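(* Let $0\le j<k<n$ be integers, $1\le p\le\infty$, $1/p+1/p'=1$, let $\mu\in\mathbb{R}$ satisfy $\mu>k-n/p-j/p'$, and put $\nu=\mu-(k-j)/p'$. Then the $j$-plane to $k$-plane transform $R_{j,k}$ is a linear bounded operator from $L^p_\mu(\Pi_{n,j})$ to $L^p_\nu(\Pi_{n,k})$ with operator norm $$\|R_{j,k}\|=\pi^{(k-j)/2}\left(\frac{\sigma_{n-k-1}}{\sigma_{n-j-1}}\right)^{1/p}\frac{\Gamma\big((\mu+n/p-k+j/p')/2\big)}{\Gamma\big((\mu+n/p-j/p)/2\big)}.$$
   Context: For $0\le m\le n-1$, $G_{n,m}$ is the Grassmann manifold of $m$-dimensional linear subspaces $\xi$ of $\mathbb{R}^n$, with its $O(n)$-invariant probability measure $d\xi$. $\Pi_{n,m}$ is the manifold of all non-oriented affine $m$-planes $\tau$ in $\mathbb{R}^n$ ($\Pi_{n,0}=\mathbb{R}^n$); each $\tau$ is parameterized by a pair $(\xi,u)$ with $\xi\in G_{n,m}$, $u\in\xi^\perp$ (so $\tau=\xi+u$), and $\Pi_{n,m}$ carries the measure $d\tau=d\xi\,du$, where $du$ is Lebesgue measure on $\xi^\perp$. $|\tau|=|u|$ is the Euclidean distance from $\tau$ to the origin. $L^p_\nu(\Pi_{n,m})$ is the space of measurable functions $\varphi$ with $\|\varphi\|_{p,\nu}=\|\,|\tau|^\nu\varphi\,\|_{L^p(\Pi_{n,m},d\tau)}<\infty$. The $j$-plane to $k$-plane transform takes a function $f(\zeta)=f(\eta,v)$ on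 $\Pi_{n,j}$ ($\eta\in G_{n,j}$, $v\in\eta^\perp$) to the function on $\Pi_{n,k}$ given by $$(R_{j,k}f)(\xi,u)=\int_{\eta\subset\xi}d_\xi\eta\int_{\eta^\perp\cap\xi}f(\eta,y+u)\,dy,$$ where $d_\xi\eta$ is the (orthogonally invariant) probability measure on the manifold of all $j$-dimensional linear subspaces $\eta$ of $\xi$ and $dy$ is Lebesgue measure on $\eta^\perp\cap\xi$. $\sigma_{m-1}=2\pi^{m/2}/\Gamma(m/2)$ is the area of the unit sphere $S^{m-1}$ in $\mathbb{R}^m$ ($\sigma_0=2$). Convention: $1/\infty=0$. *)

(* Defs.v *)
From HB Require Import structures.
From mathcomp Require Import all_boot all_order all_algebra.
From mathcomp Require Import all_classical all_reals all_analysis.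
From mathcomp Require Import measurable_realfun.

Set Implicit Arguments.
Unset Strict Implicit.
Unset Printing Implicit Defensive.

Import Order.TTheory GRing.Theory Num.Theory.
Import numFieldNormedType.Exports.

Local Open Scope classical_set_scope.
Local Open Scope ring_scope.

Section euclid.
Context {R : realType}.

Definition dot n (u v : 'rV[R]_n) : R := (u *m v^T) 0 0.

(* The library norm on ['rV_n] is the sup norm. *)
Definition enorm n (u : 'rV[R]_n) : R := Num.sqrt (dot u u).

Definition basis_mx n (V : {vspace 'rV[R]_n}) : 'M[R]_(\dim V, n) :=
  \matrix_(i < \dim V) (vbasis V)`_i.

Definition orthv n (V : {vspace 'rV[R]_n}) : {vspace 'rV[R]_n} :=
  lker (linfun (mulmxr (basis_mx V)^T)).

Lemma dotE n (u v : 'rV[R]_n) : dot u v = \sum_i u 0 i * v 0 i.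
Proof. by rewrite /dot mxE; apply: eq_bigr => i _; rewrite mxE. Qed.

Lemma dotC n (u v : 'rV[R]_n) : dot u v = dot v u.
Proof. by rewrite !dotE; apply: eq_bigr => i _; rewrite mulrC. Qed.

Lemma dot_eq0 n (u : 'rV[R]_n) : dot u u = 0 -> u = 0.
Proof.
rewrite dotE => /eqP; rewrite psumr_eq0; last by move=> i _; rewrite -expr2 sqr_ge0.
move=> /allP u0; apply/rowP => i; rewrite mxE.
by have := u0 i; rewrite mem_index_enum mulf_eq0 orbb => /(_ isT)/eqP.
Qed.

Lemma memv_orthP n (V : {vspace 'rV[R]_n}) u :
  reflect (forall v, v \in V -> dot u v = 0) (u \in orthv V).
Proof.
rewrite memv_ker lfunE /=; apply: (iffP eqP) => [uV v vV|uV].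
  rewrite (coord_vbasis vV) /dot linear_sum mulmx_sumr summxE big1// => i _.
  rewrite linearZ/= -scalemxAr mxE.
  have /rowP/(_ i) := uV; rewrite mxE [X in _ = X]mxE => e.
  rewrite [X in _ * X](_ : _ = 0) ?mulr0// -[RHS]e mxE.
  by apply: eq_bigr => l _; rewrite !mxE.
apply/rowP => i; rewrite [RHS]mxE.
have := uV _ (vbasis_mem (mem_nth 0 _ : (vbasis V)`_i \in vbasis V)).
rewrite size_tuple ltn_ord => /(_ isT) <-.
by rewrite /dot !mxE; apply: eq_bigr => l _; rewrite !mxE.
Qed.

Lemma capv_orthv n (V : {vspace 'rV[R]_n}) : (V :&: orthv V = 0)%VS.
Proof.
apply/eqP; rewrite -subv0; apply/subvP => u; rewrite memv_cap memv0 => /andP[uV].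
by move=> /memv_orthP/(_ _ uV)/dot_eq0 ->.
Qed.

Lemma addv_orthv n (V : {vspace 'rV[R]_n}) : (V + orthv V = fullv)%VS.
Proof.
apply/eqP; rewrite eqEdim subvf /= dimv_disjoint_sum ?capv_orthv//.
rewrite -(limg_ker_dim (linfun (mulmxr (basis_mx V)^T)) fullv) capfv addnC.
by rewrite leq_add2r (leq_trans (dimvS (subvf _)))// dimvf /dim/= mul1n.
Qed.

(* Orthogonal projection onto [V], acting on row vectors by [u *m orthproj V]. *)
Definition orthproj n (V : {vspace 'rV[R]_n}) : 'M[R]_n :=
  lin1_mx (daddv_pi V (orthv V)).

Lemma orthproj_orthv n (V : {vspace 'rV[R]_n}) :
  orthproj (orthv V) = 1%:M - orthproj V.
Proof.
apply/row_matrixP => i; rewrite !rowE mulmxBr mulmx1 !mul_rV_lin1.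
set u := delta_mx 0 i.
have sub : (V <= orthv (orthv V))%VS.
  apply/subvP => v vV; apply/memv_orthP => w /memv_orthP wV.
  by rewrite dotC wV.
have uE : daddv_pi V (orthv V) u + daddv_pi (orthv V) V u = u.
  by rewrite daddv_pi_add ?capv_orthv// addv_orthv memvf.
have cap : (orthv V :&: orthv (orthv V) = 0)%VS by exact: capv_orthv.
rewrite -[in LHS]uE linearD/=.
rewrite [X in _ + X]daddv_pi_id ?memv_pi// [X in X + _](_ : _ = 0).
  by rewrite add0r -[X in _ = X - _]uE addrAC subrr add0r.
have aO : daddv_pi V (orthv V) u \in orthv (orthv V) := subvP sub _ (memv_pi _ _ _).
have := daddv_pi_add cap (subvP (addvSr (orthv V) _) _ aO).
rewrite [X in _ + X]daddv_pi_id// 1?capvC//.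
by move/(canRL (addrK _)) => ->; rewrite subrr.
Qed.

End euclid.

Section measurable_matrix.
Context {R : realType}.
Variables m n : nat.

Definition mx_coord_sets : set (set 'M[R]_(m, n)) :=
  \bigcup_(ij in [set: 'I_m * 'I_n])
    preimage_set_system setT (fun A : 'M[R]_(m, n) => A ij.1 ij.2) measurable.

Definition mx_display : measure_display. Proof. exact: (sigma_display mx_coord_sets). Qed.

Let mx0 : <<s mx_coord_sets >> set0.
Proof. exact: sigma_algebra0. Qed.
Let mxC A : <<s mx_coord_sets >> A -> <<s mx_coord_sets >> (~` A).
Proof. exact: sigma_algebraC. Qed.
Let mxU (F : (set 'M[R]_(m, n))^nat) : (forall i, <<s mx_coord_sets >> (F i)) ->
  <<s mx_coord_sets >> (\bigcup_i F i).
Proof. exact: sigma_algebra_bigcup. Qed.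

HB.instance Definition _ := @isMeasurable.Build mx_display 'M[R]_(m, n)
  <<s mx_coord_sets >> mx0 mxC mxU.

Lemma measurable_coord i j :
  measurable_fun [set: 'M[R]_(m, n)] (fun A : 'M[R]_(m, n) => A i j).
Proof.
move=> _ Y mY; apply: sub_sigma_algebra.
by exists (i, j) => //; exists Y.
Qed.

Lemma measurable_mxP d (T : measurableType d) (f : T -> 'M[R]_(m, n)) :
  measurable_fun setT f <-> forall i j, measurable_fun setT (fun x => f x i j).
Proof.
split=> [mf i j|mf]; first exact: measurableT_comp (measurable_coord i j) mf.
apply: (measurability mx_coord_sets) => // _ [_ [[i j] _ [Y mY <-]] <-].
by rewrite !setTI; have := mf i j measurableT Y mY; rewrite setTI.
Qed.

End measurable_matrix.

Section measurable_subspaces.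
Context {R : realType}.
Variable n : nat.
Local Notation vspR := {vspace 'rV[R]_n}.

HB.instance Definition _ := isPointed.Build vspR 0%VS.

Definition vspace_display : measure_display.
Proof. exact: (preimage_display (@orthproj R n)). Qed.

Let vs0 : g_sigma_algebra_preimage (@orthproj R n) set0.
Proof. exact: (@measurable0 _ (g_sigma_algebra_preimageType (@orthproj R n))). Qed.
Let vsC A : g_sigma_algebra_preimage (@orthproj R n) A ->
  g_sigma_algebra_preimage (@orthproj R n) (~` A).
Proof. exact: (@measurableC _ (g_sigma_algebra_preimageType (@orthproj R n))). Qed.
Let vsU (F : (set vspR)^nat) :
  (forall i, g_sigma_algebra_preimage (@orthproj R n) (F i)) ->
  g_sigma_algebra_preimage (@orthproj R n) (\bigcup_i F i).
Proof.
by move=> mF; apply: (@bigcupT_measurable _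
  (g_sigma_algebra_preimageType (@orthproj R n))).
Qed.

(* The topology of the Grassmannians is the one induced by the embedding
   [V |-> orthproj V] into the space of matrices. *)
HB.instance Definition _ := @isMeasurable.Build vspace_display vspR
  (g_sigma_algebra_preimage (@orthproj R n)) vs0 vsC vsU.

Lemma measurable_orthproj : measurable_fun [set: vspR] (@orthproj R n).
Proof. by move=> _ Y mY; exists Y. Qed.

Lemma measurable_orthv : measurable_fun [set: vspR] (@orthv R n).
Proof.
move=> _ _ [Y mY <-]; rewrite !setTI -comp_preimage.
have mf : measurable_fun [set: vspR] (fun V : vspR => 1%:M - orthproj V).
  apply/measurable_mxP => i j.
  rewrite (_ : (fun V => _) = fun V : vspR => 1%:M i j - orthproj V i j).
    apply: measurable_funB; first exact: measurable_cst.
    exact: measurableT_comp (measurable_coord i j) measurable_orthproj.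
  by apply/funext => V; rewrite [LHS]mxE [X in _ + X = _]mxE.
rewrite (_ : _ \o _ = fun V : vspR => 1%:M - orthproj V).
  by rewrite -[X in measurable X]setTI; exact: mf.
by apply/funext => V /=; rewrite orthproj_orthv.
Qed.

End measurable_subspaces.

Section image_measure.
Context d d' (T : measurableType d) (T' : measurableType d') (R : realType).
Variables (m : {measure set T -> \bar R}) (f : {mfun T >-> T'}).

Definition image_measure : set T' -> \bar R := pushforward m f.

Let im0 : image_measure set0 = 0%E.
Proof. exact: measure0. Qed.
Let im_ge0 A : (0 <= image_measure A)%E.
Proof. exact: measure_ge0. Qed.
Let im_sigma_additive : semi_sigma_additive image_measure.
Proof. exact: measure_semi_sigma_additive. Qed.

HB.instance Definition _ :=
  isMeasure.Build _ _ _ image_measure im0 im_ge0 im_sigma_additive.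

End image_measure.

Section lebesgue_rV.
Context {R : realType}.

Definition rV_cons d (x : measurableTypeR R * 'rV[R]_d) : 'rV[R]_d.+1 :=
  row_mx (const_mx x.1 : 'rV_1) x.2.

Lemma measurable_rV_cons d : measurable_fun setT (@rV_cons d).
Proof.
apply/measurable_mxP => i j; rewrite /rV_cons; under eq_fun do rewrite mxE.
case: (@fintype.split 1 d j) => k; first under eq_fun do rewrite mxE.
  exact: measurable_fst.
exact: measurableT_comp (measurable_coord _ _) measurable_snd.
Qed.

HB.instance Definition _ d := isMeasurableFun.Build _ _ _ _
  (@rV_cons d) (@measurable_rV_cons d).

Section step.
Variables (d : nat) (m : {sigma_finite_measure set 'rV[R]_d -> \bar R}).

Definition lebesgue_rV_step : set 'rV[R]_d.+1 -> \bar R :=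
  image_measure (lebesgue_measure \x m)%E (@rV_cons d).

HB.instance Definition _ := Measure.on lebesgue_rV_step.

Let uncons (v : 'rV[R]_d.+1) : measurableTypeR R * 'rV[R]_d :=
  (v 0 0, @rsubmx R 1 1 d v).

Let unconsK : cancel uncons (@rV_cons d).
Proof.
move=> v; rewrite /rV_cons/= -[RHS](@hsubmxK R 1 1 d v).
apply: (congr1 (fun a => @row_mx R 1 1 d a (@rsubmx R 1 1 d v))).
by apply/rowP => i; rewrite !mxE; congr (v _ _); apply/val_inj; rewrite /= ord1.
Qed.

Let consK : cancel (@rV_cons d) uncons.
Proof.
move=> [x v]; rewrite /uncons/rV_cons/= row_mxKr; congr pair.
by rewrite mxE; case: splitP => [i _|//]; rewrite mxE.
Qed.

Let measurable_uncons : measurable_fun setT uncons.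
Proof.
apply: measurable_fun_pair; first exact: measurable_coord.
apply/measurable_mxP => i j; under eq_fun do rewrite mxE.
exact: measurable_coord.
Qed.

Let step_sigma_finite : sigma_finite setT lebesgue_rV_step.
Proof.
have [H HT mH] : sigma_finite setT (lebesgue_measure \x m)%E.
  have /sigma_finiteP[F [FT ndF Foo]] := sigma_finiteT (@lebesgue_measure R).
  have /sigma_finiteP[G [GT ndG Goo]] := sigma_finiteT m.
  exists (fun i => F i `*` G i) => [|i].
    rewrite -setXTT FT GT; apply/seteqP; split=> [[x y]|[x y] [i _ [Fx Gy]]].
      move=> [/= [a _ Fx] [b _ Gy]]; exists (maxn a b) => //; split => /=.
        by move: (x) Fx; exact/subsetPset/ndF/leq_maxl.
      by move: (y) Gy; exact/subsetPset/ndG/leq_maxr.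
    by split; exists i.
  have [mF Fi] := Foo i; have [mG Gi] := Goo i.
  split; first exact: measurableX.
  by rewrite product_measure1E// lte_mul_pinfty// ge0_fin_numE.
exists (fun i => uncons @^-1` H i) => [|i].
  by rewrite -preimage_bigcup -HT preimage_setT.
have [mHi Hoo] := mH i; split.
  by rewrite -[X in measurable X]setTI; exact: measurable_uncons.
rewrite /lebesgue_rV_step /image_measure /pushforward -comp_preimage.
by rewrite (_ : _ \o _ = id) ?preimage_id//; apply/funext => x /=; rewrite consK.
Qed.

HB.instance Definition _ :=
  Measure_isSigmaFinite.Build _ _ _ lebesgue_rV_step step_sigma_finite.

End step.

Fixpoint lebesgue_rV d : {sigma_finite_measure set 'rV[R]_d -> \bar R} :=
  match d with
  | 0 => @dirac _ 'rV[R]_0 0 R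
  | d'.+1 => lebesgue_rV_step (lebesgue_rV d')
  end.

End lebesgue_rV.

Section lebesgue_subspace.
Context {R : realType}.
Variables n d : nat.

Definition orthonormal_frame (V : {vspace 'rV[R]_n}) (B : 'M[R]_(d, n)) : Prop :=
  B *m B^T = 1%:M /\ forall i, row i B \in V.

(* A measurable choice of an orthonormal basis in each [d]-dimensional subspace;
   by rotation invariance of Lebesgue measure the measures below do not depend
   on it, and its measurability makes [plane_measure] a measure. *)
Definition frame : {mfun {vspace 'rV[R]_n} >-> 'M[R]_(d, n)} :=
  xget (cst 0 : {mfun {vspace 'rV[R]_n} >-> 'M[R]_(d, n)}) [set B : {mfun {vspace 'rV[R]_n} >-> 'M[R]_(d, n)} |
    forall V : {vspace 'rV[R]_n}, \dim V = d -> orthonormal_frame V (B V)].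

Lemma measurable_mulmx dT (T : measurableType dT) m
    (f : T -> 'M[R]_(m, d)) (g : T -> 'M[R]_(d, n)) :
  measurable_fun setT f -> measurable_fun setT g ->
  measurable_fun setT (fun x => f x *m g x).
Proof.
move=> mf mg; apply/measurable_mxP => i j; under eq_fun do rewrite mxE.
apply: measurable_sum => l; apply: measurable_funM.
  exact: measurableT_comp (measurable_coord i l) mf.
exact: measurableT_comp (measurable_coord l j) mg.
Qed.

Definition frame_map (V : {vspace 'rV[R]_n}) (t : 'rV[R]_d) : 'rV[R]_n :=
  t *m frame V.

Lemma measurable_frame_map V : measurable_fun setT (frame_map V).
Proof. by apply: measurable_mulmx => //; exact: measurable_cst. Qed.

HB.instance Definition _ V := isMeasurableFun.Build _ _ _ _
  (frame_map V) (@measurable_frame_map V).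

(* Lebesgue measure on a [d]-dimensional subspace [V], as a measure on R^n
   carried by [V]. *)
Definition lebesgue_subspace (V : {vspace 'rV[R]_n}) : set 'rV[R]_n -> \bar R :=
  image_measure (lebesgue_rV d) (frame_map V).

HB.instance Definition _ V := Measure.on (lebesgue_subspace V).

End lebesgue_subspace.

Arguments frame {R n} d.
Arguments lebesgue_subspace {R n} d V.

Section planes.
Context {R : realType} {n : nat}.
Local Notation vspR := {vspace 'rV[R]_n}.

Definition grassmann (V : vspR) (m : nat) : set vspR :=
  [set eta | (eta <= V)%VS /\ \dim eta = m].

Definition rotate (g : 'M[R]_n) (V : vspR) : vspR :=
  (linfun (mulmxr g : 'rV[R]_n -> 'rV[R]_n) @: V)%VS.

(* The orthogonal group of [V] consists of the restrictions to [V] of the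
   orthogonal matrices that stabilize [V]. *)
Definition invariant_grassmann_measure (V : vspR) (m : nat)
    (P : probability vspR R) : Prop :=
  P (grassmann V m) = 1%E /\
  forall g : 'M[R]_n, g *m g^T = 1%:M -> rotate g V = V ->
  forall A : set vspR, measurable A -> P (rotate g @^-1` A) = P A.

Definition grassmann_measure (V : vspR) (m : nat) : probability vspR R :=
  get (invariant_grassmann_measure V m).

(* The affine [m]-plane [xi + u] is encoded by the pair [(xi, u)]. *)
Definition planes (m : nat) : set (vspR * 'rV[R]_n) :=
  [set tau | \dim tau.1 = m /\ tau.2 \in orthv tau.1].

Definition plane_param (m : nat) (x : vspR * 'rV[R]_(n - m)) : vspR * 'rV[R]_n :=
  (x.1, frame_map (orthv x.1) x.2).

Lemma measurable_plane_param m : measurable_fun setT (@plane_param m).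
Proof.
apply: measurable_fun_pair; first exact: measurable_fst.
apply: measurable_mulmx; first exact: measurable_snd.
apply: measurableT_comp => //.
exact: measurableT_comp (@measurable_orthv R n) measurable_fst.
Qed.

HB.instance Definition _ m := isMeasurableFun.Build _ _ _ _
  (@plane_param m) (@measurable_plane_param m).

Definition plane_measure (m : nat) : set (vspR * 'rV[R]_n) -> \bar R :=
  image_measure (grassmann_measure fullv m \x lebesgue_rV (n - m))%E
    (@plane_param m).

HB.instance Definition _ m := Measure.on (plane_measure m).

Lemma plane_measureE m (A : set (vspR * 'rV[R]_n)) :
  plane_measure m A = (\int[grassmann_measure fullv m]_xi
    lebesgue_subspace (n - m) (orthv xi) (xsection A xi))%E.
Proof.
by apply: eq_integral => xi _ /=; rewrite /lebesgue_subspace /image_measure.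
Qed.

Definition weighted_norm (m : nat) (p : \bar R) (nu : R)
    (phi : vspR * 'rV[R]_n -> R) : \bar R :=
  'N[plane_measure m]_p[
    (fun tau => (enorm tau.2 `^ nu * phi tau)%:E) \_ (planes m)].

Definition weighted_Lp (m : nat) (p : \bar R) (nu : R) :
    set (vspR * 'rV[R]_n -> R) :=
  [set phi | measurable_fun (planes m) phi /\
             (weighted_norm m p nu phi < +oo)%E].

Definition bounded_linear_operator (j k : nat) (p : \bar R) (mu nu : R)
    (T : (vspR * 'rV[R]_n -> R) -> (vspR * 'rV[R]_n -> R)) : Prop :=
  [/\ forall f, weighted_Lp j p mu f -> weighted_Lp k p nu (T f),
      forall f g, weighted_Lp j p mu f -> weighted_Lp j p mu g ->
        f = g %[ae plane_measure j] -> T f = T g %[ae plane_measure k],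
      forall (a : R) f g, weighted_Lp j p mu f -> weighted_Lp j p mu g ->
        T (fun tau => a * f tau + g tau) = (fun tau => a * T f tau + T g tau)
          %[ae plane_measure k] &
      exists C : R, forall f, weighted_Lp j p mu f ->
        (weighted_norm k p nu (T f) <= C%:E * weighted_norm j p mu f)%E].

Definition operator_norm (j k : nat) (p : \bar R) (mu nu : R)
    (T : (vspR * 'rV[R]_n -> R) -> (vspR * 'rV[R]_n -> R)) : \bar R :=
  ereal_sup [set weighted_norm k p nu (T f) | f in
    [set f | weighted_Lp j p mu f /\ (weighted_norm j p mu f <= 1)%E]].

Definition radon_integral (j k : nat) (f : vspR * 'rV[R]_n -> R)
    (tau : vspR * 'rV[R]_n) : \bar R :=
  (\int[grassmann_measure tau.1 j]_(eta in grassmann tau.1 j)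
   \int[lebesgue_subspace (k - j) (orthv eta :&: tau.1)%VS]_
       (y in [set y | y \in (orthv eta :&: tau.1)%VS])
     (f (eta, y + tau.2))%:E)%E.

Definition radon_converges (j k : nat) (f : vspR * 'rV[R]_n -> R)
    (tau : vspR * 'rV[R]_n) : Prop :=
  (radon_integral j k (fun zeta => `|f zeta|%R) tau < +oo)%E.

Definition radon (j k : nat) (f : vspR * 'rV[R]_n -> R)
    (tau : vspR * 'rV[R]_n) : R :=
  fine (radon_integral j k f tau).

End planes.

Section constants.
Context {R : realType}.

Definition Gamma (x : R) : R :=
  \int[lebesgue_measure]_(t in `]0, +oo[) (t `^ (x - 1) * expR (- t)).

(* Area of the unit sphere [S^d] in R^(d+1). *)
Definition sphere_area (d : nat) : R :=
  2 * pi `^ (d.+1%:R / 2) / Gamma (d.+1%:R / 2).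

(* [1/p], with [1/oo = 0]. *)
Definition recip (p : \bar R) : R := fine (p^-1)%E.

End constants.

(* Main.v *)
(* All invariant integrals are pulled back to rotation groups: if [h] is distributed
   according to Haar measure on the rotations of [V], then the image of a fixed
   subspace of [V] under [h] is uniformly distributed among the subspaces of [V] of
   that dimension.  With [d = k - j] and [I a] the integral of [(1 + |w|^2)^(-a/2)]
   over R^d, which equals [pi^(d/2) Gamma((a-d)/2) / Gamma(a/2)], two identities
   follow, for radial integrands by scaling and then in general by averaging:
   (A) for f >= 0, the integral of |tau|^l R f(tau) over the k-planes is
       sigma_(n-k-1) / sigma_(n-j-1) * I(n - j + l) times the integral of
       |zeta|^l f(zeta) over the j-planes;
   (B) R(|zeta|^(-a))(tau) = |tau|^(d-a) I a.
   Put a = mu + (n - j)/p; the hypothesis on mu says a > d.  For p < oo, Hoelder's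
   inequality inside R with the weight |zeta|^(-a), (B) for one factor and (A) for
   the p-th power of the other give the upper bound.  It is approached by
   |zeta|^(-a-eps) restricted to |zeta| >= 1 as eps -> 0.  For p = oo, |zeta|^(-mu)
   is extremal by (B), and (A) with l = 0 disposes of null sets. *)

Require Import Defs.
From HB Require Import structures.
From mathcomp Require Import all_boot all_order all_algebra.
From mathcomp Require Import all_classical all_reals all_analysis.
From mathcomp Require Import measurable_realfun ess_sup_inf ring lra.

Set Implicit Arguments.
Unset Strict Implicit.
Unset Printing Implicit Defensive.

Import Order.TTheory GRing.Theory Num.Theory.
Import numFieldNormedType.Exports.

Local Open Scope classical_set_scope.
Local Open Scope ring_scope.

(** * Integration on the line and on spaces of row vectors *)

Section integration_tools.
Local Open Scope ereal_scope.
Context {R : realType}.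

(** The exponent a comes from asking that Hoelder's inequality and (A) produce the same value of I.
    After Hoelder and (B) the power of |tau| left over is l = mu p - a (p - 1); (A) then contributes
    I(n - j + l), and n - j + l = a holds exactly for a = mu + (n - j)/p, so that I(a)^(p-1) and
    I(a) multiply to I(a)^p. Two obstacles shape the rest. The invariant measure on a Grassmannian
    is a mere choice among the probabilities with the invariance property, so existence and
    uniqueness must be shown; both come from a Haar measure built by induction on the dimension, one
    Householder reflection at a time. And the measures inside the transform vary with tau, which
    hides measurability in tau; a measurable rotation carrying a fixed subspace onto the direction
    of tau turns them into one fixed product measure. Polar integration is obtained from uniqueness:
    a functional of the radius that is invariant under dilations is a multiple of integration
    against dr/r, and a Gaussian determines the multiple. The constants sigma and Gamma enter in
    this way. *)

Lemma ge0_integral_image d d' (T : measurableType d) (T' : measurableType d')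
    (m : {measure set T -> \bar R}) (f : {mfun T >-> T'}) (F : T' -> \bar R) :
  measurable_fun setT F -> (forall y, 0 <= F y) ->
  \int[image_measure m f]_y F y = \int[m]_x F (f x).
Proof. by move=> mF F0; rewrite [LHS]ge0_integral_pushforward. Qed.

Lemma integral_image d d' (T : measurableType d) (T' : measurableType d')
    (m : {measure set T -> \bar R}) (f : {mfun T >-> T'}) (F : T' -> \bar R) :
  measurable_fun setT F ->
  \int[image_measure m f]_y F y = \int[m]_x F (f x).
Proof.
move=> mF.
transitivity (\int[image_measure m f]_y F^\+ y - \int[image_measure m f]_y F^\- y).
  exact: integralE.
rewrite !ge0_integral_image//; [|exact: measurable_funeneg|exact: measurable_funepos].
rewrite [RHS]integralE; congr (_ - _); apply: eq_integral => x _.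
  by rewrite !funeposE.
by rewrite !funenegE.
Qed.

Lemma tonelli d1 d2 (T1 : measurableType d1) (T2 : measurableType d2)
    (m1 : {sigma_finite_measure set T1 -> \bar R})
    (m2 : {sigma_finite_measure set T2 -> \bar R}) (f : T1 -> T2 -> \bar R) :
  measurable_fun setT (fun z : T1 * T2 => f z.1 z.2) ->
  (forall x y, 0 <= f x y) ->
  \int[m1]_x \int[m2]_y f x y = \int[m2]_y \int[m1]_x f x y.
Proof.
by move=> mf f0; rewrite (@fubini_tonelli _ _ _ _ _ m1 m2 (fun z => f z.1 z.2)).
Qed.

Lemma measurable_integral_ge0 d1 d2 (T1 : measurableType d1) (T2 : measurableType d2)
    (m2 : {sigma_finite_measure set T2 -> \bar R}) (f : T1 -> T2 -> \bar R) :
  measurable_fun setT (fun z : T1 * T2 => f z.1 z.2) ->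
  (forall x y, 0 <= f x y) ->
  measurable_fun setT (fun x => \int[m2]_y f x y).
Proof.
move=> mf f0.
exact: (@measurable_fun_fubini_tonelli_F _ _ _ _ _ m2 (fun z => f z.1 z.2)).
Qed.

Lemma ge0_integralTZl d (T : measurableType d) (m : {measure set T -> \bar R})
    (f : T -> \bar R) (k : \bar R) :
  measurable_fun setT f -> (forall x, 0 <= f x) -> 0 <= k ->
  \int[m]_x (k * f x) = k * \int[m]_x f x.
Proof. by move=> mf f0 k0; rewrite ge0_integralZl. Qed.

Lemma ge0_integralTZr d (T : measurableType d) (m : {measure set T -> \bar R})
    (f : T -> \bar R) (k : \bar R) :
  measurable_fun setT f -> (forall x, 0 <= f x) -> 0 <= k ->
  \int[m]_x (f x * k) = (\int[m]_x f x) * k.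
Proof. by move=> mf f0 k0; rewrite ge0_integralZr. Qed.

End integration_tools.

(** * Translations and dilations of the line *)

Section lebesgue_line.
Local Open Scope ereal_scope.
Context {R : realType}.
Local Notation leb := (@lebesgue_measure R).
Implicit Types (F : R -> \bar R) (c : R).

Lemma lebesgue_measureD c (A : set R) : measurable A ->
  pushforward leb (fun x : measurableTypeR R => (c + x)%R : measurableTypeR R) A
    = leb A.
Proof.
move=> mA; apply/esym.
have mc : measurable_fun [set: measurableTypeR R] (fun x : measurableTypeR R => (c + x)%R : measurableTypeR R).
  by apply: measurable_funD => //; exact: measurable_cst.
pose f : {mfun measurableTypeR R >-> measurableTypeR R} :=
  HB.pack (fun x : measurableTypeR R => (c + x)%R : measurableTypeR R)
    (isMeasurableFun.Build _ _ _ _ _ mc).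
apply: (@lebesgue_measure_unique R (image_measure leb f)) => //= _ [[a b]] _ <-.
rewrite /image_measure /pushforward /=.
rewrite (_ : _ @^-1` _ = `]a - c, b - c]%classic)%R.
  rewrite !lebesgue_measure_itv/= !lte_fin ltrD2r.
  by case: ifPn => // _; rewrite -!EFinB; congr (_%:E); ring.
by apply/seteqP; split => x /=; rewrite !in_itv/= ltrBlDl lerBrDl.
Qed.

Lemma ge0_integral_shift c F : measurable_fun setT F -> (forall x, 0 <= F x) ->
  \int[leb]_x F (c + x)%R = \int[leb]_x F x.
Proof.
move=> mF F0.
have mc : measurable_fun [set: measurableTypeR R] (fun x : measurableTypeR R => (c + x)%R : measurableTypeR R).
  by apply: measurable_funD => //; exact: measurable_cst.
rewrite -(ge0_integral_pushforward mc _ measurableT)//.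
by apply: eq_measure_integral => //= A mA _; rewrite -[RHS](lebesgue_measureD c).
Qed.

Lemma ge0_integral_scale c F : (0 < c)%R ->
  measurable_fun setT F -> (forall x, 0 <= F x) ->
  \int[leb]_x F (c * x)%R = (c^-1)%:E * \int[leb]_x F x.
Proof.
move=> c0 mF F0.
have mc : measurable_fun [set: measurableTypeR R] (fun x : measurableTypeR R => (c * x)%R : measurableTypeR R).
  by apply: measurable_funM => //; exact: measurable_cst.
pose f : {mfun measurableTypeR R >-> measurableTypeR R} :=
  HB.pack (fun x : measurableTypeR R => (c * x)%R : measurableTypeR R)
    (isMeasurableFun.Build _ _ _ _ _ mc).
have ci0 : (0 <= c)%R by rewrite ltW.
(* [c] times the image measure gives half-open intervals their length, and this determines Lebesgue
   measure. *)
have key : forall A, measurable A ->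
    leb A = mscale (NngNum ci0) (image_measure leb f) A.
  move=> A mA; apply: lebesgue_measure_unique => //= _ [[a b]] _ <-.
  rewrite /mscale /image_measure /pushforward /=.
  rewrite (_ : _ @^-1` _ = `]a / c, b / c]%classic)%R.
    rewrite !lebesgue_measure_itv/= !lte_fin ltr_pM2r ?invr_gt0//.
    case: ifPn => _; last by rewrite mule0.
    by rewrite -!EFinM -EFinB mulrBr ![(c * _)%R]mulrC !divfK ?gt_eqF.
  by apply/seteqP; split => x /=; rewrite !in_itv/= ltr_pdivrMr// ler_pdivlMr// ![(x * c)%R]mulrC.
have -> : \int[leb]_x F x = c%:E * \int[leb]_x F (c * x)%R.
  rewrite -(ge0_integral_pushforward mc _ measurableT)//.
  rewrite -(@ge0_integral_mscale _ _ _ (image_measure leb f) _ _ (NngNum ci0))//.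
  by apply: eq_measure_integral => //= A mA _; rewrite key.
by rewrite muleA -EFinM mulVf ?gt_eqF// mul1e.
Qed.

End lebesgue_line.

(** * Measurability of matrix operations *)

Section measurable_matrix_operations.
Context {R : realType} d (T : measurableType d).

Lemma measurable_trmx m n (f : T -> 'M[R]_(m, n)) :
  measurable_fun setT f -> measurable_fun setT (fun x => (f x)^T).
Proof.
move=> /measurable_mxP mf; apply/measurable_mxP => i j.
by under eq_fun do rewrite mxE; exact: mf.
Qed.

Lemma measurable_addmx m n (f g : T -> 'M[R]_(m, n)) :
  measurable_fun setT f -> measurable_fun setT g ->
  measurable_fun setT (fun x => f x + g x).
Proof.
move=> /measurable_mxP mf /measurable_mxP mg; apply/measurable_mxP => i j.
by under eq_fun do rewrite mxE; exact: measurable_funD.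
Qed.

Lemma measurable_scalemx m n (c : T -> R) (f : T -> 'M[R]_(m, n)) :
  measurable_fun setT c -> measurable_fun setT f ->
  measurable_fun setT (fun x => c x *: f x).
Proof.
move=> mc /measurable_mxP mf; apply/measurable_mxP => i j.
by under eq_fun do rewrite mxE; exact: measurable_funM.
Qed.

Lemma measurable_subrmx m n (f g : T -> 'M[R]_(m, n)) :
  measurable_fun setT f -> measurable_fun setT g ->
  measurable_fun setT (fun x => f x - g x).
Proof.
move=> /measurable_mxP mf /measurable_mxP mg; apply/measurable_mxP => i j.
rewrite (_ : (fun x => _) = fun x => f x i j - g x i j); first exact: measurable_funB.
by apply/funext => x; rewrite !mxE.
Qed.

Lemma measurable_col_mx m1 m2 n (f : T -> 'M[R]_(m1, n)) (g : T -> 'M[R]_(m2, n)) :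
  measurable_fun setT f -> measurable_fun setT g ->
  measurable_fun setT (fun x => col_mx (f x) (g x)).
Proof.
move=> /measurable_mxP mf /measurable_mxP mg; apply/measurable_mxP => i j.
under eq_fun do rewrite mxE.
by case: (fintype.split i) => k; [exact: mf|exact: mg].
Qed.

Lemma measurable_row n m (i : 'I_m) (f : T -> 'M[R]_(m, n)) :
  measurable_fun setT f -> measurable_fun setT (fun x => row i (f x)).
Proof.
move=> /measurable_mxP mf; apply/measurable_mxP => k j.
by under eq_fun do rewrite mxE; exact: mf.
Qed.

Lemma measurable_dot n (f g : T -> 'rV[R]_n) :
  measurable_fun setT f -> measurable_fun setT g ->
  measurable_fun setT (fun x => dot (f x) (g x)).
Proof.
move=> /measurable_mxP mf /measurable_mxP mg.
by under eq_fun do rewrite dotE; apply: measurable_sum => i; exact: measurable_funM.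
Qed.

Lemma measurable_sqrtr (f : T -> R) :
  measurable_fun setT f -> measurable_fun setT (fun x => Num.sqrt (f x)).
Proof.
by apply: measurableT_comp; apply: continuous_measurable_fun; exact: sqrt_continuous.
Qed.

Lemma measurable_enorm n (f : T -> 'rV[R]_n) :
  measurable_fun setT f -> measurable_fun setT (fun x => enorm (f x)).
Proof. by move=> mf; apply: measurable_sqrtr; exact: measurable_dot. Qed.

Lemma measurable_eqmx m n (f g : T -> 'M[R]_(m, n)) :
  measurable_fun setT f -> measurable_fun setT g ->
  measurable [set x | f x = g x].
Proof.
move=> mf mg.
rewrite (_ : [set x | _] = \bigcap_(i in [set: 'I_m]) \bigcap_(j in [set: 'I_n])
   [set x | f x i j = g x i j]).
  apply: fin_bigcap_measurable => // i _; apply: fin_bigcap_measurable => // j _.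
  rewrite (_ : [set x | _] = (fun x => f x i j - g x i j) @^-1` [set 0]).
    rewrite -[X in measurable X]setTI.
    have : measurable_fun setT (fun x => f x i j - g x i j).
      by apply: measurable_funB; apply/(measurable_mxP _).1.
    by apply.
  by apply/seteqP; split => x /= => [->|/subr0_eq//]; rewrite subrr.
apply/seteqP; split => x /= H; first by move=> i _ j _ /=; rewrite (congr1 (fun M : 'M[R]_(m, n) => M i j) H).
by apply/matrixP => i j; exact: H.
Qed.

End measurable_matrix_operations.

(** * Scalar product and Euclidean norm *)

Section enorm.
Context {R : realType}.

Lemma dot_ge0 n (u : 'rV[R]_n) : 0 <= dot u u.
Proof. by rewrite dotE sumr_ge0// => i _; rewrite -expr2 sqr_ge0. Qed.

Lemma enorm_ge0 n (u : 'rV[R]_n) : 0 <= enorm u.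
Proof. exact: sqrtr_ge0. Qed.

Lemma enorm_sqr n (u : 'rV[R]_n) : enorm u ^+ 2 = dot u u.
Proof. by rewrite sqr_sqrtr ?dot_ge0. Qed.

Lemma enorm_eq0 n (u : 'rV[R]_n) : enorm u = 0 -> u = 0.
Proof. by move=> u0; apply: dot_eq0; rewrite -enorm_sqr u0 expr0n. Qed.

Lemma dotZ n a b (u v : 'rV[R]_n) : dot (a *: u) (b *: v) = a * b * dot u v.
Proof. by rewrite /dot linearZ/= -scalemxAr -scalemxAl !mxE mulrCA mulrA. Qed.

Lemma dotDl n (u v w : 'rV[R]_n) : dot (u + v) w = dot u w + dot v w.
Proof. by rewrite /dot mulmxDl mxE. Qed.

Lemma dotDr n (u v w : 'rV[R]_n) : dot w (u + v) = dot w u + dot w v.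
Proof. by rewrite ![dot w _]dotC dotDl. Qed.

Lemma dotNl n (u v : 'rV[R]_n) : dot (- u) v = - dot u v.
Proof. by rewrite /dot mulNmx mxE. Qed.

Lemma dotNr n (u v : 'rV[R]_n) : dot v (- u) = - dot v u.
Proof. by rewrite ![dot v _]dotC dotNl. Qed.

Lemma enormZ n a (u : 'rV[R]_n) : enorm (a *: u) = `|a| * enorm u.
Proof. by rewrite /enorm dotZ -expr2 sqrtrM ?sqr_ge0// sqrtr_sqr. Qed.

Lemma dot_mulmx m n (u v : 'rV[R]_m) (B : 'M[R]_(m, n)) :
  B *m B^T = 1%:M -> dot (u *m B) (v *m B) = dot u v.
Proof. by move=> BB; rewrite /dot trmx_mul mulmxA -(mulmxA u) BB mulmx1. Qed.

Lemma enorm_mulmx m n (u : 'rV[R]_m) (B : 'M[R]_(m, n)) :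
  B *m B^T = 1%:M -> enorm (u *m B) = enorm u.
Proof. by move=> BB; rewrite /enorm dot_mulmx. Qed.

Lemma rV_cons0 d (x : R * 'rV[R]_d) : rV_cons x 0 ord0 = x.1.
Proof. by rewrite mxE; case: splitP => // i _; rewrite mxE. Qed.

Lemma rV_consS d (x : R * 'rV[R]_d) i : rV_cons x 0 (lift ord0 i) = x.2 0 i.
Proof.
rewrite mxE; case: splitP => k /= ki; first by have := ltn_ord k; rewrite -ki.
by congr (x.2 _ _); apply/val_inj; move: ki; rewrite /bump/= !add1n => -[].
Qed.

Lemma dot_cons d (x y : R * 'rV[R]_d) :
  dot (rV_cons x) (rV_cons y) = x.1 * y.1 + dot x.2 y.2.
Proof.
rewrite !dotE big_ord_recl !rV_cons0; congr (_ + _).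
by apply: eq_bigr => i _; rewrite !rV_consS.
Qed.

End enorm.

(** * Translations, dilations and rotations of Lebesgue measure on R^d *)

Section lebesgue_rV_theory.
Local Open Scope ereal_scope.
Context {R : realType}.
Local Notation leb := (@lebesgue_measure R).
Local Notation "'λ' d" := (@lebesgue_rV R d) (at level 10).

Lemma ge0_integral_rV0 (F : 'rV[R]_0 -> \bar R) :
  measurable_fun setT F -> (forall x, 0 <= F x) ->
  \int[λ 0]_x F x = F 0%R.
Proof. by move=> mF F0; rewrite integral_dirac// diracT mul1e. Qed.

Lemma ge0_integral_rVS d (F : 'rV[R]_d.+1 -> \bar R) :
  measurable_fun setT F -> (forall x, 0 <= F x) ->
  \int[λ d.+1]_x F x = \int[leb]_a \int[λ d]_v F (rV_cons (a, v)).
Proof.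
move=> mF F0; rewrite /= [LHS]ge0_integral_image// fubini_tonelli1//.
exact: measurableT_comp.
Qed.

Lemma ge0_integral_rV_shift d c (F : 'rV[R]_d -> \bar R) :
  measurable_fun setT F -> (forall x, 0 <= F x) ->
  \int[λ d]_x F (c + x)%R = \int[λ d]_x F x.
Proof.
elim: d c F => [|d IH] c F mF F0.
  by apply: eq_integral => x _; rewrite !thinmx0.
have mFc : measurable_fun setT (fun x => F (c + x)%R).
  apply: measurableT_comp => //; apply: measurable_addmx => //.
rewrite !ge0_integral_rVS//.
pose c' := \row_k c ord0 (lift ord0 k).
have cE a v : (c + rV_cons (a, v) = rV_cons (c ord0 ord0 + a, c' + v))%R.
  apply/rowP => i; rewrite mxE; case: (unliftP ord0 i) => [k ->|->].
    by rewrite !rV_consS !mxE.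
  by rewrite !rV_cons0.
under eq_integral do under eq_integral do rewrite cE.
have mFF : measurable_fun setT (fun z : measurableTypeR R * 'rV[R]_d => F (rV_cons (z.1, z.2))).
  apply: measurableT_comp => //.
  by rewrite (_ : (fun z => _) = @rV_cons R d)//; apply/funext => -[].
rewrite -[RHS](ge0_integral_shift (c ord0 ord0)); last 2 first.
- exact: (measurable_integral_ge0 (λ d) (f := fun a v => F (rV_cons (a, v)))).
- by move=> x; exact: integral_ge0.
apply: eq_integral => a _; rewrite (IH c' (fun v => F (rV_cons (_, v))))//.
by apply: measurableT_comp => //; apply: measurableT_comp.
Qed.

Lemma ge0_integral_rV_scale d (c : R) (F : 'rV[R]_d -> \bar R) : (0 < c)%R ->
  measurable_fun setT F -> (forall x, 0 <= F x) ->
  \int[λ d]_x F (c *: x)%R = (c ^- d)%:E * \int[λ d]_x F x.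
Proof.
move=> c0; elim: d F => [|d IH] F mF F0.
  rewrite expr0 invr1 mul1e.
  by apply: eq_integral => x _; rewrite !thinmx0.
have mFc : measurable_fun setT (fun x : 'rV[R]_d.+1 => F (c *: x)%R).
  apply: measurableT_comp => //; apply: measurable_scalemx => //; exact: measurable_cst.
rewrite !ge0_integral_rVS//.
have cE a v : (c *: rV_cons (a, v) = rV_cons (c * a, c *: v))%R.
  apply/rowP => i; rewrite mxE; case: (unliftP ord0 i) => [k ->|->].
    by rewrite !rV_consS !mxE.
  by rewrite !rV_cons0.
under eq_integral do under eq_integral do rewrite cE.
have mFF : measurable_fun setT (fun z : measurableTypeR R * 'rV[R]_d => F (rV_cons (z.1, z.2))).
  apply: measurableT_comp => //.
  by rewrite (_ : (fun z => _) = @rV_cons R d)//; apply/funext => -[].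
have mI : measurable_fun setT (fun a => \int[λ d]_v F (rV_cons (a, v))).
  exact: (measurable_integral_ge0 (λ d) (f := fun a v => F (rV_cons (a, v)))).
transitivity (\int[leb]_a ((c ^- d)%:E * \int[λ d]_v F (rV_cons ((c * a)%R, v)))).
  apply: eq_integral => a _; rewrite (IH (fun v => F (rV_cons (_, v))))//.
  by apply: measurableT_comp => //; apply: measurableT_comp.
rewrite ge0_integralTZl; last 3 first.
- by apply: (measurableT_comp mI); exact: measurable_funM.
- by move=> x; exact: integral_ge0.
- by rewrite lee_fin invr_ge0 exprn_ge0// ltW.
rewrite (ge0_integral_scale c0 (F := fun a => \int[λ d]_v F (rV_cons (a, v))))//.
  by rewrite muleA -EFinM -invfM exprSr.
by move=> x; exact: integral_ge0.
Qed.

Lemma measurable_gauss_rV d : measurable_fun setT (fun x : 'rV[R]_d => expR (- dot x x)).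
Proof.
apply: measurableT_comp => //; apply: measurable_funN.
exact: measurable_dot.
Qed.

(** The Gaussian is both radial and a product over the coordinates. It is the test function for
    rotation invariance, for the finiteness of balls and for the constant in polar integration. *)
Lemma integral_gauss_rV d :
  \int[λ d]_x (expR (- dot x x))%:E = (Num.sqrt pi ^+ d)%:E.
Proof.
elim: d => [|d IH].
  rewrite ge0_integral_rV0//.
  - by rewrite dotE big_ord0 oppr0 expR0.
  - by apply/measurable_EFinP; exact: measurable_gauss_rV.
rewrite ge0_integral_rVS; last 2 first.
- by apply/measurable_EFinP; exact: measurable_gauss_rV.
- by move=> x; rewrite lee_fin expR_ge0.
transitivity (\int[leb]_a ((gauss_fun a)%:E * (Num.sqrt pi ^+ d)%:E)).
  apply: eq_integral => a _; rewrite -IH -ge0_integralTZl.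
  - by apply: eq_integral => v _; rewrite dot_cons/= opprD expRD EFinM.
  - by apply/measurable_EFinP; exact: measurable_gauss_rV.
  - by move=> x; rewrite lee_fin expR_ge0.
  - by rewrite lee_fin gauss_fun_ge0.
rewrite ge0_integralTZr.
- by rewrite integralT_gauss -EFinM exprS.
- by apply/measurable_EFinP; exact: measurable_gauss_fun.
- by move=> x; rewrite lee_fin gauss_fun_ge0.
- by rewrite lee_fin exprn_ge0// sqrtr_ge0.
Qed.

(** A convolution argument. With [G] the Gaussian, integrate [F (x *m h) * G (x *m h + y)] over [x]
    and [y]: integrating [y] first gives the integral of [F (x *m h)] times that of [G]; translating
    [x], then [y], and using [G (x *m h) = G x] gives the integral of [F (- x)] times the same
    factor. The outcome does not depend on [h], so [h = g] and [h = 1] agree. *)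
Lemma ge0_integral_rV_mulmx d (g : 'M[R]_d) (F : 'rV[R]_d -> \bar R) :
  (g *m g^T = 1%:M)%R -> measurable_fun setT F -> (forall x, 0 <= F x) ->
  \int[λ d]_x F (x *m g)%R = \int[λ d]_x F x.
Proof.
move=> gg mF F0.
suff key h : (h *m h^T = 1%:M)%R ->
    \int[λ d]_x F (x *m h)%R = \int[λ d]_x F (- x)%R.
  rewrite key// -(key 1%:M)%R; last by rewrite trmx1 mulmx1.
  by apply: eq_integral => x _; rewrite mulmx1.
move=> hh; have hh' : (h^T *m h = 1%:M)%R by exact: mulmx1C.
pose G (x : 'rV[R]_d) := (expR (- dot x x))%:E.
have mG : measurable_fun setT G by apply/measurable_EFinP; exact: measurable_gauss_rV.
have G0 x : 0 <= G x by rewrite lee_fin expR_ge0.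
have mh : measurable_fun setT (fun x : 'rV[R]_d => x *m h)%R.
  by apply: measurable_mulmx => //; exact: measurable_cst.
have mFh : measurable_fun setT (fun x => F (x *m h)%R) by exact: measurableT_comp.
have IG : \int[λ d]_x G x = (Num.sqrt pi ^+ d)%:E by exact: integral_gauss_rV.
have pd0 : (0 < Num.sqrt (@pi R) ^+ d)%R by rewrite exprn_gt0// sqrtr_gt0 pi_gt0.
suff : (Num.sqrt pi ^+ d)%:E * \int[λ d]_x F (x *m h)%R =
       (Num.sqrt pi ^+ d)%:E * \int[λ d]_x F (- x)%R.
  move=> /(congr1 (fun z => (Num.sqrt pi ^+ d)^-1%:E * z)).
  by rewrite !muleA -!EFinM mulVf ?gt_eqF// !mul1e.
have mfst : measurable_fun setT (fun z : 'rV[R]_d * 'rV[R]_d => z.1 *m h)%R.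
  by apply: measurableT_comp mh _.
transitivity (\int[λ d]_x \int[λ d]_y (F (x *m h)%R * G (x *m h + y)%R)).
  rewrite -ge0_integralTZl; [|exact: mFh|by []|by rewrite lee_fin ltW].
  apply: eq_integral => x _; rewrite ge0_integralTZl; last 3 first.
  - by apply: measurableT_comp => //; exact: measurable_addmx.
  - by [].
  - by [].
  by rewrite ge0_integral_rV_shift// IG muleC.
rewrite tonelli; last 2 first.
- apply: emeasurable_funM; first exact: measurableT_comp mFh _.
  by apply: measurableT_comp => //; apply: measurable_addmx.
- by move=> x y; exact: mule_ge0.
transitivity (\int[λ d]_y \int[λ d]_x (F (x *m h - y)%R * G (x *m h)%R)).
  apply: eq_integral => y _.
  rewrite -(ge0_integral_rV_shift (- (y *m h^T))%R (F := fun x => F (x *m h)%R * G (x *m h + y)%R)); last 2 first.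
  - apply: emeasurable_funM => //.
    by apply: measurableT_comp => //; apply: measurable_addmx.
  - by move=> x; exact: mule_ge0.
  apply: eq_integral => x _; rewrite mulmxDl mulNmx -mulmxA hh' mulmx1.
  by rewrite (addrC (- y)%R) subrK.
rewrite tonelli; last 2 first.
- apply: emeasurable_funM; last by apply: measurableT_comp => //; exact: measurableT_comp mh _.
  apply: measurableT_comp => //; apply: measurable_subrmx => //.
  exact: measurableT_comp mh _.
- by move=> x y; exact: mule_ge0.
transitivity (\int[λ d]_x (G x * \int[λ d]_y F (- y)%R)).
  apply: eq_integral => x _.
  have mFN : measurable_fun setT (fun y : 'rV[R]_d => F (- y)%R).
    rewrite (_ : (fun y => _) = fun y => F ((-1) *: y)%R); last first.
      by apply/funext => y; rewrite scaleN1r.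
    apply: measurableT_comp => //; apply: measurable_scalemx => //.
  rewrite -(ge0_integral_rV_shift (x *m h)%R (F := fun y => F (x *m h - y)%R * G (x *m h)%R)).
  - rewrite -ge0_integralTZl; [|exact: mFN|by []|by rewrite lee_fin expR_ge0].
    apply: eq_integral => y _; rewrite opprD addrA subrr sub0r muleC.
    by rewrite /G dot_mulmx.
  - apply: emeasurable_funM; last exact: measurable_cst.
    apply: measurableT_comp => //; apply: measurable_subrmx => //; exact: measurable_cst.
  - by move=> y; exact: mule_ge0.
rewrite ge0_integralTZr//; last by apply: integral_ge0.
by rewrite IG.
Qed.

End lebesgue_rV_theory.

(** * Projections, rotations and measurable frames *)

Section orthogonal_projections.
Context {R : realType} {n : nat}.
Implicit Types (V W : {vspace 'rV[R]_n}) (u v : 'rV[R]_n) (g : 'M[R]_n).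

Lemma mulmx_orthproj_mem V u : u *m orthproj V \in V.
Proof. by rewrite /orthproj mul_rV_lin1 memv_pi. Qed.

Lemma mulmx_orthproj_id V u : u \in V -> u *m orthproj V = u.
Proof. by move=> uV; rewrite /orthproj mul_rV_lin1/= daddv_pi_id// capv_orthv. Qed.

Lemma orthprojP V u : reflect (u *m orthproj V = u) (u \in V).
Proof.
apply: (iffP idP) => [|<-]; first exact: mulmx_orthproj_id.
exact: mulmx_orthproj_mem.
Qed.

Lemma mulmx_orthproj_orth V u : u \in orthv V -> u *m orthproj V = 0.
Proof.
move=> uV; have : u *m orthproj (orthv V) = u by exact: mulmx_orthproj_id.
rewrite orthproj_orthv mulmxBr mulmx1 => /eqP.
by rewrite -subr_eq0 addrAC subrr sub0r oppr_eq0 => /eqP.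
Qed.

Lemma mulmx_orthproj_eq0 V u : u *m orthproj V = 0 -> u \in orthv V.
Proof. by move=> uV; apply/orthprojP; rewrite orthproj_orthv mulmxBr uV mulmx1 subr0. Qed.

Lemma dot_trmx u v g : dot (u *m g) v = dot u (v *m g^T).
Proof. by rewrite /dot trmx_mul trmxK mulmxA. Qed.

Lemma dot_mx_inj (A B : 'M[R]_n) :
  (forall u v, dot (u *m A) v = dot (u *m B) v) -> A = B.
Proof.
move=> H; apply/row_matrixP => i; rewrite !rowE.
apply/eqP; rewrite -subr_eq0; apply/eqP; apply: dot_eq0.
by rewrite [X in dot X _](_ : _ = delta_mx 0 i *m A - delta_mx 0 i *m B)// dotDl dotNl H subrr.
Qed.

Lemma orthproj_trmx V : (orthproj V)^T = orthproj V.
Proof.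
apply: dot_mx_inj => u v; rewrite dot_trmx trmxK dotC.
suff key a b : dot (a *m orthproj V) b = dot (a *m orthproj V) (b *m orthproj V).
  by rewrite key dotC -key.
apply/eqP; rewrite -subr_eq0 -dotNr -dotDr -[X in dot _ (X + _)]mulmx1 -mulmxN -mulmxDr.
rewrite -orthproj_orthv dotC; apply/eqP.
by move/memv_orthP: (mulmx_orthproj_mem (orthv V) b); apply; exact: mulmx_orthproj_mem.
Qed.

Lemma orthproj_idem V : orthproj V *m orthproj V = orthproj V.
Proof.
apply/row_matrixP => i; rewrite !rowE mulmxA mulmx_orthproj_id//.
exact: mulmx_orthproj_mem.
Qed.

(** Symmetry makes [u - u *m Q] orthogonal to [V], so the projection sends [u] and [u *m Q] to the
    same vector. *)
Lemma orthproj_uniq V (Q : 'M[R]_n) : Q^T = Q -> (forall u, u *m Q \in V) ->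
  (forall u, u \in V -> u *m Q = u) -> orthproj V = Q.
Proof.
move=> QT QV VQ; apply/row_matrixP => i; rewrite !rowE; set u := delta_mx 0 i.
have : u - u *m Q \in orthv V.
  by apply/memv_orthP => v vV; rewrite dotDl dotNl dot_trmx QT VQ// subrr.
move=> /mulmx_orthproj_orth; rewrite mulmxBl => /subr0_eq ->.
exact/mulmx_orthproj_id.
Qed.

(** Equalities of subspaces can thus be checked as identities between projection matrices. *)
Lemma orthproj_inj : injective (@orthproj R n).
Proof.
by move=> V W VW; apply/vspaceP => u; apply/orthprojP/orthprojP; rewrite VW.
Qed.

Lemma orthproj0 : orthproj (0%VS : {vspace 'rV[R]_n}) = 0.
Proof.
apply: orthproj_uniq; first exact: trmx0.
- by move=> u; rewrite mulmx0 mem0v.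
- by move=> u; rewrite memv0 => /eqP ->; rewrite mul0mx.
Qed.

Lemma subv_orthproj V W : (V <= W)%VS -> orthproj V *m orthproj W = orthproj V.
Proof.
move=> VW; apply/row_matrixP => i; rewrite !rowE mulmxA mulmx_orthproj_id//.
exact: (subvP VW _ (mulmx_orthproj_mem _ _)).
Qed.

Lemma subv_orthproj' V W : (V <= W)%VS -> orthproj W *m orthproj V = orthproj V.
Proof.
by move=> VW; rewrite -[LHS]trmxK trmx_mul !orthproj_trmx subv_orthproj// orthproj_trmx.
Qed.

Lemma orthproj_subv V W : orthproj V *m orthproj W = orthproj V -> (V <= W)%VS.
Proof.
move=> VW; apply/subvP => u /orthprojP uV; apply/orthprojP.
by rewrite -{1}uV -mulmxA VW uV.
Qed.

Lemma orthproj_cap V W : (V <= W)%VS ->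
  orthproj (orthv V :&: W)%VS = orthproj W - orthproj V.
Proof.
move=> VW; apply: orthproj_uniq.
- by rewrite linearB/= !orthproj_trmx.
- move=> u; rewrite memv_cap; apply/andP; split.
    apply: mulmx_orthproj_eq0.
    by rewrite -mulmxA mulmxBl (subv_orthproj' VW) orthproj_idem subrr mulmx0.
  apply/orthprojP.
  by rewrite -mulmxA mulmxBl (subv_orthproj VW) orthproj_idem.
- move=> u; rewrite memv_cap => /andP[uV uW].
  by rewrite mulmxBr mulmx_orthproj_id// mulmx_orthproj_orth// subr0.
Qed.

Definition rowspan d (B : 'M[R]_(d, n)) : {vspace 'rV[R]_n} :=
  limg (linfun (mulmxr B : 'rV[R]_d -> 'rV[R]_n)).

Lemma mem_rowspan d (B : 'M[R]_(d, n)) u :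
  (exists t, u = t *m B) <-> u \in rowspan B.
Proof.
split=> [[t ->]|/memv_imgP[t _ ->]]; last by exists t; rewrite lfunE.
by apply/memv_imgP; exists t; rewrite ?memvf// lfunE.
Qed.

Lemma orthproj_rowspan d (B : 'M[R]_(d, n)) :
  B *m B^T = 1%:M -> orthproj (rowspan B) = B^T *m B.
Proof.
move=> BB; apply: orthproj_uniq; first by rewrite trmx_mul trmxK.
- by move=> u; apply/mem_rowspan; exists (u *m B^T); rewrite mulmxA.
- by move=> u /mem_rowspan[t ->]; rewrite -mulmxA (mulmxA B) BB mul1mx.
Qed.

Lemma dim_rowspan d (B : 'M[R]_(d, n)) :
  B *m B^T = 1%:M -> \dim (rowspan B) = d.
Proof.
move=> BB; rewrite limg_dim_eq; first by rewrite dimvf /dim/= mul1n.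
apply/eqP; rewrite -subv0; apply/subvP => t; rewrite memv_cap memv0 => /andP[_].
rewrite memv_ker lfunE/= => /eqP /(congr1 (mulmx^~ B^T)).
by rewrite -mulmxA BB mulmx1 mul0mx => ->.
Qed.

Lemma orthonormal_frame_orthproj d V (B : 'M[R]_(d, n)) : \dim V = d ->
  orthonormal_frame V B -> B^T *m B = orthproj V.
Proof.
move=> dV [BB BV]; rewrite -orthproj_rowspan//; congr orthproj.
apply/eqP; rewrite eqEdim dim_rowspan// dV leqnn andbT.
apply/subvP => u /mem_rowspan[t ->]; rewrite mulmx_sum_row.
by apply: memv_suml => i _; apply: memvZ.
Qed.

(** The identities [B *m B^T = 1%:M] and [B^T *m B = orthproj V] already contain the dimension of
    [V]; frames are passed around in this form because it is stable under rotation. *)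
Lemma orthonormal_frame_dim d V (B : 'M[R]_(d, n)) :
  B *m B^T = 1%:M -> B^T *m B = orthproj V -> orthonormal_frame V B /\ \dim V = d.
Proof.
move=> BB BV; have <- : rowspan B = V by apply: orthproj_inj; rewrite orthproj_rowspan.
split; last exact: dim_rowspan.
by split=> // i; apply/mem_rowspan; exists (delta_mx 0 i); rewrite -rowE.
Qed.

End orthogonal_projections.

(** * Action of orthogonal matrices on subspaces *)

Section rotations.
Context {R : realType} {n : nat}.
Implicit Types (V W : {vspace 'rV[R]_n}) (u v : 'rV[R]_n) (g h : 'M[R]_n).

Lemma mem_rotate g V u : (exists2 v, v \in V & u = v *m g) <-> u \in rotate g V.
Proof.
split=> [[v vV ->]|/memv_imgP[v vV ->]]; last by exists v => //; rewrite lfunE.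
by apply/memv_imgP; exists v => //; rewrite lfunE.
Qed.

Lemma orthproj_rotate g V : g *m g^T = 1%:M ->
  orthproj (rotate g V) = g^T *m orthproj V *m g.
Proof.
move=> gg; apply: orthproj_uniq.
- by rewrite !trmx_mul trmxK orthproj_trmx mulmxA.
- move=> u; apply/mem_rotate; exists (u *m g^T *m orthproj V).
    exact: mulmx_orthproj_mem.
  by rewrite !mulmxA.
- move=> u /mem_rotate[v vV ->]; rewrite !mulmxA -(mulmxA v) gg mulmx1.
  by rewrite mulmx_orthproj_id.
Qed.

Lemma rotateM g h V : rotate h (rotate g V) = rotate (g *m h) V.
Proof.
apply/vspaceP => u; apply/idP/idP => [/mem_rotate[v /mem_rotate[w wV ->] ->]|].
  by apply/mem_rotate; exists w => //; rewrite mulmxA.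
move=> /mem_rotate[v vV ->]; apply/mem_rotate; exists (v *m g).
  by apply/mem_rotate; exists v.
by rewrite mulmxA.
Qed.

Lemma rotate1 V : rotate 1%:M V = V.
Proof.
apply/vspaceP => u; apply/idP/idP => [/mem_rotate[v vV ->]|uV]; first by rewrite mulmx1.
by apply/mem_rotate; exists u; rewrite ?mulmx1.
Qed.

Lemma dim_rotate g V : g *m g^T = 1%:M -> \dim (rotate g V) = \dim V.
Proof.
move=> gg; rewrite limg_dim_eq//.
apply/eqP; rewrite -subv0; apply/subvP => t; rewrite memv_cap memv0 => /andP[_].
rewrite memv_ker lfunE/= => /eqP /(congr1 (mulmx^~ g^T)).
by rewrite -mulmxA gg mulmx1 mul0mx => ->.
Qed.

Lemma orthv_rotate g V : g *m g^T = 1%:M -> orthv (rotate g V) = rotate g (orthv V).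
Proof.
move=> gg; apply: orthproj_inj; rewrite orthproj_orthv !orthproj_rotate//.
by rewrite orthproj_orthv mulmxBr mulmxBl mulmx1 (mulmx1C gg).
Qed.

Lemma rotateS g V W : (V <= W)%VS -> (rotate g V <= rotate g W)%VS.
Proof. exact: limgS. Qed.

End rotations.

(** * Householder reflections *)

Section householder.
Context {R : realType} {n : nat}.
Implicit Types (a b u w : 'rV[R]_n).

(* When [a = b] the coefficient is [2 / 0 = 0], so that the identity comes out. *)
Definition reflection a b : 'M[R]_n :=
  1%:M - (2 / dot (a - b) (a - b)) *: ((a - b)^T *m (a - b)).

Lemma dotZl c u w : dot (c *: u) w = c * dot u w.
Proof. by rewrite -{1}[w]scale1r dotZ mulr1. Qed.

Lemma mulmx_reflection u a b :
  u *m reflection a b = u - (2 / dot (a - b) (a - b) * dot u (a - b)) *: (a - b).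
Proof.
rewrite mulmxBr mulmx1 -scalemxAr mulmxA -scalerA; congr (_ - _ *: _).
by rewrite [u *m _]mx11_scalar mul_scalar_mx.
Qed.

Lemma reflection_fix u a b : dot u (a - b) = 0 -> u *m reflection a b = u.
Proof. by move=> uab; rewrite mulmx_reflection uab mulr0 scale0r subr0. Qed.

Lemma reflection_trmx a b : (reflection a b)^T = reflection a b.
Proof. by rewrite linearB/= linearZ/= trmx_mul trmxK trmx1. Qed.

Lemma reflection_orth a b : reflection a b *m (reflection a b)^T = 1%:M.
Proof.
rewrite reflection_trmx; apply/row_matrixP => i; rewrite !rowE mulmxA mulmx1.
set u := delta_mx 0 i; rewrite !mulmx_reflection; set w := a - b; set s := dot w w.
rewrite dotDl dotNl dotZl -/s.
have [s0|s0] := eqVneq s 0.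
  by rewrite s0 invr0 !(mulr0, mul0r) scale0r !subr0.
rewrite -addrA -opprD -scalerDl [X in X *: _](_ : _ = 0) ?scale0r ?subr0//.
by field.
Qed.

(** Equal lengths give [dot w w = 2 * dot a w] for [w = a - b], so exactly one copy of [w] is
    subtracted from [a]. *)
Lemma reflection_swap a b : dot a a = dot b b -> a *m reflection a b = b.
Proof.
move=> ab; rewrite mulmx_reflection; set w := a - b.
have sE : dot w w = 2 * dot a w.
  by rewrite /w !(dotDl, dotDr, dotNl, dotNr) -ab (dotC b a); ring.
have [s0|s0] := eqVneq (dot w w) 0.
  have /eqP := dot_eq0 s0; rewrite subr_eq0 => /eqP ab'.
  by rewrite s0 invr0 mulr0 mul0r scale0r subr0.
rewrite (_ : _ / _ * _ = 1) ?scale1r ?opprB 1?addrC ?subrK//.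
by rewrite mulrAC -sE mulfV.
Qed.

End householder.

(** * Measurability of subspace-valued maps *)

Section measurable_subspace_valued.
Context {R : realType} {n : nat} {d : measure_display} {T : measurableType d}.

Lemma measurable_vspaceP (f : T -> {vspace 'rV[R]_n}) :
  measurable_fun setT f <-> measurable_fun setT (fun x => orthproj (f x)).
Proof.
split=> [mf|mf]; first exact: measurableT_comp (@measurable_orthproj R n) mf.
move=> _ _ [Y mY <-]; rewrite !setTI -comp_preimage -[X in measurable X]setTI.
exact: mf.
Qed.

Lemma measurable_fun_eqmx p q (f g : T -> 'M[R]_(p, q)) :
  measurable_fun setT f -> measurable_fun setT g ->
  measurable_fun setT (fun x => f x == g x).
Proof.
move=> mf mg; apply: (measurable_fun_bool true).
rewrite setTI (_ : _ @^-1` _ = [set x | f x = g x]); first exact: measurable_eqmx.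
by apply/seteqP; split => x /= /eqP.
Qed.

(** The inverse is glued from real powers on the two half-lines and from its conventional value 0 at
    0. *)
Lemma measurable_fun_inv (f : T -> R) :
  measurable_fun setT f -> measurable_fun setT (fun x => (f x)^-1).
Proof.
move=> mf; rewrite (_ : (fun x => _) =
    fun x => if 0 < f x then f x `^ (-1) else if f x < 0 then - ((- f x) `^ (-1)) else 0).
  apply: measurable_fun_ifT.
  - by apply: measurable_fun_ltr => //; exact: measurable_cst.
  - exact: measurableT_comp (measurable_powR _) mf.
  - apply: measurable_fun_ifT.
    + by apply: measurable_fun_ltr => //; exact: measurable_cst.
    + apply: measurable_funN; apply: measurableT_comp (measurable_powR _) _.
      exact: measurable_funN.
    + exact: measurable_cst.
apply/funext => x; case: ltgtP => [f0|f0|<-]; last by rewrite invr0.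
- by rewrite powRN powRr1// ltW.
- by rewrite powRN powRr1 ?invrN ?opprK// oppr_ge0 ltW.
Qed.

End measurable_subspace_valued.

(** * Measurable orthonormal frames and dimensions *)

Section pivot_frames.
Context {R : realType} {n : nat}.
Implicit Types (V W : {vspace 'rV[R]_n}) (u : 'rV[R]_n) (P : 'M[R]_n).

(** The first nonzero row of [P], normalized. It is found by a finite cascade of equality tests,
    hence depends measurably on [P]. *)
Definition pivot (s : seq 'I_n) P : 'rV[R]_n :=
  foldr (fun i acc => if row i P == 0 then acc else (enorm (row i P))^-1 *: row i P) 0 s.

(** Gram-Schmidt on projections: if [P] projects onto [V] and [b] is a unit vector of [V], then
    [P - b^T *m b] projects onto the complement of [b] in [V]. *)
Fixpoint pivot_frame d P : 'M[R]_(d, n) :=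
  match d with
  | 0 => 0
  | d'.+1 => let b := pivot (enum 'I_n) P in
             col_mx b (pivot_frame d' (P - b^T *m b))
  end.

Lemma measurable_pivot d (T : measurableType d) s (f : T -> 'M[R]_n) :
  measurable_fun setT f -> measurable_fun setT (fun x => pivot s (f x)).
Proof.
move=> mf; elim: s => [|i s IH] /=; first exact: measurable_cst.
have mr : measurable_fun setT (fun x => row i (f x)) by exact: measurable_row.
apply: measurable_fun_ifT => //.
  by apply: measurable_fun_eqmx => //; exact: measurable_cst.
apply: measurable_scalemx => //; apply: measurable_fun_inv.
exact: measurable_enorm.
Qed.

Lemma measurable_pivot_frame k d (T : measurableType d) (f : T -> 'M[R]_n) :
  measurable_fun setT f -> measurable_fun setT (fun x => pivot_frame k (f x)).
Proof.
elim: k f => [|k IH] f mf /=; first exact: measurable_cst.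
have mp := measurable_pivot (enum 'I_n) mf.
apply: (@measurable_col_mx R _ _ 1 k n) => //; apply: IH; apply: measurable_subrmx => //.
by apply: measurable_mulmx => //; exact: measurable_trmx.
Qed.

Lemma pivot_unit V : V != 0%VS ->
  let b := pivot (enum 'I_n) (orthproj V) in b \in V /\ dot b b = 1.
Proof.
move=> V0.
have : exists2 i, i \in enum 'I_n & row i (orthproj V) != 0.
  apply: contrapT => H; move/eqP: V0; apply; apply: orthproj_inj; rewrite orthproj0.
  apply/row_matrixP => i; rewrite row0; apply: contrapT => /eqP H'.
  by apply: H; exists i; rewrite ?mem_enum.
elim: (enum 'I_n) => [[//]|i s IH] /= [j jis j0].
case: (eqVneq (row i (orthproj V)) 0) => [i0|i0].
  apply: IH; exists j => //; move: jis; rewrite inE => /predU1P[ji|//].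
  by rewrite ji i0 eqxx in j0.
split; first by rewrite memvZ// rowE mulmx_orthproj_mem.
rewrite dotZ -enorm_sqr -expr2 -exprMn mulVf ?expr1n//.
by apply: contra i0 => /eqP/enorm_eq0/eqP.
Qed.

Lemma dim_cap_orth1 V b : b \in V -> dot b b = 1 ->
  \dim V = (\dim (orthv <[b]> :&: V)%VS).+1.
Proof.
move=> bV b1; rewrite -[RHS]addn1.
have b0 : b != 0 by apply: contra_eq_neq b1 => ->; rewrite dotE big1 1?eq_sym ?oner_eq0// => i _; rewrite mxE mul0r.
have d1 : \dim <[b]> = 1%N by rewrite dim_vline b0.
rewrite -[X in (_ + X)%N]d1 -dimv_disjoint_sum; last first.
  apply/eqP; rewrite -subv0; apply/subvP => u; rewrite !memv_cap => /andP[/andP[uO _] ub].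
  by rewrite -(capv_orthv <[b]>%VS) memv_cap ub uO.
congr (\dim _); apply/eqP; rewrite eqEsubv; apply/andP; split; last first.
  by rewrite subv_add capvSr -memvE.
apply/subvP => u uV; rewrite -[u](subrK (dot u b *: b)); apply: memv_add; last first.
  by rewrite memvZ// memv_line.
rewrite memv_cap; apply/andP; split; last by rewrite memvB// memvZ.
apply/memv_orthP => _ /vlineP[c ->].
rewrite dotC dotZl dotC dotDl dotNl dotZl b1 mulr1 subrr mulr0//.
Qed.

Lemma orthproj_line (b : 'rV[R]_n) : dot b b = 1 -> orthproj <[b]> = b^T *m b.
Proof.
move=> b1; rewrite -orthproj_rowspan; last first.
  by rewrite [LHS]mx11_scalar -/(dot b b) b1.
congr orthproj; apply/vspaceP => u; apply/idP/idP.
  by move=> /vlineP[c ->]; apply/mem_rowspan; exists c%:M; rewrite mul_scalar_mx.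
by move=> /mem_rowspan[t ->]; rewrite [t]mx11_scalar mul_scalar_mx memvZ// memv_line.
Qed.

Lemma pivot_frameP d V : \dim V = d ->
  let B := pivot_frame d (orthproj V) in
  B *m B^T = 1%:M /\ B^T *m B = orthproj V.
Proof.
elim: d V => [|d IH] V dV /=.
  split; first by apply/matrixP => -[].
  have /eqP -> : V == 0%VS by rewrite -dimv_eq0 dV.
  by rewrite orthproj0 mulmx0.
have V0 : V != 0%VS by rewrite -dimv_eq0 dV.
have [bV b1] := pivot_unit V0; set b := pivot _ _ in bV b1 *.
have bV' : (<[b]> <= V)%VS by rewrite -memvE.
have := dim_cap_orth1 bV b1; rewrite dV => -[] /esym /IH/=.
rewrite orthproj_cap// orthproj_line//; set B := pivot_frame _ _ => -[BB BP].
have bP : b *m orthproj V = b by exact/orthprojP.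
have bb : b *m b^T = 1%:M by rewrite [LHS]mx11_scalar -/(dot b b) b1.
have Bb : B *m b^T = 0.
  have -> : B = B *m (orthproj V - b^T *m b) by rewrite -BP mulmxA BB mul1mx.
  rewrite -mulmxA mulmxBl -mulmxA bb mulmx1.
  by rewrite -{1}orthproj_trmx -trmx_mul bP subrr mulmx0.
have bB : b *m B^T = 0 by apply: trmx_inj; rewrite trmx_mul trmxK trmx0.
have h1 : (col_mx b B : 'M[R]_(1 + d, n)) *m (col_mx b B)^T = 1%:M.
  by rewrite tr_col_mx mul_col_row bb BB Bb bB -scalar_mx_block.
have h2 : (col_mx b B)^T *m (col_mx b B : 'M[R]_(1 + d, n)) = orthproj V.
  by rewrite tr_col_mx mul_row_col BP addrC subrK.
by split; [exact: h1|exact: h2].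
Qed.

Lemma measurable_frame d : measurable_fun setT (frame d : {vspace 'rV[R]_n} -> 'M[R]_(d, n)).
Proof. exact: measurable_funP. Qed.

(** [frame] is selected by [xget] with default [cst 0]. The measurable pivot frame shows that an
    admissible selection exists, so the selected map has the required property. *)
Lemma frame_spec d V : \dim V = d -> orthonormal_frame V (frame d V).
Proof.
have mf : measurable_fun setT (fun V : {vspace 'rV[R]_n} => pivot_frame d (orthproj V)).
  by apply: measurable_pivot_frame; exact: measurable_orthproj.
pose f : {mfun {vspace 'rV[R]_n} >-> 'M[R]_(d, n)} :=
  HB.pack (fun V : {vspace 'rV[R]_n} => pivot_frame d (orthproj V))
    (isMeasurableFun.Build _ _ _ _ _ mf).
apply: (@xgetPex _ _ [set B : {mfun {vspace 'rV[R]_n} >-> 'M[R]_(d, n)} |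
    forall V : {vspace 'rV[R]_n}, \dim V = d -> orthonormal_frame V (B V)]).
exists f => W dW; have [BB BP] := pivot_frameP dW.
exact: (orthonormal_frame_dim BB BP).1.
Qed.

Lemma frame_orth d V : \dim V = d -> frame d V *m (frame d V)^T = 1%:M.
Proof. by case/frame_spec. Qed.

Lemma frame_orthproj d V : \dim V = d -> (frame d V)^T *m frame d V = orthproj V.
Proof. by move=> dV; apply: orthonormal_frame_orthproj => //; exact: frame_spec. Qed.

(** Turns the dimension into a sum of matrix entries: it becomes measurable, and dimension formulas
    become trace identities. *)
Lemma mxtrace_orthproj V : \tr (orthproj V) = (\dim V)%:R.
Proof.
by rewrite -(frame_orthproj (erefl (\dim V))) mxtrace_mulC frame_orth// mxtrace1.
Qed.

Lemma measurable_dim d (T : measurableType d) m (f : T -> {vspace 'rV[R]_n}) :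
  measurable_fun setT f -> measurable [set x | \dim (f x) = m].
Proof.
move=> /measurable_vspaceP /measurable_mxP mf.
rewrite (_ : [set x | _] = (fun x => \sum_i orthproj (f x) i i) @^-1` [set m%:R]).
  rewrite -[X in measurable X]setTI.
  have : measurable_fun setT (fun x => \sum_i orthproj (f x) i i).
    by apply: measurable_sum => i; exact: mf.
  by apply.
apply/seteqP; split => x /=; have := mxtrace_orthproj (f x); rewrite /mxtrace => -> //.
  by move=> ->.
by move=> /eqP; rewrite eqr_nat => /eqP.
Qed.

Lemma dim_orthv V : \dim (orthv V) = (n - \dim V)%N.
Proof.
have := mxtrace_orthproj (orthv V); rewrite orthproj_orthv linearB/= mxtrace1 mxtrace_orthproj.
have le : (\dim V <= n)%N by rewrite (leq_trans (dimvS (subvf _)))// dimvf /dim/= mul1n.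
by rewrite -natrB// => /eqP; rewrite eqr_nat => /eqP.
Qed.

Lemma dim_orthv_cap V W : (V <= W)%VS -> \dim (orthv V :&: W)%VS = (\dim W - \dim V)%N.
Proof.
move=> VW; have := mxtrace_orthproj (orthv V :&: W)%VS.
rewrite orthproj_cap// linearB/= !mxtrace_orthproj -natrB ?dimvS//.
by move=> /eqP; rewrite eqr_nat => /eqP.
Qed.

Lemma exists_subspace V m : (m <= \dim V)%N -> exists2 W, (W <= V)%VS & \dim W = m.
Proof.
elim: m => [|m IH] mV; first by exists 0%VS; rewrite ?sub0v ?dimv0.
have [W WV dW] := IH (ltnW mV).
have V0 : (orthv W :&: V)%VS != 0%VS.
  by rewrite -dimv_eq0 dim_orthv_cap// dW subn_eq0 -ltnNge.
have [bV b1] := pivot_unit V0; set b := pivot _ _ in bV b1.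
move: bV; rewrite memv_cap => /andP[bW bV].
exists (W + <[b]>)%VS; first by rewrite subv_add WV -memvE.
rewrite dimv_disjoint_sum ?dim_vline ?dW.
  rewrite (_ : b != 0) ?addn1//.
  by apply: contra_eq_neq b1 => ->; rewrite dotE big1 1?eq_sym ?oner_eq0// => i _; rewrite mxE mul0r.
apply/eqP; rewrite -subv0; apply/subvP => u; rewrite memv_cap memv0 => /andP[uW /vlineP[c uE]].
apply/eqP/dot_eq0; rewrite {2}uE dotC dotZl dotC.
by rewrite dotC (memv_orthP _ _ bW) ?mulr0.
Qed.

End pivot_frames.

(** * Haar measures and invariant measures on Grassmannians *)

Section uniform_directions.
Local Open Scope ereal_scope.
Context {R : realType}.
Local Notation "'λ' d" := (@lebesgue_rV R d) (at level 10).

Lemma integralT_indic d (T : measurableType d) (m : {measure set T -> \bar R})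
    (A : set T) : measurable A -> \int[m]_x (\1_A x)%:E = m A.
Proof. by move=> mA; rewrite integral_indic// setIT. Qed.

Lemma ge0_integral_mrestr d (T : measurableType d) (m : {measure set T -> \bar R})
    (D : set T) (mD : measurable D) (F : T -> \bar R) :
  measurable_fun setT F -> (forall x, 0 <= F x) ->
  \int[mrestr m mD]_x F x = \int[m]_(x in D) F x.
Proof.
move=> mF F0.
have DC0 : mrestr m mD (~` D) = 0.
  by rewrite -[LHS]/(m (~` D `&` D)) setICl measure0.
rewrite (ge0_negligible_integral _ _ _ _ DC0)//; last exact: measurableC.
rewrite setTD setCK; apply: eq_measure_integral => A mA AD.
by rewrite -[LHS]/(m (A `&` D)) setIidl.
Qed.

Lemma measurable_mx_set1 m n (A : 'M[R]_(m, n)) : measurable [set A].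
Proof.
rewrite (_ : [set A] = [set x | x = cst A x])//.
apply: measurable_eqmx; first exact: measurable_id.
exact: measurable_cst.
Qed.

(** Dilation by 2 fixes the origin but scales the measure by [2 ^- d]; since the measure of the
    origin is finite, by comparison with the Gaussian, it vanishes. *)
Lemma lebesgue_rV_set0 d : (0 < d)%N -> λ d [set 0%R] = 0.
Proof.
move=> d0; have m1 : measurable [set (0 : 'rV[R]_d)%R] by exact: measurable_mx_set1.
have mI : measurable_fun setT (fun x : 'rV[R]_d => (\1_[set 0%R] x)%:E : \bar R).
  by apply/measurable_EFinP; exact: measurable_indic.
have fin : λ d [set 0%R] < +oo.
  apply: (@le_lt_trans _ _ (\int[λ d]_x (expR (- dot x x))%:E)); last first.
    by rewrite integral_gauss_rV ltry.
  rewrite -[leLHS]integralT_indic//; apply: ge0_le_integral => //.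
  - by apply/measurable_EFinP; exact: measurable_gauss_rV.
  - move=> x _; rewrite lee_fin indicE; case: (boolP (x \in _)) => [|_]; last by rewrite mulr0n expR_ge0.
    rewrite inE => ->; rewrite (_ : dot (0 : 'rV[R]_d)%R 0%R = 0%R) ?oppr0 ?expR0//.
    by rewrite dotE big1// => i _; rewrite mxE mul0r.
have I0 (x : 'rV[R]_d) : 0 <= (\1_[set 0%R] x : R)%:E by rewrite lee_fin.
have E : \int[λ d]_x (\1_[set 0%R] ((2 : R) *: x)%R : R)%:E =
    \int[λ d]_x (\1_[set 0%R] x)%:E.
  apply: eq_integral => x _; congr (_%:E).
  rewrite !indicE (_ : ((2 *: x)%R \in [set 0%R]) = (x \in [set 0%R]))//.
  apply/idP/idP; rewrite !inE/=; last by move=> ->; rewrite scaler0.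
  by move/eqP; rewrite scaler_eq0 pnatr_eq0/= => /eqP.
have : λ d [set 0%R] = (2 ^- d)%:E * λ d [set 0%R].
  have := ge0_integral_rV_scale (ltr0n R 2) mI I0.
  by rewrite E !integralT_indic.
have ge0 : 0 <= λ d [set 0%R] by exact: measure_ge0.
move: fin ge0; case: (λ d [set 0%R]) => [r| |]// _.
rewrite lee_fin => r0 -[rE]; congr (_%:E).
have d2 : (2 ^- d < 1 :> R)%R.
  rewrite -exprVn exprn_ilt1 -?lt0n ?invr_ge0//; lra.
have /eqP : (r * (1 - 2 ^- d) = 0)%R by rewrite mulrBr mulr1 {1}rE mulrC subrr.
by rewrite mulf_eq0 => /orP[/eqP//|]; rewrite subr_eq0 eq_sym lt_eqF.
Qed.

(** Lebesgue measure on a ball, normalized. Only directions are used later, so this stands in for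
    the uniform measure on the sphere; the origin, the one point without direction, is null. *)
Lemma rotation_invariant_probability d : (0 < d)%N ->
  exists P : probability 'rV[R]_d R, P [set 0%R] = 0 /\
    forall (g : 'M[R]_d) (F : 'rV[R]_d -> \bar R), (g *m g^T = 1%:M)%R ->
      measurable_fun setT F -> (forall x, 0 <= F x) ->
      \int[P]_x F (x *m g)%R = \int[P]_x F x.
Proof.
move=> d0; pose D N := [set x : 'rV[R]_d | (enorm x <= N%:R)%R].
have mD N : measurable (D N).
  rewrite (_ : D N = (@enorm R d) @^-1` `]-oo, N%:R]%classic); last first.
    by apply/seteqP; split => x /=; rewrite /D/= in_itv.
  rewrite -[X in measurable X]setTI.
  have : measurable_fun setT (@enorm R d) by apply: measurable_enorm.
  by apply.
have finD N : λ d (D N) < +oo.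
  have : (expR (- N%:R ^+ 2))%:E * λ d (D N) <= (Num.sqrt pi ^+ d)%:E.
    rewrite -integral_gauss_rV -[X in _ * X]integralT_indic// -ge0_integralTZl.
    - apply: ge0_le_integral => //.
      + apply: emeasurable_funM; first exact: measurable_cst.
        by apply/measurable_EFinP; exact: measurable_indic.
      + by apply/measurable_EFinP; exact: measurable_gauss_rV.
      + move=> x _; rewrite -EFinM lee_fin indicE.
        case: (boolP (x \in _)) => [|_]; last by rewrite mulr0n mulr0 expR_ge0.
        rewrite inE /D/= => xN; rewrite mulr1 ler_expR lerN2 -enorm_sqr.
        by rewrite lerXn2r// nnegrE// enorm_ge0.
    - by apply/measurable_EFinP; exact: measurable_indic.
    - by move=> x; rewrite lee_fin.
    - by rewrite lee_fin ltW.
  case: (λ d (D N)) => [r _| |//]; first by rewrite ltry.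
  by rewrite gt0_muley ?lte_fin.
(* If every ball were null, so would be the whole space, against the positive Gaussian integral. *)
have [N posD] : exists N, λ d (D N) != 0.
  apply: contrapT => H.
  have : λ d [set: 'rV[R]_d] = 0.
    apply: measure_negligible => //.
    rewrite (_ : setT = \bigcup_N D N).
      apply: negligible_bigcup => N; apply/negligibleP => //.
      by apply: contrapT => /eqP ?; apply: H; exists N.
    apply/esym; rewrite -subTset => x _.
    exists (Num.bound (enorm x)) => //=; rewrite /D/=.
    by rewrite ltW// archi_boundP// enorm_ge0.
  move=> T0; have := @integral_gauss_rV R d; rewrite (ge0_negligible_integral measurableT _ _ _ T0).
  - rewrite setDv integral_set0 => -[] /eqP.
    by rewrite eq_sym gt_eqF// exprn_gt0// sqrtr_gt0 pi_gt0.
  - exact: measurableT.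
  - by apply/measurable_EFinP; exact: measurable_gauss_rV.
  - by move=> x _; rewrite lee_fin expR_ge0.
pose m := mrestr (λ d) (mD N).
have mT : m setT = λ d (D N) by rewrite -[LHS]/(λ d (setT `&` D N)) setTI.
(* [mnormalize] falls back on the Dirac mass when the total mass is 0 or infinite; [m0] excludes
   both cases. *)
pose P : probability 'rV[R]_d R := mnormalize m (dirac (0 : 'rV[R]_d)%R).
have m0 : ((m setT == 0) || (m setT == +oo)) = false.
  by rewrite mT (negbTE posD)/=; apply/negbTE; rewrite -ltey.
have c0 : (0 <= (fine (m setT))^-1)%R by rewrite invr_ge0 fine_ge0.
have PE A : measurable A -> P A = mscale (NngNum c0) m A.
  by move=> _; rewrite /P/= /mnormalize m0/= muleC.
exists P; split.
  have m1 : measurable [set (0 : 'rV[R]_d)%R] by exact: measurable_mx_set1.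
  rewrite PE// -[LHS]/(_ * λ d ([set 0%R] `&` D N)).
  rewrite (subset_measure0 _ m1 _ (lebesgue_rV_set0 d0)) ?mule0//.
  exact: measurableI.
move=> g F gg mF F0.
have mg : measurable_fun setT (fun x : 'rV[R]_d => x *m g)%R.
  by apply: measurable_mulmx => //; exact: measurable_cst.
have IE G : measurable_fun setT G -> (forall x, 0 <= G x) ->
    \int[P]_x G x = ((fine (m setT))^-1)%:E * \int[λ d]_x (G x * (\1_(D N) x)%:E).
  move=> mG G0; rewrite (eq_measure_integral (mscale (NngNum c0) m)); last first.
    by move=> A mA _; exact: PE.
  rewrite ge0_integral_mscale// ge0_integral_mrestr//; congr (_ * _).
  rewrite integral_mkcond; apply: eq_integral => x _.
  by rewrite patchE indicE; case: (boolP (x \in _)) => _; rewrite ?mule1 ?mule0.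
rewrite !IE//; last exact: measurableT_comp mF mg.
congr (_ * _); rewrite -[RHS](ge0_integral_rV_mulmx gg); last 2 first.
- by apply: emeasurable_funM => //; apply/measurable_EFinP; exact: measurable_indic.
- by move=> x; rewrite mule_ge0.
apply: eq_integral => x _; congr (_ * _); congr (_%:E); rewrite !indicE.
have -> // : ((x *m g)%R \in D N) = (x \in D N).
by apply/idP/idP; rewrite !inE /D/= enorm_mulmx.
Qed.

End uniform_directions.

(** * Rotation groups of subspaces and their transitivity *)

Section subspace_rotation_groups.
Context {R : realType} {n : nat}.
Implicit Types (V W : {vspace 'rV[R]_n}) (u v b : 'rV[R]_n) (g h : 'M[R]_n).

(* The rotations of [V], extended to R^n by the identity on the orthogonal complement. *)
Definition orthgrp V g :=
  (g *m g^T == 1%:M) && (orthproj (orthv V) *m g == orthproj (orthv V)).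

(** A retraction of all matrices onto the rotations of [V]: through it any probability on matrices
    describes one on the group, which is not a type of its own. *)
Definition to_orthgrp V g := if orthgrp V g then g else 1%:M.

Lemma orthgrp1 V : orthgrp V 1%:M.
Proof. by rewrite /orthgrp trmx1 !mulmx1 !eqxx. Qed.

Lemma orthgrp_orth V g : orthgrp V g -> g *m g^T = 1%:M.
Proof. by case/andP => /eqP. Qed.

Lemma orthgrp_orth' V g : orthgrp V g -> g^T *m g = 1%:M.
Proof. by move=> /orthgrp_orth/mulmx1C. Qed.

Lemma orthgrp_fix V g u : orthgrp V g -> u \in orthv V -> u *m g = u.
Proof. by case/andP => _ /eqP gV /orthprojP uV; rewrite -{1}uV -mulmxA gV uV. Qed.

Lemma orthgrpP V g : g *m g^T = 1%:M -> (forall u, u \in orthv V -> u *m g = u) ->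
  orthgrp V g.
Proof.
move=> gg gV; rewrite /orthgrp gg eqxx/=; apply/eqP/row_matrixP => i.
by rewrite !rowE mulmxA gV// mulmx_orthproj_mem.
Qed.

Lemma orthgrpM V g h : orthgrp V g -> orthgrp V h -> orthgrp V (g *m h).
Proof.
move=> gV hV; apply: orthgrpP => [|u uV].
  by rewrite trmx_mul mulmxA -(mulmxA g) (orthgrp_orth hV) mulmx1 (orthgrp_orth gV).
by rewrite mulmxA !(@orthgrp_fix V).
Qed.

Lemma orthgrp_trmx V g : orthgrp V g -> orthgrp V g^T.
Proof.
move=> gV; apply: orthgrpP => [|u uV]; first by rewrite trmxK (orthgrp_orth' gV).
by rewrite -{1}(orthgrp_fix gV uV) -mulmxA (orthgrp_orth gV) mulmx1.
Qed.

Lemma orthgrp_comm V g : orthgrp V g -> orthproj V *m g = g *m orthproj V.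
Proof.
move=> gV; have /andP[_ /eqP e1] := gV; have /andP[_ /eqP] := orthgrp_trmx gV.
move=> /(congr1 (@trmx _ _ _)); rewrite trmx_mul trmxK orthproj_trmx -{2}e1.
rewrite orthproj_orthv mulmxBl mulmxBr mul1mx mulmx1 => /eqP.
by rewrite -subr_eq0 opprB addrC addrA subrK subr_eq0 => /eqP.
Qed.

Lemma orthgrp_rotate V g : orthgrp V g -> rotate g V = V.
Proof.
move=> gV; apply: orthproj_inj; rewrite orthproj_rotate ?(orthgrp_orth gV)//.
by rewrite -mulmxA orthgrp_comm// mulmxA (orthgrp_orth' gV) mul1mx.
Qed.

Lemma orthgrpS V W g : (V <= W)%VS -> orthgrp V g -> orthgrp W g.
Proof.
move=> VW gV; apply: orthgrpP; first exact: orthgrp_orth gV.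
move=> u /memv_orthP uW; apply: (orthgrp_fix gV); apply/memv_orthP => v vV.
by apply: uW; exact: (subvP VW).
Qed.

Lemma orthgrp_fixed V W g : (V <= orthv W)%VS -> orthgrp V g -> rotate g W = W.
Proof.
move=> VW gV; apply/vspaceP => u.
have gW v : v \in W -> v *m g = v.
  move=> vW; apply: (orthgrp_fix gV); apply/memv_orthP => w /(subvP VW)/memv_orthP.
  by move=> /(_ _ vW); rewrite dotC.
apply/idP/idP => [/mem_rotate[v vW ->]|uW]; first by rewrite gW.
by apply/mem_rotate; exists u; rewrite ?gW.
Qed.

Lemma to_orthgrpP V g : orthgrp V (to_orthgrp V g).
Proof. by rewrite /to_orthgrp; case: ifP => // _; exact: orthgrp1. Qed.

Lemma to_orthgrp_id V g : orthgrp V g -> to_orthgrp V g = g.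
Proof. by rewrite /to_orthgrp => ->. Qed.

Lemma measurable_to_orthgrp V d (T : measurableType d) (f : T -> 'M[R]_n) :
  measurable_fun setT f -> measurable_fun setT (fun x => to_orthgrp V (f x)).
Proof.
move=> mf; apply: measurable_fun_ifT => //.
apply: measurable_and; apply: measurable_fun_eqmx; (try exact: measurable_cst).
  by apply: measurable_mulmx => //; exact: measurable_trmx.
by apply: measurable_mulmx => //; exact: measurable_cst.
Qed.

Lemma reflection_orthgrp V a b : a \in V -> b \in V -> orthgrp V (reflection a b).
Proof.
move=> aV bV; apply: orthgrpP; first exact: reflection_orth.
by move=> u /memv_orthP uV; apply: reflection_fix; rewrite uV// memvB.
Qed.

Lemma measurable_reflection a d (T : measurableType d) (f : T -> 'rV[R]_n) :
  measurable_fun setT f -> measurable_fun setT (fun x => reflection a (f x)).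
Proof.
move=> mf; have mab : measurable_fun setT (fun x => a - f x).
  by apply: measurable_subrmx => //; exact: measurable_cst.
apply: measurable_subrmx; first exact: measurable_cst.
apply: measurable_scalemx; last first.
  by apply: measurable_mulmx => //; exact: measurable_trmx.
apply: measurable_funM; first exact: measurable_cst.
by apply: measurable_fun_inv; exact: measurable_dot.
Qed.

Lemma orthgrp_transitive V a b : a \in V -> b \in V -> dot a a = dot b b ->
  exists2 g, orthgrp V g & a *m g = b.
Proof.
by move=> aV bV ab; exists (reflection a b); [exact: reflection_orthgrp|exact: reflection_swap].
Qed.

(** The rotation sends an orthonormal frame of [W1] to one of [W2], a frame of the complement of
    [W1] in [V] to one of the complement of [W2], and fixes what is orthogonal to [V]. *)
Lemma orthgrp_transitive_subspaces V W1 W2 : (W1 <= V)%VS -> (W2 <= V)%VS ->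
  \dim W1 = \dim W2 -> exists2 g, orthgrp V g & rotate g W1 = W2.
Proof.
move=> W1V W2V d12.
have dc : \dim (orthv W1 :&: V)%VS = \dim (orthv W2 :&: V)%VS.
  by rewrite !dim_orthv_cap// d12.
set m := \dim W2 in d12; set m' := \dim (orthv W2 :&: V)%VS in dc.
pose B1 := frame m W1; pose B2 := frame m W2.
pose C1 := frame m' (orthv W1 :&: V)%VS; pose C2 := frame m' (orthv W2 :&: V)%VS.
have B1B : B1 *m B1^T = 1%:M by exact: frame_orth.
have B2B : B2 *m B2^T = 1%:M by exact: frame_orth.
have C1C : C1 *m C1^T = 1%:M by exact: frame_orth.
have C2C : C2 *m C2^T = 1%:M by exact: frame_orth.
have B1P : B1^T *m B1 = orthproj W1 by exact: frame_orthproj.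
have B2P : B2^T *m B2 = orthproj W2 by exact: frame_orthproj.
have C1P : C1^T *m C1 = orthproj V - orthproj W1 by rewrite frame_orthproj// orthproj_cap.
have C2P : C2^T *m C2 = orthproj V - orthproj W2 by rewrite frame_orthproj// orthproj_cap.
have frE d W (B : 'M[R]_(d, n)) : B *m B^T = 1%:M -> B^T *m B = orthproj W -> B = B *m orthproj W.
  by move=> BB <-; rewrite mulmxA BB mul1mx.
have cE d (B : 'M[R]_(d, n)) U : (U <= V)%VS -> B *m B^T = 1%:M ->
    B^T *m B = orthproj V - orthproj U -> B *m orthproj V = B /\ B *m orthproj U = 0.
  move=> UV BB BP.
  have BE : B = B *m (orthproj V - orthproj U) by rewrite -BP mulmxA BB mul1mx.
  split; rewrite BE -mulmxA mulmxBl.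
    by rewrite orthproj_idem subv_orthproj.
  by rewrite subv_orthproj'// orthproj_idem subrr mulmx0.
have [C2V C2W] := cE _ _ _ W2V C2C C2P.
have B2E := frE _ _ _ B2B B2P; have B1E := frE _ _ _ B1B B1P.
have B2V : B2 *m orthproj V = B2 by rewrite B2E -mulmxA subv_orthproj.
have CB : C2 *m B2^T = 0.
  by rewrite B2E trmx_mul orthproj_trmx mulmxA C2W mul0mx.
have BC : B2 *m C2^T = 0 by apply: trmx_inj; rewrite trmx_mul trmxK CB trmx0.
pose Q := 1%:M - orthproj V.
have QT : Q^T = Q by rewrite linearB/= trmx1 orthproj_trmx.
have QQ : Q *m Q = Q by rewrite /Q -orthproj_orthv orthproj_idem.
have BQ : B2 *m Q = 0 by rewrite mulmxBr mulmx1 B2V subrr.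
have CQ : C2 *m Q = 0 by rewrite mulmxBr mulmx1 C2V subrr.
have QB : Q *m B2^T = 0 by apply: trmx_inj; rewrite trmx_mul trmxK QT BQ trmx0.
have QC : Q *m C2^T = 0 by apply: trmx_inj; rewrite trmx_mul trmxK QT CQ trmx0.
have QE : Q = 1%:M - orthproj V by [].
clearbody Q.
pose g := B1^T *m B2 + C1^T *m C2 + Q.
have gT : g^T = B2^T *m B1 + C2^T *m C1 + Q.
  by rewrite /g 2!linearD/= QT !trmx_mul !trmxK.
have gg : g *m g^T = 1%:M.
  rewrite gT /g !(mulmxDl, mulmxDr) -!mulmxA.
  rewrite !(mulmxA B2) !(mulmxA C2) !(mulmxA Q) B2B C2C BC CB BQ CQ QB QC QQ.
  rewrite !(mul0mx, mulmx0, mul1mx, addr0, add0r) B1P C1P QE.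
  by rewrite [orthproj W1 + _]addrC subrK addrC subrK.
have W1g : rotate g W1 = W2.
  apply: orthproj_inj; rewrite orthproj_rotate//.
  have B1W : B1 *m g = B2.
    have B1C : B1 *m C1^T = 0.
      have [_ C1W] := cE _ _ _ W1V C1C C1P.
      apply: trmx_inj; rewrite trmx0 trmx_mul trmxK B1E trmx_mul orthproj_trmx.
      by rewrite mulmxA C1W mul0mx.
    have B1Q : B1 *m Q = 0 by rewrite QE mulmxBr mulmx1 B1E -mulmxA subv_orthproj// subrr.
    by rewrite /g !mulmxDr !mulmxA B1B B1C B1Q mul1mx mul0mx !addr0.
  by rewrite -B1P mulmxA -trmx_mul -mulmxA B1W.
exists g => //; apply: orthgrpP => // u uV.
have uQ : u *m Q = u by rewrite QE mulmxBr mulmx1 mulmx_orthproj_orth// subr0.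
have uz d (B : 'M[R]_(d, n)) : B *m orthproj V = B -> u *m B^T = 0.
  by move=> <-; rewrite trmx_mul orthproj_trmx mulmxA mulmx_orthproj_orth// mul0mx.
have B1V : B1 *m orthproj V = B1 by rewrite B1E -mulmxA subv_orthproj.
have [C1V _] := cE _ _ _ W1V C1C C1P.
by rewrite /g !mulmxDr !mulmxA !uz// !mul0mx !add0r.
Qed.

End subspace_rotation_groups.

(** * Existence of a right-invariant probability *)

Section haar_measures.
Local Open Scope ereal_scope.
Context {R : realType} {n : nat}.
Implicit Types (V W : {vspace 'rV[R]_n}) (g h k : 'M[R]_n).

Lemma ge0_eq_integral_set0 d (m : {measure set 'rV[R]_d -> \bar R})
    (F G : 'rV[R]_d -> \bar R) : m [set 0%R] = 0 ->
  measurable_fun setT F -> measurable_fun setT G ->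
  (forall x, 0 <= F x) -> (forall x, 0 <= G x) ->
  (forall x, x != 0%R -> F x = G x) -> \int[m]_x F x = \int[m]_x G x.
Proof.
move=> m0 mF mG F0 G0 FG; apply: ge0_ae_eq_integral => //.
exists [set 0%R]; split => //; first exact: measurable_mx_set1.
move=> x /= H; apply: contrapT => x0; apply: H => _; apply: FG.
by apply/eqP.
Qed.

(** Only the image of [H] under [to_orthgrp V] is constrained; [H] itself may charge other
    matrices. *)
Definition right_haar V (H : probability 'M[R]_n R) :=
  forall (F : 'M[R]_n -> \bar R) k, measurable_fun setT F -> (forall g, 0 <= F g) ->
    orthgrp V k ->
    \int[H]_g F (to_orthgrp V g *m k)%R = \int[H]_g F (to_orthgrp V g).

(* A rotation of [V] is determined by the image [w] of a unit vector [b] and by a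
   rotation of the orthogonal complement of [b] in [V]. *)
Lemma right_haar_exists V : exists H, right_haar V H.
Proof.
have [d dV] : exists d, \dim V = d by exists (\dim V).
elim: d V dV => [|d IH] V dV.
  exists (dirac (1%:M : 'M[R]_n)%R) => F k mF F0 kV; congr (integral _ _ _).
  apply/funext => g; congr F.
  have /eqP V0 : (V == 0)%VS by rewrite -dimv_eq0 dV.
  have -> : k = 1%:M%R.
    have /andP[_ /eqP] := kV.
    by rewrite V0 orthproj_orthv orthproj0 subr0 mul1mx.
  by rewrite mulmx1.
have V0 : V != 0%VS by rewrite -dimv_eq0 dV.
have [bV b1] := pivot_unit V0; move: (pivot _ _) bV b1 => {V0} b bV b1.
pose V' := (orthv <[b]> :&: V)%VS.
have dV' : \dim V' = d by have := dim_cap_orth1 bV b1; rewrite dV => -[].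
have V'V : (V' <= V)%VS by exact: capvSr.
have [H' hH'] := IH _ dV'.
have [P [P0 Pinv]] := @rotation_invariant_probability R _ (ltn0Sn d).
pose B := frame d.+1 V.
have BB : (B *m B^T = 1%:M)%R by exact: frame_orth.
have BP : (B^T *m B = orthproj V)%R by exact: frame_orthproj.
clearbody B.
have BV x : (x *m B \in V)%R.
  apply/orthprojP; rewrite -BP -mulmxA; congr (_ *m _)%R.
  by rewrite mulmxA BB mul1mx.
(* The direction of [x], carried into [V] by the frame; [b] is a dummy value at 0. *)
pose w (x : 'rV[R]_d.+1) : 'rV[R]_n :=
  if x == 0%R then b else ((enorm x)^-1 *: (x *m B))%R.
have wV x : w x \in V by rewrite /w; case: ifP => // _; rewrite memvZ.
have w1 x : dot (w x) (w x) = 1%R.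
  rewrite /w; case: eqVneq => // x0.
  rewrite dotZ dot_mulmx// -enorm_sqr -expr2 -exprMn mulVf ?expr1n//.
  by apply: contra x0 => /eqP/enorm_eq0/eqP.
have mw : measurable_fun setT w.
  apply: measurable_fun_ifT => //.
    by apply: measurable_fun_eqmx => //; exact: measurable_cst.
  apply: measurable_scalemx.
    by apply: measurable_fun_inv; exact: measurable_enorm.
  by apply: measurable_mulmx => //; exact: measurable_cst.
(* First a rotation fixing [b], then the reflection taking [b] to the random direction [w z.1]. *)
pose X (z : 'rV[R]_d.+1 * 'M[R]_n) : 'M[R]_n :=
  (to_orthgrp V' z.2 *m reflection b (w z.1))%R.
have mX : measurable_fun setT X.
  apply: measurable_mulmx; first exact: measurable_to_orthgrp.
  by apply: measurable_reflection; exact: measurableT_comp mw _.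
pose mfX : {mfun ('rV[R]_d.+1 * 'M[R]_n)%type >-> 'M[R]_n} :=
  HB.pack X (isMeasurableFun.Build _ _ _ _ X mX).
have XV z : orthgrp V (X z).
  apply: orthgrpM; last exact: reflection_orthgrp.
  exact: (orthgrpS V'V (to_orthgrpP _ _)).
exists (distribution (P \x H') mfX) => F k mF F0 kV.
pose Phi w := \int[H']_h F (to_orthgrp V' h *m reflection b w)%R.
have mPhi : measurable_fun setT Phi.
  apply: measurable_integral_ge0 => //; apply: measurableT_comp => //.
  apply: measurable_mulmx; first exact: measurable_to_orthgrp.
  exact: measurable_reflection.
have Phi0 v : 0 <= Phi v by exact: integral_ge0.
have step k' : orthgrp V k' ->
    \int[distribution (P \x H') mfX]_g F (to_orthgrp V g *m k')%R =
    \int[P]_x Phi (w x *m k')%R.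
  move=> k'V; have mk : measurable_fun setT (fun g => F (to_orthgrp V g *m k')%R).
    apply: measurableT_comp => //; apply: measurable_mulmx; last exact: measurable_cst.
    exact: measurable_to_orthgrp.
  rewrite (ge0_integral_distribution mfX mk); last by move=> g; exact: F0.
  rewrite fubini_tonelli1; last 2 first.
  - exact: (measurableT_comp mk mX).
  - by move=> z; exact: F0.
  apply: eq_integral => x _; rewrite /fubini_F/= /Phi.
  pose v := (w x *m k')%R.
  have vV : v \in V by rewrite -(orthgrp_rotate k'V); apply/mem_rotate; exists (w x).
  have v1 : dot v v = 1%R by rewrite dot_mulmx ?(orthgrp_orth k'V).
  (* As [b] goes to [w x], then to [v], then back to [b], [k''] fixes [b] and is a rotation of [V'];
     the invariance of [H'] absorbs it. *)
  pose k'' := (reflection b (w x) *m k' *m (reflection b v)^T)%R.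
  have k''V : orthgrp V k''.
    apply: orthgrpM; last by apply: orthgrp_trmx; exact: reflection_orthgrp.
    by apply: orthgrpM; first exact: reflection_orthgrp.
  have k''V' : orthgrp V' k''.
    rewrite /orthgrp (orthgrp_orth k''V) eqxx/=; apply/eqP.
    rewrite orthproj_orthv orthproj_cap ?orthproj_line ?opprB ?addrA -?memvE//.
    rewrite addrAC -orthproj_orthv mulmxDl; congr (_ + _)%R.
      by have /andP[_ /eqP] := k''V.
    rewrite -mulmxA; congr (_ *m _)%R; rewrite !mulmxA reflection_swap ?b1 ?w1//.
    by rewrite -/v -{1}(@reflection_swap _ _ b v) ?b1 ?v1// -mulmxA reflection_orth mulmx1.
  rewrite -[LHS]/(\int[H']_h F (to_orthgrp V (X (x, h)) *m k')%R).
  rewrite -(hH' (fun g => F (g *m reflection b v)%R) k'')//; last first.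
    apply: measurableT_comp => //; apply: measurable_mulmx => //; exact: measurable_cst.
  apply: eq_integral => h _; congr F.
  rewrite to_orthgrp_id// /X/= /k'' -!mulmxA; congr (_ *m (_ *m _))%R.
  by rewrite reflection_trmx -{2}[reflection b v]reflection_trmx reflection_orth mulmx1.
have -> : \int[distribution (P \x H') mfX]_g F (to_orthgrp V g) =
    \int[distribution (P \x H') mfX]_g F (to_orthgrp V g *m 1%:M)%R.
  by apply: eq_integral => g _; rewrite mulmx1.
rewrite (step _ kV) (step _ (orthgrp1 V)); clearbody Phi => {step}.
(* [k] in the coordinates of the frame [B]: an orthogonal matrix, under which [P] is invariant. *)
pose c := (B *m k *m B^T)%R.
have BkE : (c *m B = B *m k)%R.
  rewrite /c -mulmxA BP -mulmxA -(orthgrp_comm kV) mulmxA; congr (_ *m _)%R.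
  by rewrite -BP mulmxA BB mul1mx.
have cc : (c *m c^T = 1%:M)%R.
  have -> : (c^T = B *m (k^T *m B^T))%R by rewrite /c !trmx_mul trmxK.
  by rewrite mulmxA BkE mulmxA -(mulmxA B) (orthgrp_orth kV) mulmx1.
have mPw k' : measurable_fun setT (fun x => Phi (w x *m k')%R).
  apply: (measurableT_comp mPhi).
  by apply: measurable_mulmx => //; exact: measurable_cst.
have mc : measurable_fun setT (fun x : 'rV[R]_d.+1 => x *m c)%R.
  by apply: measurable_mulmx => //; exact: measurable_cst.
rewrite -[RHS](Pinv c (fun x => Phi (w x *m 1%:M)%R))//.
(* [w (x *m c) = w x *m k] may fail at [x = 0], where [w] takes its dummy value; [P] does not charge
   0. *)
apply: ge0_eq_integral_set0 => //; first exact: (measurableT_comp (mPw 1%:M%R) mc).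
move=> x x0; congr Phi; rewrite mulmx1 /w (negbTE x0).
have /negbTE -> : (x *m c)%R != 0%R.
  by apply: contra x0 => /eqP xc; apply/eqP; rewrite -[x]mulmx1 -cc mulmxA xc mul0mx.
by rewrite enorm_mulmx// -scalemxAl -mulmxA -BkE mulmxA.
Qed.

End haar_measures.

(** * Inversion and left translation *)

Section haar_invariance.
Local Open Scope ereal_scope.
Context {R : realType} {n : nat}.
Implicit Types (V W : {vspace 'rV[R]_n}) (g h k : 'M[R]_n).

Definition haar V : probability 'M[R]_n R := projT1 (cid (right_haar_exists V)).

Lemma haar_mulmxr V : right_haar V (haar V).
Proof. exact: projT2 (cid (right_haar_exists V)). Qed.

Lemma integral_probability_cst d (T : measurableType d) (P : probability T R) (c : \bar R) :
  \int[P]_x c = c.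
Proof.
apply: (etrans (integral_cst P measurableT c)).
exact: (etrans (congr1 (fun x => c * x) (probability_setT P)) (mule1 c)).
Qed.

(** Transposition is inversion here. In the double integral of [F (h *m g^T)], right translation of
    [g] by [h^T] removes [h], and right translation of [h] by [g^T] removes [g]. *)
Lemma haar_trmx V (F : 'M[R]_n -> \bar R) :
  measurable_fun setT F -> (forall g, 0 <= F g) ->
  \int[haar V]_g F ((to_orthgrp V g)^T)%R = \int[haar V]_g F (to_orthgrp V g).
Proof.
move=> mF F0; pose G := to_orthgrp V.
have mFT : measurable_fun setT (fun g => F g^T%R).
  by apply: measurableT_comp => //; exact: measurable_trmx.
transitivity (\int[haar V]_h \int[haar V]_g F (G h *m (G g)^T)%R).
  rewrite -[LHS](integral_probability_cst (haar V)); apply: eq_integral => h _.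
  rewrite -(@haar_mulmxr V (fun g => F g^T%R) (G h)^T%R)//; last first.
    by apply: orthgrp_trmx; exact: to_orthgrpP.
  by apply: eq_integral => g _; rewrite trmx_mul trmxK.
rewrite tonelli//; last first.
  apply: measurableT_comp => //; apply: measurable_mulmx.
    exact: measurable_to_orthgrp.
  by apply: measurable_trmx; exact: measurable_to_orthgrp.
rewrite -[RHS](integral_probability_cst (haar V)); apply: eq_integral => g _.
by apply: haar_mulmxr => //; apply: orthgrp_trmx; exact: to_orthgrpP.
Qed.

(** Right invariance conjugated by inversion. *)
Lemma haar_mulmxl V (F : 'M[R]_n -> \bar R) k :
  measurable_fun setT F -> (forall g, 0 <= F g) -> orthgrp V k ->
  \int[haar V]_g F (k *m to_orthgrp V g)%R = \int[haar V]_g F (to_orthgrp V g).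
Proof.
move=> mF F0 kV.
have mFk : measurable_fun setT (fun g => F (k *m g)%R).
  by apply: measurableT_comp => //; apply: measurable_mulmx => //; exact: measurable_cst.
have mFT : measurable_fun setT (fun g => F g^T%R).
  by apply: measurableT_comp => //; exact: measurable_trmx.
rewrite -(@haar_trmx V (fun g => F (k *m g)%R))// -[RHS](haar_trmx V mF F0).
rewrite -(@haar_mulmxr V (fun g => F g^T%R) k^T%R)//; last exact: orthgrp_trmx.
by apply: eq_integral => g _; rewrite trmx_mul trmxK.
Qed.

End haar_invariance.

(** * Existence and uniqueness of the invariant measure on a Grassmannian *)

Section grassmann_measures.
Local Open Scope ereal_scope.
Context {R : realType} {n : nat}.
Implicit Types (V W : {vspace 'rV[R]_n}) (g h k : 'M[R]_n).

Lemma orthgrp_mem V g u : orthgrp V g -> u \in V -> (u *m g \in V)%R.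
Proof.
move=> gV uV; have : (u *m g)%R \in rotate g V by apply/mem_rotate; exists u.
by rewrite orthgrp_rotate.
Qed.

Lemma measurable_rotate d (T : measurableType d) (f : T -> 'M[R]_n)
    (W : T -> {vspace 'rV[R]_n}) : (forall x, f x *m (f x)^T = 1%:M)%R ->
  measurable_fun setT f -> measurable_fun setT W ->
  measurable_fun setT (fun x => rotate (f x) (W x)).
Proof.
move=> ff mf /measurable_vspaceP mW; apply/measurable_vspaceP.
under eq_fun do rewrite orthproj_rotate//.
by apply: measurable_mulmx => //; apply: measurable_mulmx => //; exact: measurable_trmx.
Qed.

Lemma measurable_grassmann V m : measurable (grassmann V m).
Proof.
rewrite (_ : grassmann V m =
   [set eta | orthproj eta *m orthproj V = orthproj eta]%R `&` [set eta | \dim eta = m]).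
  apply: measurableI; last exact: measurable_dim.
  apply: measurable_eqmx; last exact: measurable_orthproj.
  by apply: measurable_mulmx; [exact: measurable_orthproj|exact: measurable_cst].
apply/seteqP; split => eta [] /= => [/subv_orthproj|/orthproj_subv]; by [].
Qed.

Lemma to_orthgrp_orth V g : (to_orthgrp V g *m (to_orthgrp V g)^T = 1%:M)%R.
Proof. exact: (orthgrp_orth (to_orthgrpP V g)). Qed.

Definition orbit_map V W (g : 'M[R]_n) := rotate (to_orthgrp V g) W.

Lemma measurable_orbit V W : measurable_fun setT (orbit_map V W).
Proof.
apply: measurable_rotate => [g| |]; first exact: to_orthgrp_orth.
  exact: measurable_to_orthgrp.
exact: measurable_cst.
Qed.

HB.instance Definition _ V W := isMeasurableFun.Build _ _ _ _
  (orbit_map V W) (measurable_orbit V W).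

Definition orbit_measure V W : probability {vspace 'rV[R]_n} R :=
  distribution (haar V) (orbit_map V W).

Lemma orbit_measureE V W A : measurable A ->
  orbit_measure V W A = \int[haar V]_g (\1_A (rotate (to_orthgrp V g) W))%:E.
Proof.
move=> mA; rewrite -(integralT_indic (orbit_measure V W))// [LHS]ge0_integral_distribution//.
by apply/measurable_EFinP; exact: measurable_indic.
Qed.

Lemma measurable_indic_orbit V W (A : set {vspace 'rV[R]_n}) k : measurable A ->
  measurable_fun setT (fun g => (\1_A (rotate (to_orthgrp V g) W))%:E : \bar R).
Proof.
move=> mA; apply/measurable_EFinP; apply: measurableT_comp (measurable_orbit V W).
exact: measurable_indic.
Qed.

Lemma orbit_measure_invariant V W : (W <= V)%VS ->
  invariant_grassmann_measure V (\dim W) (orbit_measure V W).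
Proof.
move=> WV; split.
  rewrite -(probability_setT (haar V)); congr (haar V _).
  rewrite -subTset => g _ /=; split; last by rewrite dim_rotate// to_orthgrp_orth.
  by have := rotateS (to_orthgrp V g) WV; rewrite (orthgrp_rotate (to_orthgrpP V g)).
move=> g gg gV A mA.
(* [g] stabilizes [V] but need not fix its complement pointwise. [k] agrees with [g] on [V] and is
   the identity on the complement, so it is a rotation of [V] with the same effect on subspaces of
   [V]. *)
pose k := (orthproj V *m g + orthproj (orthv V))%R.
have Vg u : u \in V -> (u *m g \in V)%R.
  by move=> uV; rewrite -gV; apply/mem_rotate; exists u.
have PgP : (orthproj V *m g *m orthproj V = orthproj V *m g)%R.
  apply/row_matrixP => i; rewrite !rowE !mulmxA mulmx_orthproj_id//.
  exact/Vg/mulmx_orthproj_mem.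
have PQ : (orthproj V *m orthproj (orthv V) = 0)%R.
  by rewrite orthproj_orthv mulmxBr mulmx1 orthproj_idem subrr.
have kV : orthgrp V k.
  apply: orthgrpP => [|u uV]; last first.
    by rewrite /k mulmxDr mulmxA mulmx_orthproj_orth// mul0mx add0r mulmx_orthproj_id.
  have e1 : (orthproj V *m g *m (g^T *m orthproj V) = orthproj V)%R.
    by rewrite mulmxA -(mulmxA (orthproj V)) gg mulmx1 orthproj_idem.
  have e2 : (orthproj V *m g *m orthproj (orthv V) = 0)%R.
    by rewrite -PgP -mulmxA PQ mulmx0.
  have e3 : (orthproj (orthv V) *m (g^T *m orthproj V) = 0)%R.
    by apply: trmx_inj; rewrite !trmx_mul trmxK !orthproj_trmx e2 trmx0.
  rewrite /k linearD/= trmx_mul !orthproj_trmx mulmxDl !mulmxDr e1 e2 e3.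
  by rewrite addr0 add0r orthproj_idem orthproj_orthv addrC subrK.
have kE u : u \in V -> (u *m k = u *m g)%R.
  move=> uV; rewrite /k mulmxDr mulmxA mulmx_orthproj_id// [X in (_ + X)%R](_ : _ = 0%R) ?addr0//.
  by rewrite orthproj_orthv mulmxBr mulmx1 mulmx_orthproj_id// subrr.
clearbody k.
have mgA : measurable (rotate g @^-1` A).
  rewrite -[X in measurable X]setTI.
  have : measurable_fun setT (rotate g : {vspace 'rV[R]_n} -> _) by exact: measurable_rotate.
  by apply.
rewrite !orbit_measureE//.
pose F h : \bar R := (\1_A (rotate (to_orthgrp V h) W))%:E.
have mF : measurable_fun setT F by exact: measurable_indic_orbit.
have F0 h : 0 <= F h by rewrite lee_fin.
have FE h : orthgrp V h -> F h = (\1_A (rotate h W))%:E by move=> hV; rewrite /F to_orthgrp_id.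
transitivity (\int[haar V]_h F (to_orthgrp V h *m k)%R).
  apply: eq_integral => h _; rewrite FE; last exact: orthgrpM (to_orthgrpP V h) kV.
  rewrite !indicE; congr ((nat_of_bool _)%:R%:E).
  have -> : rotate (to_orthgrp V h *m k) W = rotate g (rotate (to_orthgrp V h) W).
    rewrite rotateM; apply/vspaceP => u.
    have hk v : v \in W -> (v *m (to_orthgrp V h *m k) = v *m (to_orthgrp V h *m g))%R.
      move=> vW; have : (v *m to_orthgrp V h \in V)%R.
        by apply: orthgrp_mem (to_orthgrpP V h) _; exact: (subvP WV).
      by move=> /kE; rewrite !mulmxA.
    by apply/idP/idP => /mem_rotate[v vW ->]; apply/mem_rotate; exists v; rewrite ?hk.
  by apply/idP/idP; rewrite !inE.
rewrite haar_mulmxr//; apply: eq_integral => h _; rewrite FE//; exact: to_orthgrpP.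
Qed.

(** Uniqueness by averaging. For an invariant [P], [P A] is the mean over [h] of the [P]-measure of
    the [eta] with [rotate h eta] in [A]; after exchanging the integrals, the mean over [h] no
    longer depends on [eta], because the rotations of [V] act transitively on its subspaces of given
    dimension. The orbit measure also provides the existence that [get] requires. *)
Lemma grassmann_measure_orbit V W : (W <= V)%VS -> forall A, measurable A ->
  grassmann_measure V (\dim W) A = orbit_measure V W A.
Proof.
move=> WV.
have [PT Pinv] : invariant_grassmann_measure V (\dim W) (grassmann_measure V (\dim W)).
  by apply: getPex; exists (orbit_measure V W); exact: orbit_measure_invariant.
move: (grassmann_measure V (\dim W)) PT Pinv => P PT Pinv A mA.
pose G := to_orthgrp V.
have mGA : measurable_fun setT (fun z : 'M[R]_n * {vspace 'rV[R]_n} =>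
    (\1_A (rotate (G z.1) z.2))%:E : \bar R).
  apply/measurable_EFinP; apply: measurableT_comp; first exact: measurable_indic.
  apply: measurable_rotate => //; first by move=> x; exact: to_orthgrp_orth.
  exact: measurable_to_orthgrp.
have P0 : P (~` grassmann V (\dim W)) = 0.
  by rewrite probability_setC ?PT ?subee//; exact: measurable_grassmann.
transitivity (\int[haar V]_h \int[P]_eta (\1_A (rotate (G h) eta))%:E).
  rewrite -[LHS](integral_probability_cst (haar V)); apply: eq_integral => h _.
  rewrite -[LHS](Pinv (G h)) ?(to_orthgrp_orth, orthgrp_rotate (to_orthgrpP V h))//.
  have mgA : measurable (rotate (G h) @^-1` A).
    rewrite -[X in measurable X]setTI.
    have : measurable_fun setT (rotate (G h) : {vspace 'rV[R]_n} -> _).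
      by apply: measurable_rotate => // _; exact: to_orthgrp_orth.
    by apply.
  by rewrite -integralT_indic.
rewrite tonelli; last 2 first.
- exact: mGA.
- by move=> x y; rewrite lee_fin.
rewrite -[RHS](integral_probability_cst P); apply: ge0_ae_eq_integral => //.
- apply: measurable_integral_ge0 => //.
  have msw : measurable_fun setT (fun z : {vspace 'rV[R]_n} * 'M[R]_n => (z.2, z.1)).
    exact: measurable_fun_pair.
  exact: (measurableT_comp mGA msw).
- by move=> x _; apply: integral_ge0 => *; rewrite lee_fin.
exists (~` grassmann V (\dim W)); split => //; first exact/measurableC/measurable_grassmann.
move=> eta /= H [etaV deta]; apply: H => _.
have [k kV <-] := orthgrp_transitive_subspaces WV etaV (esym deta).
rewrite orbit_measureE//.
pose F h : \bar R := (\1_A (rotate (to_orthgrp V h) W))%:E.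
have mF : measurable_fun setT F by exact: measurable_indic_orbit.
have F0 h : 0 <= F h by rewrite lee_fin.
rewrite [RHS](eq_integral (fun h => F (to_orthgrp V h))); last first.
  by move=> h _; rewrite /F (to_orthgrp_id (to_orthgrpP V h)).
rewrite -(haar_mulmxl mF F0 kV); apply: eq_integral => h _.
by rewrite /F to_orthgrp_id ?rotateM//; apply: orthgrpM => //; exact: to_orthgrpP.
Qed.

Lemma integral_grassmann m V W (F : {vspace 'rV[R]_n} -> \bar R) :
  (W <= V)%VS -> \dim W = m -> measurable_fun setT F ->
  \int[grassmann_measure V m]_eta F eta =
  \int[haar V]_g F (rotate (to_orthgrp V g) W).
Proof.
move=> WV <- mF; rewrite (eq_measure_integral (orbit_measure V W)); last first.
  by move=> A mA _; exact: grassmann_measure_orbit.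
exact: (integral_image (haar V) (orbit_map V W) mF).
Qed.

End grassmann_measures.

(** * Integration over planes *)

Section signed_transfer.
Local Open Scope ereal_scope.
Context {R : realType}.

(** [radon_integral] integrates signed functions whose convergence is not yet known, so changes of
    variables are carried from nonnegative to arbitrary measurable functions through positive and
    negative parts. *)
Lemma integral_transfer d1 d2 d (T1 : measurableType d1) (T2 : measurableType d2)
    (T : measurableType d) (m1 : {measure set T1 -> \bar R})
    (m2 : {measure set T2 -> \bar R}) (a : T1 -> T) (b : T2 -> T) :
  (forall F : T -> \bar R, measurable_fun setT F -> (forall x, 0 <= F x) ->
    \int[m1]_x F (a x) = \int[m2]_x F (b x)) ->
  forall F : T -> \bar R, measurable_fun setT F ->
    \int[m1]_x F (a x) = \int[m2]_x F (b x).
Proof.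
move=> H F mF; rewrite integralE [RHS]integralE; congr (_ - _).
  transitivity (\int[m1]_x F^\+ (a x)); first by apply: eq_integral => x _; rewrite !funeposE.
  rewrite H; [|exact: measurable_funepos|by move=> x; exact: funepos_ge0].
  by apply: eq_integral => x _; rewrite !funeposE.
transitivity (\int[m1]_x F^\- (a x)); first by apply: eq_integral => x _; rewrite !funenegE.
rewrite H; [|exact: measurable_funeneg|by move=> x; exact: funeneg_ge0].
by apply: eq_integral => x _; rewrite !funenegE.
Qed.

Lemma measurable_integral d1 d2 (T1 : measurableType d1) (T2 : measurableType d2)
    (m2 : {sigma_finite_measure set T2 -> \bar R}) (f : T1 -> T2 -> \bar R) :
  measurable_fun setT (fun z : T1 * T2 => f z.1 z.2) ->
  measurable_fun setT (fun x => \int[m2]_y f x y).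
Proof.
move=> mf.
rewrite (_ : (fun x => _) = fun x => \int[m2]_y (f x)^\+ y - \int[m2]_y (f x)^\- y); last first.
  by apply/funext => x; exact: integralE.
apply: emeasurable_funB; apply: measurable_integral_ge0 => //.
- rewrite (_ : (fun z => _) = (fun z : T1 * T2 => f z.1 z.2)^\+); first exact: measurable_funepos.
  by apply/funext => z; rewrite !funeposE.
- rewrite (_ : (fun z => _) = (fun z : T1 * T2 => f z.1 z.2)^\-); first exact: measurable_funeneg.
  by apply/funext => z; rewrite !funenegE.
Qed.

End signed_transfer.

(** * Integrals over subspaces and over the manifold of planes *)

Section subspace_integrals.
Local Open Scope ereal_scope.
Context {R : realType} {n : nat}.
Implicit Types (V W E : {vspace 'rV[R]_n}) (u v : 'rV[R]_n) (g h k : 'M[R]_n).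
Local Notation "'λ' d" := (@lebesgue_rV R d) (at level 10).

Lemma integral_rV_mulmx d (g : 'M[R]_d) (F : 'rV[R]_d -> \bar R) :
  (g *m g^T = 1%:M)%R -> measurable_fun setT F ->
  \int[λ d]_x F (x *m g)%R = \int[λ d]_x F x.
Proof.
move=> gg mF; apply: (integral_transfer (a := fun x => (x *m g)%R) (b := id)) mF.
by move=> {}F mF F0; exact: ge0_integral_rV_mulmx.
Qed.

(** Two orthonormal frames of [V] differ by an orthogonal matrix of coordinates, so Lebesgue measure
    on [V] does not depend on the chosen frame. *)
Lemma integral_frame d V (B : 'M[R]_(d, n)) (F : 'rV[R]_n -> \bar R) :
  (B *m B^T = 1%:M)%R -> (B^T *m B = orthproj V)%R -> measurable_fun setT F ->
  \int[λ d]_t F (t *m frame d V)%R = \int[λ d]_t F (t *m B)%R.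
Proof.
move=> BB BP mF; have [_ dV] := orthonormal_frame_dim BB BP.
have fB : (frame d V = (frame d V *m B^T) *m B)%R.
  by rewrite -mulmxA BP -(frame_orthproj dV) mulmxA (frame_orth dV) mul1mx.
under eq_integral do rewrite fB mulmxA.
apply: (integral_rV_mulmx (F := fun t => F (t *m B)%R)).
  rewrite trmx_mul trmxK mulmxA -(mulmxA _ B^T%R) BP -(frame_orthproj dV).
  by rewrite mulmxA (frame_orth dV) mul1mx (frame_orth dV).
apply: measurableT_comp => //; apply: measurable_mulmx => //; exact: measurable_cst.
Qed.

Lemma measurable_memv d (T : measurableType d) (u : T -> 'rV[R]_n) (V : T -> {vspace 'rV[R]_n}) :
  measurable_fun setT u -> measurable_fun setT V -> measurable [set x | u x \in V x].
Proof.
move=> mu /measurable_vspaceP mV.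
rewrite (_ : [set x | _] = [set x | u x *m orthproj (V x) = u x]%R).
  by apply: measurable_eqmx => //; exact: measurable_mulmx.
by apply/seteqP; split => x /= /orthprojP.
Qed.

Lemma integral_lebesgue_subspace d V (B : 'M[R]_(d, n)) (F : 'rV[R]_n -> \bar R) :
  (B *m B^T = 1%:M)%R -> (B^T *m B = orthproj V)%R -> measurable_fun setT F ->
  \int[lebesgue_subspace d V]_(y in [set y | y \in V]) F y = \int[λ d]_t F (t *m B)%R.
Proof.
move=> BB BP mF; have [fV dV] := orthonormal_frame_dim BB BP.
have mV : measurable [set y | y \in V].
  by apply: measurable_memv => //; exact: measurable_cst.
rewrite integral_mkcond integral_image; last first.
  by apply/(measurable_restrictT F mV); exact: measurable_funTS.
rewrite -(integral_frame BB BP)//; apply: eq_integral => t _.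
rewrite patchE mem_set//= /frame_map; apply/orthprojP.
by rewrite -(frame_orthproj dV) -!mulmxA (mulmxA (frame d V)) (frame_orth dV) mul1mx.
Qed.

Lemma measurable_planes m : measurable (planes m : set ({vspace 'rV[R]_n} * 'rV[R]_n)).
Proof.
rewrite (_ : planes m = [set x | \dim x.1 = m] `&` [set x | x.2 \in orthv x.1]); last first.
  by apply/seteqP; split.
apply: measurableI; first exact: measurable_dim.
apply: measurable_memv => //; apply: measurableT_comp => //.
exact: measurable_orthv.
Qed.

Lemma measurable_pair_rotate d (T : measurableType d) (f : T -> 'M[R]_n) E (u : T -> 'rV[R]_n) :
  (forall x, f x *m (f x)^T = 1%:M)%R -> measurable_fun setT f -> measurable_fun setT u ->
  measurable_fun setT (fun x => (rotate (f x) E, u x)).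
Proof.
move=> ff mf mu; apply: measurable_fun_pair => //.
by apply: measurable_rotate => //; exact: measurable_cst.
Qed.

Local Notation G := (to_orthgrp (fullv : {vspace 'rV[R]_n})).

(** By independence of the frame, the chosen frame of the rotated complement may be replaced by the
    rotated frame [C *m G g]; the integral then runs over a fixed product space, where [tonelli]
    applies. *)
Lemma ge0_integral_plane m E (C : 'M[R]_(n - m, n))
    (phi : {vspace 'rV[R]_n} * 'rV[R]_n -> \bar R) :
  \dim E = m -> (C *m C^T = 1%:M)%R -> (C^T *m C = orthproj (orthv E))%R ->
  measurable_fun setT phi -> (forall x, 0 <= phi x) ->
  \int[plane_measure m]_x phi x =
  \int[haar fullv]_g \int[λ (n - m)]_t phi (rotate (G g) E, t *m C *m G g)%R.
Proof.
move=> dE CC CP mphi phi0.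
pose Phi eta := \int[λ (n - m)]_t phi (eta, t *m frame (n - m) (orthv eta))%R.
have mpp : measurable_fun setT (fun x => phi (@plane_param R n m x)).
  exact: (measurableT_comp mphi (@measurable_plane_param R n m)).
have mPhi : measurable_fun setT Phi.
  by apply: measurable_integral_ge0 => //; exact: mpp.
rewrite ge0_integral_image// fubini_tonelli1//.
transitivity (\int[grassmann_measure fullv m]_eta Phi eta); first exact: eq_integral.
rewrite (integral_grassmann (subvf E) dE mPhi); apply: eq_integral => g _.
rewrite /Phi; set E' := rotate _ _.
rewrite (integral_frame (B := C *m G g) (V := orthv E') (F := fun v => phi (E', v))).
- by apply: eq_integral => t _; rewrite mulmxA.
- by rewrite trmx_mul mulmxA -(mulmxA C) to_orthgrp_orth mulmx1.
- rewrite trmx_mul mulmxA -(mulmxA _ C^T%R) CP.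
  by rewrite /E' orthv_rotate ?orthproj_rotate ?to_orthgrp_orth.
- apply: measurableT_comp => //.
Qed.

Lemma plane_measure_setC m : (m <= n)%N ->
  @plane_measure R n m (~` planes m) = 0.
Proof.
move=> mn; have mC : measurable (~` planes m : set ({vspace 'rV[R]_n} * 'rV[R]_n)).
  by apply: measurableC; exact: measurable_planes.
have [|E _ dE] := @exists_subspace R n fullv m; first by rewrite dimvf /dim/= mul1n.
have dO : \dim (orthv E) = (n - m)%N by rewrite dim_orthv dE.
rewrite -(integralT_indic (plane_measure m))//.
rewrite (ge0_integral_plane dE (frame_orth dO) (frame_orthproj dO)).
- rewrite integral0_eq// => g _; rewrite integral0_eq// => t _.
  rewrite indicE memNset//= /planes/=; apply; split.
    by rewrite dim_rotate// to_orthgrp_orth.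
  rewrite orthv_rotate ?to_orthgrp_orth//; apply/mem_rotate.
  exists (t *m frame (n - m) (orthv E))%R => //.
  apply/orthprojP; rewrite -(frame_orthproj dO).
  by rewrite -!mulmxA (mulmxA (frame _ _)) (frame_orth dO) mul1mx.
- by apply/measurable_EFinP; exact: measurable_indic.
- by move=> x; rewrite lee_fin.
Qed.

(* By transitivity, only the length of [v] matters. *)
Lemma haar_radial E (e v : 'rV[R]_n) (phi : {vspace 'rV[R]_n} * 'rV[R]_n -> \bar R) :
  measurable_fun setT phi -> (forall x, 0 <= phi x) ->
  e \in orthv E -> dot e e = 1%R -> v \in orthv E ->
  \int[haar fullv]_g phi (rotate (G g) E, v *m G g)%R =
  \int[haar fullv]_g phi (rotate (G g) E, (enorm v *: e) *m G g)%R.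
Proof.
move=> mphi phi0 eE e1 vE.
have [|k kE kv] := @orthgrp_transitive R n (orthv E) (enorm v *: e)%R v (memvZ _ eE) vE.
  by rewrite dotZ e1 mulr1 -expr2 enorm_sqr.
have kf : orthgrp fullv k by apply: (orthgrpS (subvf _) kE).
pose F g := phi (rotate (G g) E, (enorm v *: e) *m G g)%R.
have mF : measurable_fun setT F.
  apply: measurableT_comp => //; apply: measurable_pair_rotate.
  - by move=> x; exact: to_orthgrp_orth.
  - exact: measurable_to_orthgrp.
  - apply: measurable_mulmx; first exact: measurable_cst.
    exact: measurable_to_orthgrp.
transitivity (\int[haar fullv]_g F (k *m G g)%R).
  apply: eq_integral => g _; rewrite /F (to_orthgrp_id (orthgrpM kf (to_orthgrpP _ g))).
  by rewrite -rotateM (orthgrp_fixed (subvv _) kE) mulmxA kv.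
rewrite (haar_mulmxl mF _ kf); last by move=> g; exact: phi0.
apply: eq_integral => g _.
by rewrite /F (to_orthgrp_id (to_orthgrpP _ _)).
Qed.

(** Double integration again: right invariance of [H] against left invariance of [haar V]. *)
Lemma haar_unique V (H : probability 'M[R]_n R) (F : 'M[R]_n -> \bar R) :
  right_haar V H -> measurable_fun setT F -> (forall g, 0 <= F g) ->
  \int[H]_g F (to_orthgrp V g) = \int[haar V]_g F (to_orthgrp V g).
Proof.
move=> hH mF F0.
transitivity (\int[haar V]_g \int[H]_h F (to_orthgrp V h *m to_orthgrp V g)%R).
  rewrite -[LHS](integral_probability_cst (haar V)); apply: eq_integral => g _.
  by rewrite (hH F)//; exact: to_orthgrpP.
rewrite tonelli; last 2 first.
- apply: measurableT_comp => //.
  by apply: measurable_mulmx; exact: measurable_to_orthgrp.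
- by move=> x y; exact: F0.
rewrite -[RHS](integral_probability_cst H); apply: eq_integral => g _.
by rewrite haar_mulmxl//; exact: to_orthgrpP.
Qed.

Lemma orthgrp_conj V g h : (g *m g^T = 1%:M)%R ->
  orthgrp V h -> orthgrp (rotate g V) (g^T *m h *m g).
Proof.
move=> gg hV; apply: orthgrpP => [|u].
  rewrite !trmx_mul trmxK !mulmxA -(mulmxA _ g) gg mulmx1 -(mulmxA _ h).
  by rewrite (orthgrp_orth hV) mulmx1 (mulmx1C gg).
rewrite orthv_rotate// => /mem_rotate[v vV ->].
by rewrite !mulmxA -(mulmxA v) gg mulmx1 (orthgrp_fix hV).
Qed.

(** [haar] is chosen separately for each subspace, so nothing relates its values at [V] and at
    [rotate g V] beforehand. The conjugated measure is right invariant for [rotate g V], and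
    uniqueness identifies the two. *)
Lemma ge0_haar_conj V g (F : 'M[R]_n -> \bar R) : (g *m g^T = 1%:M)%R ->
  measurable_fun setT F -> (forall h, 0 <= F h) ->
  \int[haar (rotate g V)]_h F (to_orthgrp (rotate g V) h) =
  \int[haar V]_h F (g^T *m to_orthgrp V h *m g)%R.
Proof.
move=> gg mF F0.
pose X h := (g^T *m to_orthgrp V h *m g)%R.
have mX : measurable_fun setT X.
  apply: measurable_mulmx; last exact: measurable_cst.
  by apply: measurable_mulmx; [exact: measurable_cst|exact: measurable_to_orthgrp].
pose mfX : {mfun 'M[R]_n >-> 'M[R]_n} := HB.pack X (isMeasurableFun.Build _ _ _ _ X mX).
have XV h : orthgrp (rotate g V) (X h) by apply: orthgrp_conj => //; exact: to_orthgrpP.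
have IE (F' : 'M[R]_n -> \bar R) : measurable_fun setT F' -> (forall h, 0 <= F' h) ->
   \int[distribution (haar V) mfX]_h F' h = \int[haar V]_h F' (X h).
  by move=> mF' F'0; rewrite ge0_integral_distribution.
have mto k : measurable_fun setT (fun h => F (to_orthgrp (rotate g V) h)).
  by apply: measurableT_comp => //; exact: measurable_to_orthgrp.
suff rh : right_haar (rotate g V) (distribution (haar V) mfX).
  apply: etrans (esym (haar_unique rh mF F0)) _.
  apply: etrans (IE _ (mto 0%R) (fun h => F0 _)) _.
  by apply: eq_integral => h _; rewrite to_orthgrp_id.
move=> F' k mF' F'0 kV.
rewrite (IE (fun h => F' (to_orthgrp (rotate g V) h *m k)%R))//; last first.
  apply: measurableT_comp => //; apply: measurable_mulmx; last exact: measurable_cst.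
  exact: measurable_to_orthgrp.
rewrite (IE (fun h => F' (to_orthgrp (rotate g V) h))); last 2 first.
- by apply: measurableT_comp => //; exact: measurable_to_orthgrp.
- by move=> h; exact: F'0.
have kV' : orthgrp V (g *m k *m g^T)%R.
  have gT : (g^T *m g^T^T = 1%:M)%R by rewrite trmxK (mulmx1C gg).
  have := orthgrp_conj gT kV; rewrite trmxK rotateM gg rotate1//.
have mF'g : measurable_fun setT (fun h => F' (g^T *m h *m g)%R).
  apply: measurableT_comp => //; apply: measurable_mulmx; last exact: measurable_cst.
  by apply: measurable_mulmx => //; exact: measurable_cst.
have := haar_mulmxr mF'g (fun h => F'0 _) kV' => e.
rewrite (eq_integral (fun h => F' (g^T *m (to_orthgrp V h *m (g *m k *m g^T)) *m g)%R)) ?e.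
  by apply: eq_integral => h _; rewrite (to_orthgrp_id (XV h)).
move=> h _; rewrite (to_orthgrp_id (XV h)) /X !mulmxA.
by rewrite -(mulmxA _ g^T%R g) (mulmx1C gg) mulmx1.
Qed.

End subspace_integrals.

(** * The transform as an integral over rotations *)

Section radon_formula.
Local Open Scope ereal_scope.
Context {R : realType} {n : nat}.
Implicit Types (V W E : {vspace 'rV[R]_n}) (u v : 'rV[R]_n) (g h k : 'M[R]_n).
Local Notation "'λ' d" := (@lebesgue_rV R d) (at level 10).
Local Notation plane := ({vspace 'rV[R]_n} * 'rV[R]_n)%type.

Variables (j k : nat) (E1 E2 : {vspace 'rV[R]_n}) (Z : 'M[R]_(k - j, n)).
Hypotheses (E12 : (E1 <= E2)%VS) (dE1 : \dim E1 = j) (dE2 : \dim E2 = k).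
Hypotheses (ZZ : (Z *m Z^T = 1%:M)%R) (ZP : (Z^T *m Z = orthproj (orthv E1 :&: E2)%VS)%R).

(* The integral of [f] over the [j]-planes contained in the [k]-plane obtained from
   [E2] by the rotation [g] followed by the translation [u]. *)
Definition radon_flag (f : plane -> R) g u : \bar R :=
  \int[haar E2]_h \int[λ (k - j)]_z
    (f (rotate (to_orthgrp E2 h *m g) E1, z *m Z *m (to_orthgrp E2 h *m g) + u)%R)%:E.

Lemma measurable_radon_integrand f d (T : measurableType d) (a : T -> 'M[R]_n)
    (u : T -> 'rV[R]_n) (h : T -> 'M[R]_n) (z : T -> 'rV[R]_(k - j)) :
  measurable_fun setT f -> (forall x, a x *m (a x)^T = 1%:M)%R ->
  measurable_fun setT a -> measurable_fun setT u ->
  measurable_fun setT h -> measurable_fun setT z ->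
  measurable_fun setT (fun x => (f (rotate (to_orthgrp E2 (h x) *m a x) E1,
     z x *m Z *m (to_orthgrp E2 (h x) *m a x) + u x)%R : R)).
Proof.
move=> mf aa ma mu mh mz.
have mt : measurable_fun setT (fun x => to_orthgrp E2 (h x) *m a x)%R.
  by apply: measurable_mulmx => //; exact: measurable_to_orthgrp.
apply: measurableT_comp => //; apply: measurable_pair_rotate => //.
  by move=> x; rewrite trmx_mul mulmxA -(mulmxA _ (a x)) aa mulmx1 to_orthgrp_orth.
apply: measurable_addmx => //; apply: measurable_mulmx => //.
by apply: measurable_mulmx => //; exact: measurable_cst.
Qed.

Lemma measurable_radon_flag f d (T : measurableType d) (a : T -> 'M[R]_n)
    (u : T -> 'rV[R]_n) : measurable_fun setT f ->
  (forall x, a x *m (a x)^T = 1%:M)%R ->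
  measurable_fun setT a -> measurable_fun setT u ->
  measurable_fun setT (fun x => radon_flag f (a x) (u x)).
Proof.
move=> mf aa ma mu; apply: measurable_integral; apply: measurable_integral.
apply/measurable_EFinP.
apply: (@measurable_radon_integrand f _ _ (fun w : (T * 'M[R]_n) * 'rV[R]_(k - j) => a w.1.1)
  (fun w => u w.1.1) (fun w => w.1.2) snd) => //.
- by apply: (measurableT_comp ma); exact: (measurableT_comp measurable_fst measurable_fst).
- by apply: (measurableT_comp mu); exact: (measurableT_comp measurable_fst measurable_fst).
- exact: (measurableT_comp measurable_snd measurable_fst).
Qed.

Lemma haar_conj V g (F : 'M[R]_n -> \bar R) : (g *m g^T = 1%:M)%R ->
  measurable_fun setT F ->
  \int[haar (rotate g V)]_h F (to_orthgrp (rotate g V) h) =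
  \int[haar V]_h F (g^T *m to_orthgrp V h *m g)%R.
Proof.
move=> gg; apply: (integral_transfer (a := fun h => to_orthgrp (rotate g V) h)
  (b := fun h => (g^T *m to_orthgrp V h *m g)%R)).
by move=> F' mF' F'0; exact: ge0_haar_conj.
Qed.

Lemma integral_frames d V (B B' : 'M[R]_(d, n)) (F : 'rV[R]_n -> \bar R) :
  (B *m B^T = 1%:M)%R -> (B^T *m B = orthproj V)%R ->
  (B' *m B'^T = 1%:M)%R -> (B'^T *m B' = orthproj V)%R -> measurable_fun setT F ->
  \int[λ d]_t F (t *m B)%R = \int[λ d]_t F (t *m B')%R.
Proof. by move=> BB BP BB' BP' mF; rewrite -(integral_frame BB BP) ?(integral_frame BB' BP'). Qed.

(** The inner measures depend on the plane through chosen frames and Haar measures. Independence of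
    the frame replaces the frames by rotated copies of [Z], and conjugation of Haar measures brings
    the rotations back to [haar E2]. *)
Lemma radon_integralE f g u : (g *m g^T = 1%:M)%R -> measurable_fun setT f ->
  radon_integral j k f (rotate g E2, u) = radon_flag f g u.
Proof.
move=> gg mf; rewrite /radon_integral/=; set xi := rotate g E2.
have dxi : \dim xi = k by rewrite dim_rotate.
(* A frame of [orthv eta :&: xi] that is measurable in [eta]: for [eta] inside [xi] the difference
   of projections is the projection onto that intersection, and only such [eta] are integrated
   over. *)
pose N (eta : {vspace 'rV[R]_n}) := pivot_frame (k - j) (orthproj xi - orthproj eta)%R.
have mN : measurable_fun setT N.
  apply: measurable_pivot_frame; apply: measurable_subrmx; first exact: measurable_cst.
  exact: measurable_orthproj.
have NP eta : grassmann xi j eta ->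
    (N eta *m (N eta)^T = 1%:M /\ (N eta)^T *m N eta = orthproj (orthv eta :&: xi)%VS)%R.
  move=> [etaxi deta]; rewrite /N -orthproj_cap//; apply: pivot_frameP.
  by rewrite dim_orthv_cap// dxi deta.
clearbody N.
pose Phi eta := \int[λ (k - j)]_t (f (eta, t *m N eta + u)%R)%:E.
have mPhi : measurable_fun setT Phi.
  apply: measurable_integral; apply/measurable_EFinP; apply: measurableT_comp => //.
  apply: measurable_fun_pair; first exact: measurable_fst.
  apply: measurable_addmx; last exact: measurable_cst.
  by apply: measurable_mulmx; [exact: measurable_snd|exact: (measurableT_comp mN)].
have mfe (eta : {vspace 'rV[R]_n}) : measurable_fun setT (fun y : 'rV[R]_n => (f (eta, y + u)%R)%:E : \bar R).
  apply/measurable_EFinP; apply: measurableT_comp => //.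
  apply: measurable_fun_pair; first exact: measurable_cst.
  by apply: measurable_addmx => //; exact: measurable_cst.
transitivity (\int[grassmann_measure xi j]_(eta in grassmann xi j) Phi eta).
  apply: eq_integral => eta; rewrite inE => /NP[NN NO].
  exact: (integral_lebesgue_subspace NN NO (mfe eta)).
rewrite integral_mkcond.
have W12 : (rotate g E1 <= xi)%VS by exact: rotateS.
have dW : \dim (rotate g E1) = j by rewrite dim_rotate.
rewrite (integral_grassmann W12 dW); last first.
  apply/(measurable_restrictT _ (measurable_grassmann xi j)); exact: measurable_funTS.
pose F x := \int[λ (k - j)]_t (f (rotate (g *m to_orthgrp xi x) E1,
  t *m (Z *m (g *m to_orthgrp xi x)) + u)%R)%:E.
have mF : measurable_fun setT F.
  apply: measurable_integral; apply/measurable_EFinP; apply: measurableT_comp => //.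
  have mg : measurable_fun setT (fun z : 'M[R]_n * 'rV[R]_(k - j) => g *m to_orthgrp xi z.1)%R.
    apply: measurable_mulmx; first exact: measurable_cst.
    exact: measurable_to_orthgrp.
  apply: measurable_pair_rotate => //.
    by move=> x; rewrite trmx_mul mulmxA -(mulmxA g) to_orthgrp_orth mulmx1.
  apply: measurable_addmx; last exact: measurable_cst.
  apply: measurable_mulmx; first exact: measurable_snd.
  by apply: measurable_mulmx => //; exact: measurable_cst.
transitivity (\int[haar xi]_h F (to_orthgrp xi h)).
  apply: eq_integral => h _; set eta := rotate _ _.
  have hxi := to_orthgrpP xi h.
  have etaG : grassmann xi j eta.
    split; last by rewrite dim_rotate ?dim_rotate// to_orthgrp_orth.
    by have := rotateS (to_orthgrp xi h) W12; rewrite (orthgrp_rotate hxi).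
  rewrite patchE mem_set// /F (to_orthgrp_id hxi) /Phi.
  have [NN NO] := NP _ etaG.
  have gh : (g *m to_orthgrp xi h *m (g *m to_orthgrp xi h)^T = 1%:M)%R.
    by rewrite trmx_mul mulmxA -(mulmxA g) to_orthgrp_orth mulmx1.
  have e1 : rotate (g *m to_orthgrp xi h)%R E1 = eta by rewrite -rotateM.
  have e2 : rotate (g *m to_orthgrp xi h)%R E2 = xi by rewrite -rotateM orthgrp_rotate.
  move: (g *m to_orthgrp xi h)%R gh e1 e2 => x xx e1 e2; rewrite e1.
  apply: (integral_frames NN NO (B' := (Z *m x)%R) _ _ (mfe eta)).
    by rewrite trmx_mul mulmxA -(mulmxA Z) xx mulmx1.
  rewrite trmx_mul mulmxA -(mulmxA _ Z^T%R) ZP -e1 -e2.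
  rewrite (orthproj_cap (rotateS x E12)).
  by rewrite orthproj_cap// !orthproj_rotate// mulmxBr mulmxBl.
(* Conjugation turns [g *m (g^T *m h *m g)] into [h *m g], the rotation used by [radon_flag]. *)
rewrite (haar_conj E2 gg mF); apply: eq_integral => h _; rewrite /F.
have hc := orthgrp_conj gg (to_orthgrpP E2 h).
rewrite (to_orthgrp_id hc) (_ : g *m _ = to_orthgrp E2 h *m g)%R; last first.
  by rewrite !mulmxA gg mul1mx.
by under eq_integral do rewrite mulmxA.
Qed.

End radon_formula.

(** * Radial integrals *)

Section multiplicative_haar_measure.
Local Open Scope ereal_scope.
Context {R : realType}.
Local Notation leb := (@lebesgue_measure R).
Implicit Types (F K : R -> \bar R) (c r : R).

Definition hinv r : R := if (0 < r)%R then r^-1%R else 0%R.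

(* Integration against [dr / r] over the positive half-line. *)
Definition mint F : \bar R := \int[leb]_r ((hinv r)%:E * F r).

Lemma hinv_ge0 r : (0 <= hinv r)%R.
Proof. by rewrite /hinv; case: ifP => // r0; rewrite invr_ge0 ltW. Qed.

Lemma measurable_hinv : measurable_fun setT hinv.
Proof.
apply: measurable_fun_ifT.
- by apply: measurable_fun_ltr => //; exact: measurable_cst.
- by apply: measurable_fun_inv; exact: measurable_id.
- exact: measurable_cst.
Qed.

Lemma measurable_hinvE : measurable_fun setT (fun r => (hinv r)%:E).
Proof. by apply/measurable_EFinP; exact: measurable_hinv. Qed.

Lemma measurable_mint_integrand F : measurable_fun setT F ->
  measurable_fun setT (fun r => (hinv r)%:E * F r).
Proof. by move=> mF; apply: emeasurable_funM => //; exact: measurable_hinvE. Qed.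

Lemma mint_integrand_ge0 F r : (forall r, 0 <= F r) -> 0 <= (hinv r)%:E * F r.
Proof. by move=> F0; rewrite mule_ge0// lee_fin hinv_ge0. Qed.

Lemma mint_ge0 F : (forall r, 0 <= F r) -> 0 <= mint F.
Proof. by move=> F0; apply: integral_ge0 => r _; exact: mint_integrand_ge0. Qed.

Lemma eq_mint F K : (forall r, (0 < r)%R -> F r = K r) -> mint F = mint K.
Proof.
move=> FK; apply: eq_integral => r _; rewrite /hinv; case: ifPn => [/FK ->//|_].
by rewrite !mul0e.
Qed.

Lemma le_mint F K : measurable_fun setT F -> measurable_fun setT K ->
  (forall r, 0 <= F r) -> (forall r, 0 <= K r) ->
  (forall r, (0 < r)%R -> F r <= K r) -> mint F <= mint K.
Proof.
move=> mF mK F0 K0 FK; apply: ge0_le_integral => //.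
- by move=> r _; exact: mint_integrand_ge0.
- exact: measurable_mint_integrand.
- exact: measurable_mint_integrand.
move=> r _; rewrite /hinv; case: ifPn => [r0|_]; last by rewrite !mul0e.
by apply: lee_wpmul2l; [rewrite lee_fin invr_ge0 ltW|exact: FK].
Qed.

Lemma mintZl (k : \bar R) F : measurable_fun setT F -> (forall r, 0 <= F r) -> 0 <= k ->
  mint (fun r => k * F r) = k * mint F.
Proof.
move=> mF F0 k0; rewrite /mint -ge0_integralTZl//.
- by apply: eq_integral => r _; rewrite muleCA.
- exact: measurable_mint_integrand.
- by move=> r; exact: mint_integrand_ge0.
Qed.

Lemma mint_scale c F : (0 < c)%R -> measurable_fun setT F -> (forall r, 0 <= F r) ->
  mint (fun r => F (c * r)%R) = mint F.
Proof.
move=> c0 mF F0.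
have mH := measurable_mint_integrand mF.
have H0 r := mint_integrand_ge0 r F0.
transitivity (c%:E * (c^-1%:E * mint F)); last by rewrite muleA -EFinM mulfV ?gt_eqF// mul1e.
rewrite -(ge0_integral_scale c0 mH H0) -ge0_integralTZl.
- apply: eq_integral => r _; rewrite muleA; congr (_ * _).
  rewrite -EFinM /hinv pmulr_rgt0//; case: ifPn => r0; last by rewrite mulr0.
  by rewrite invfM mulrA mulfV ?gt_eqF// mul1r.
- apply: (measurableT_comp mH); apply: measurable_funM => //; exact: measurable_cst.
- by move=> r; exact: H0.
- by rewrite lee_fin ltW.
Qed.

(** Evaluate the integral of [W x * F (N x) * K (r * N x)] over [x] and over [dr / r] in two ways.
    Integrating [r] first produces [mint K], as [dr / r] absorbs [N x]. Using the invariance [inv]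
    for fixed [r] turns the integrand into [F (r^-1 * N x) * K (N x)], and the integral over [r] is
    then that of [F (r^-1)]. *)
Lemma scale_invariant_functional d (T : measurableType d)
    (m : {sigma_finite_measure set T -> \bar R}) (N W : T -> R) :
  measurable_fun setT N -> measurable_fun setT W -> (forall x, 0 <= W x)%R ->
  (forall x, W x != 0 -> 0 < N x)%R ->
  (forall F c, measurable_fun setT F -> (forall r, 0 <= F r) -> (0 < c)%R ->
    \int[m]_x ((W x)%:E * F (c * N x)%R) = \int[m]_x ((W x)%:E * F (N x))) ->
  forall F K, measurable_fun setT F -> measurable_fun setT K ->
    (forall r, 0 <= F r) -> (forall r, 0 <= K r) ->
  (\int[m]_x ((W x)%:E * F (N x))) * mint K =
  (\int[m]_x ((W x)%:E * K (N x))) * mint (fun r => F r^-1%R).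
Proof.
move=> mN mW W0 WN inv F K mF mK F0 K0.
have mFN : measurable_fun setT (fun x => F (N x)) by exact: (measurableT_comp mF mN).
have mKN : measurable_fun setT (fun x => K (N x)) by exact: (measurableT_comp mK mN).
have mWE : measurable_fun setT (fun x => (W x)%:E : \bar R) by exact/measurable_EFinP.
have W0E x : 0 <= (W x)%:E by rewrite lee_fin.
have H0 r : 0 <= (hinv r)%:E by rewrite lee_fin hinv_ge0.
have mFi : measurable_fun setT (fun r => F r^-1%R).
  by apply: (measurableT_comp mF); apply: measurable_fun_inv.
have mNs : measurable_fun setT (fun z : T * R => z.2 * N z.1)%R.
  by apply: measurable_funM; [exact: measurable_snd|exact: (measurableT_comp mN)].
have mNi : measurable_fun setT (fun z : T * R => z.2^-1 * N z.1)%R.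
  apply: measurable_funM; last exact: (measurableT_comp mN).
  by apply: measurable_fun_inv.
have mH2 : measurable_fun setT (fun z : T * R => (hinv z.2)%:E : \bar R).
  exact: (measurableT_comp measurable_hinvE).
have mW1 : measurable_fun setT (fun z : T * R => (W z.1)%:E : \bar R).
  exact: (measurableT_comp mWE).
transitivity (\int[m]_x \int[leb]_r
    ((hinv r)%:E * ((W x)%:E * (F (N x) * K (r * N x)%R)))).
  rewrite -ge0_integralTZr; last 3 first.
  - exact: emeasurable_funM.
  - by move=> x; rewrite mule_ge0.
  - exact: mint_ge0.
  apply: eq_integral => x _; have [Wx|Wx] := eqVneq (W x) 0%R.
    rewrite Wx !mul0e; apply/esym; apply: integral0_eq => r _.
    by rewrite mul0e mule0.
  rewrite -(mint_scale (WN _ Wx) mK K0) -mintZl; last 3 first.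
  - apply: (measurableT_comp mK); apply: measurable_funM => //; exact: measurable_cst.
  - by move=> r; exact: K0.
  - by rewrite mule_ge0.
  by apply: eq_integral => r _; rewrite -muleA (mulrC (N x)).
rewrite tonelli; last 2 first.
- apply: emeasurable_funM => //; apply: emeasurable_funM => //.
  apply: emeasurable_funM; first exact: (measurableT_comp mFN).
  exact: (measurableT_comp mK mNs).
- by move=> x r; rewrite !mule_ge0.
transitivity (\int[leb]_r \int[m]_x
    ((hinv r)%:E * ((W x)%:E * (F (r^-1 * N x)%R * K (N x))))).
  apply: eq_integral => r _.
  have mKr : measurable_fun setT (fun y => K (r * y)%R).
    by apply: (measurableT_comp mK); apply: measurable_funM => //; exact: measurable_cst.
  have mFr : measurable_fun setT (fun y => F (r^-1 * y)%R).
    by apply: (measurableT_comp mF); apply: measurable_funM => //; exact: measurable_cst.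
  rewrite !ge0_integralTZl//; last 4 first.
  - apply: emeasurable_funM => //; apply: emeasurable_funM => //; exact: (measurableT_comp mFr mN).
  - by move=> x; rewrite !mule_ge0.
  - apply: emeasurable_funM => //; apply: emeasurable_funM => //; exact: (measurableT_comp mKr mN).
  - by move=> x; rewrite !mule_ge0.
  rewrite /hinv; case: ifPn => [r0|_]; last by rewrite !mul0e.
  congr (_ * _).
  rewrite -(inv (fun y => F (r^-1 * y)%R * K y) r)//.
  - by apply: eq_integral => x _; rewrite mulrA mulVf ?gt_eqF// mul1r.
  - exact: emeasurable_funM.
  - by move=> y; rewrite mule_ge0.
rewrite -(tonelli m leb (f := fun x r =>
    (hinv r)%:E * ((W x)%:E * (F (r^-1 * N x)%R * K (N x))))); last 2 first.
- apply: emeasurable_funM => //; apply: emeasurable_funM => //.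
  apply: emeasurable_funM; last exact: (measurableT_comp mKN).
  exact: (measurableT_comp mF mNi).
- by move=> x r; rewrite !mule_ge0.
rewrite -ge0_integralTZr; last 3 first.
- exact: emeasurable_funM.
- by move=> x; rewrite mule_ge0.
- by apply: mint_ge0 => r.
apply: eq_integral => x _; have [Wx|Wx] := eqVneq (W x) 0%R.
  by rewrite Wx !mul0e; apply: integral0_eq => r _; rewrite mul0e mule0.
have Nx := WN _ Wx.
have Ni : (0 < (N x)^-1)%R by rewrite invr_gt0.
rewrite -(mint_scale Ni mFi)// -mintZl; last 3 first.
- apply: (measurableT_comp mFi); apply: measurable_funM => //; exact: measurable_cst.
- by move=> r.
- by rewrite mule_ge0.
apply: eq_integral => r _; congr (_ * _); rewrite -muleA; congr (_ * _).
by rewrite muleC invfM invrK mulrC.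
Qed.

(** Supplies test functions whose integral can be cancelled. *)
Lemma mint_indic (a b : R) : (0 < a)%R -> (a < b)%R ->
  0 < mint (fun r => (\1_(`]a, b]%classic) r)%:E) < +oo.
Proof.
move=> a0 ab; have b0 : (0 < b)%R by exact: lt_trans ab.
have mI : measurable_fun setT (fun r => (\1_(`]a, b]%classic) r)%:E : \bar R).
  by apply/measurable_EFinP; exact: measurable_indic.
have Ib : \int[leb]_r (\1_(`]a, b]%classic) r)%:E = (b - a)%:E.
  transitivity (leb `]a, b]%classic); first exact: integralT_indic.
  by rewrite lebesgue_measure_itv/= lte_fin ab.
apply/andP; split.
- apply: (@lt_le_trans _ _ ((b^-1)%:E * (b - a)%:E)).
    by rewrite -EFinM lte_fin mulr_gt0 ?invr_gt0// subr_gt0.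
  rewrite -Ib -ge0_integralTZl; last 3 first.
  - exact: mI.
  - by move=> r; rewrite lee_fin.
  - by rewrite lee_fin invr_ge0 ltW.
  apply: ge0_le_integral => //.
  + by move=> r _; rewrite mule_ge0 ?lee_fin// invr_ge0 ltW.
  + by apply: emeasurable_funM => //; exact: measurable_cst.
  + exact: measurable_mint_integrand.
  + move=> r _; rewrite -!EFinM lee_fin indicE.
    case: (boolP (r \in _)) => [|_]; last by rewrite !mulr0.
    rewrite inE/= in_itv/= => /andP[ar rb]; rewrite !mulr1 /hinv (lt_trans a0 ar).
    by rewrite lef_pV2// posrE// (lt_trans a0).
- apply: (@le_lt_trans _ _ ((a^-1)%:E * (b - a)%:E)); last by rewrite -EFinM ltry.
  rewrite -Ib -ge0_integralTZl; last 3 first.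
  - exact: mI.
  - by move=> r; rewrite lee_fin.
  - by rewrite lee_fin invr_ge0 ltW.
  apply: ge0_le_integral => //.
  + by move=> r _; rewrite mule_ge0 ?lee_fin ?hinv_ge0.
  + exact: measurable_mint_integrand.
  + by apply: emeasurable_funM => //; exact: measurable_cst.
  + move=> r _; rewrite -!EFinM lee_fin indicE.
    case: (boolP (r \in _)) => [|_]; last by rewrite !mulr0.
    rewrite inE/= in_itv/= => /andP[ar rb]; rewrite !mulr1 /hinv (lt_trans a0 ar).
    by rewrite lef_pV2 ?posrE ?(lt_trans a0 ar)// ltW.
Qed.

End multiplicative_haar_measure.

(** * Uniqueness of dr/r, substitutions and the Gamma function *)

Section mellin_integrals.
Local Open Scope ereal_scope.
Context {R : realType}.
Local Notation leb := (@lebesgue_measure R).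
Local Notation "'λ' d" := (@lebesgue_rV R d) (at level 10).
Implicit Types (F K : R -> \bar R) (c r s a : R).

Lemma mule_cancelr (k y z : \bar R) : 0 < k < +oo -> y * k = z * k -> y = z.
Proof.
case: k => [k| |] /andP[]//; rewrite lte_fin => k0 _ /(congr1 (fun w => w * (k^-1)%:E)).
by rewrite -!muleA -EFinM mulfV ?gt_eqF// !mule1.
Qed.

Local Notation K12 a b := (fun r => (\1_(`]a, b]%classic) r)%:E).

Let mK12 a b : measurable_fun setT (K12 a b : R -> \bar R).
Proof. by apply/measurable_EFinP; exact: measurable_indic. Qed.

Let K120 a b r : 0 <= (K12 a b r : \bar R).
Proof. by rewrite lee_fin. Qed.

Lemma measurable_comp_inv F : measurable_fun setT F -> measurable_fun setT (fun r => F r^-1%R).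
Proof. by move=> mF; apply: (measurableT_comp mF); apply: measurable_fun_inv. Qed.

(** [scale_invariant_functional] applied to [dr / r] itself, tested on one indicator; in return this
    removes the inversion from that identity. *)
Lemma mint_inv F : measurable_fun setT F -> (forall r, 0 <= F r) ->
  mint (fun r => F r^-1%R) = mint F.
Proof.
move=> mF F0; pose K : R -> \bar R := K12 1%R 2%R.
have WN (x : R) : (hinv x != 0 -> 0 < x)%R.
  by rewrite /hinv; case: ifPn => // _; rewrite eqxx.
have inv F' c : measurable_fun setT F' -> (forall r, 0 <= F' r) -> (0 < c)%R ->
    \int[leb]_x ((hinv x)%:E * F' (c * x)%R) = \int[leb]_x ((hinv x)%:E * F' x).
  by move=> mF' F'0 c0; exact: mint_scale.
have H : mint F * mint K = mint K * mint (fun r => F r^-1%R).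
  have mid : measurable_fun setT (id : R -> R) by exact: measurable_id.
  exact: (@scale_invariant_functional R _ _ leb id hinv mid measurable_hinv
    (@hinv_ge0 R) WN inv F K mF (mK12 _ _) F0 (K120 _ _)).
apply: (@mule_cancelr (mint K)); first by apply: mint_indic; lra.
by rewrite H muleC.
Qed.

Lemma scale_invariant_unique d (T : measurableType d)
    (m : {sigma_finite_measure set T -> \bar R}) (N W : T -> R) :
  measurable_fun setT N -> measurable_fun setT W -> (forall x, 0 <= W x)%R ->
  (forall x, W x != 0 -> 0 < N x)%R ->
  (forall F c, measurable_fun setT F -> (forall r, 0 <= F r) -> (0 < c)%R ->
    \int[m]_x ((W x)%:E * F (c * N x)%R) = \int[m]_x ((W x)%:E * F (N x))) ->
  forall F K, measurable_fun setT F -> measurable_fun setT K ->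
    (forall r, 0 <= F r) -> (forall r, 0 <= K r) ->
  (\int[m]_x ((W x)%:E * F (N x))) * mint K =
  (\int[m]_x ((W x)%:E * K (N x))) * mint F.
Proof.
move=> mN mW W0 WN inv F K mF mK F0 K0.
by rewrite (scale_invariant_functional mN mW W0 WN inv)// mint_inv.
Qed.

(** The left-hand side is invariant under dilations, hence a multiple of [mint F]. The constant is
    found on []1, 4]]: its inverse image under squaring is []1, 2]], while []1, 4]] is made of []1,
    2]] and its double. *)
Lemma mint_sqr F : measurable_fun setT F -> (forall r, 0 <= F r) ->
  mint (fun r => F (r ^+ 2)%R) = 2^-1%:E * mint F.
Proof.
move=> mF F0; pose k := mint (K12 1%R 2%R : R -> \bar R).
have k0 : 0 < k < +oo by apply: mint_indic; lra.
have k14 : mint (K12 1%R 4%R) = 2%:E * k.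
  transitivity (mint (fun r => K12 1%R 2%R r + K12 1%R 2%R (2^-1 * r)%R)).
    apply: eq_mint => r r0; rewrite -EFinD; congr (_%:E); rewrite !indicE.
    rewrite !mem_setE !in_itv/=.
    have -> : (1 < 2^-1 * r)%R = (2 < r)%R by apply/idP/idP; lra.
    have -> : (2^-1 * r <= 2)%R = (r <= 4)%R by apply/idP/idP; lra.
    case: (ltrP 1 r) => r1; case: (lerP r 2) => r2; case: (lerP r 4) => r4 /=;
      rewrite ?(addr0, add0r)//; lra.
  transitivity (k + mint (fun r => K12 1%R 2%R (2^-1 * r)%R)).
    rewrite /k /mint -ge0_integralD//.
    - by apply: eq_integral => r _; rewrite ge0_muleDr// ?K120.
    - by move=> r _; rewrite mule_ge0 ?K120// lee_fin hinv_ge0.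
    - exact: measurable_mint_integrand.
    - by move=> r _; rewrite mule_ge0 ?K120// lee_fin hinv_ge0.
    - apply: measurable_mint_integrand; apply: (measurableT_comp (mK12 _ _)).
      by apply: measurable_funM => //; exact: measurable_cst.
  have h2 : (0 < 2^-1 :> R)%R by rewrite invr_gt0.
  rewrite (mint_scale (F := K12 1%R 2%R) h2 (mK12 _ _) (K120 _ _)) -/k.
  by case: (k) k0 => [y| |] /andP[]// _ _; rewrite -EFinD -EFinM; congr (_%:E); ring.
have m2 : measurable_fun setT (fun r => r ^+ 2)%R by exact: measurable_funX.
have WN (x : R) : (hinv x != 0 -> 0 < x ^+ 2)%R.
  by rewrite /hinv; case: ifPn => [x0 _|]; [rewrite exprn_gt0|rewrite eqxx].
have inv F' c : measurable_fun setT F' -> (forall r, 0 <= F' r) -> (0 < c)%R ->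
    \int[leb]_x ((hinv x)%:E * F' (c * x ^+ 2)%R) = \int[leb]_x ((hinv x)%:E * F' (x ^+ 2)%R).
  move=> mF' F'0 c0; have sc : (0 < Num.sqrt c)%R by rewrite sqrtr_gt0.
  transitivity (mint (fun r => F' ((Num.sqrt c * r) ^+ 2)%R)).
    by apply: eq_integral => r _; rewrite exprMn sqr_sqrtr// ltW.
  by rewrite (mint_scale sc (F := fun r => F' (r ^+ 2)%R))//; exact: (measurableT_comp mF').
have H : mint (fun r => F (r ^+ 2)%R) * mint (K12 1%R 4%R) =
    mint (fun r => K12 1%R 4%R (r ^+ 2)%R) * mint F.
  exact: (@scale_invariant_unique _ _ leb (fun r => r ^+ 2)%R hinv m2 measurable_hinv
    (@hinv_ge0 R) WN inv F (K12 1%R 4%R) mF (mK12 _ _) F0 (K120 _ _)).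
have k41 : mint (fun r => K12 1%R 4%R (r ^+ 2)%R) = k.
  apply: eq_mint => r r0; congr (_%:E); rewrite !indicE !mem_setE !in_itv/=.
  have -> : (1 < r ^+ 2)%R = (1 < r)%R by apply/idP/idP; nra.
  by have -> : (r ^+ 2 <= 4)%R = (r <= 2)%R by apply/idP/idP; nra.
rewrite k41 k14 in H.
apply: (@mule_cancelr (2%:E * k)).
  case: (k) k0 => [x| |] /andP[]//; rewrite lte_fin => x0 _; rewrite -EFinM ltry lte_fin andbT; lra.
by rewrite H muleACA -EFinM mulVf ?pnatr_eq0// mul1e muleC.
Qed.

Lemma powR_sub1 t a : (0 < t)%R -> (t `^ (a - 1) = t `^ a / t)%R.
Proof. by move=> t0; rewrite powRD ?(gt_eqF t0) ?implybT// powR_inv1// ltW. Qed.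

Lemma mint_tail s : (0 < s)%R ->
  mint (fun t => ((\1_(`[1%R, +oo[%classic) t : R) * t `^ (- s))%R%:E) = s^-1%:E.
Proof.
move=> s0.
transitivity (\int[leb]_(t in `[1%R, +oo[) (t `^ (- s - 1))%:E).
  rewrite integral_mkcond; apply: eq_integral => t _.
  rewrite patchE indicE; case: (boolP (t \in _)) => [|_]; last by rewrite mul0r mule0.
  rewrite inE/= in_itv/= andbT mul1r -EFinM => t1; congr (_%:E).
  have t0 : (0 < t)%R by exact: lt_le_trans t1.
  by rewrite /hinv t0 powR_sub1// mulrC.
have dF (x : R) : (0 < x)%R -> is_derive x 1%R (fun t => - s^-1 * t `^ (- s))%R (x `^ (- s - 1))%R.
  move=> x0; have h := is_derive1_powR (- s)%R x0.
  rewrite (_ : (x `^ (- s - 1))%R = (- s^-1 *: (- s * x `^ (- s - 1)))%R).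
    exact: is_deriveZ.
  by rewrite /GRing.scale/= mulrA mulrNN mulVf ?mul1r// gt_eqF.
rewrite (@ge0_continuous_FTC2y R (fun t => t `^ (- s - 1)) (fun t => - s^-1 * t `^ (- s))%R 1 0)%R.
- by rewrite powR1 mulr1 -EFinB sub0r opprK.
- by move=> x _; exact: powR_ge0.
- apply: derivable_within_continuous => x; rewrite in_itv/= andbT => x1.
  by apply: derivable_powR; rewrite in_itv/= andbT (lt_le_trans _ x1).
- rewrite -[X in _ --> X](mulr0 (- s^-1)%R); apply: cvgMr.
  have pos : \forall x \near +oo%R, (0 < x `^ s)%R by near=> x; rewrite powR_gt0.
  have lim : (x `^ s)%R @[x --> +oo%R] --> +oo%R.
    apply/cvgryPge => A; near=> x.
    rewrite (@le_trans _ _ (Num.max A 0)%R)// ?le_max ?lexx//.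
    rewrite -[leLHS](@powRr1 _ (Num.max A 0)%R) ?le_max ?lexx ?orbT//.
    rewrite -(mulVf (lt0r_neq0 s0)) powRrM ge0_ler_powR// ?nnegrE ?powR_ge0 ?ltW//.
  under eq_fun do rewrite powRN.
  exact: (gtr0_cvgV0 pos).2 lim.
- move=> x x1; have x0 : (0 < x)%R by exact: lt_trans x1.
  by have [] := dF x x0.
- apply: cvg_at_right_filter.
  have [d1 _] := dF 1%R ltr01.
  by move/derivable1_diffP/differentiable_continuous : d1.
- move=> x; rewrite in_itv/= andbT => x1; have x0 : (0 < x)%R by exact: lt_trans x1.
  by rewrite derive1E; have [_ ->] := dF x x0.
Unshelve. all: end_near. Qed.

(** Euler's integral as an extended real, so that identities can be stated before convergence is
    known. *)
Definition gammaE (x : R) := mint (fun t => (t `^ x * expR (- t))%R%:E).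

Lemma measurable_powRE (x : R) : measurable_fun setT (fun t : R => t `^ x)%R.
Proof. exact: measurable_powR. Qed.

Lemma measurable_expRN c : measurable_fun setT (fun t : R => expR (- (c * t)))%R.
Proof.
apply: measurableT_comp => //; apply: measurable_funN.
by apply: measurable_funM => //; exact: measurable_cst.
Qed.

Lemma measurable_gamma_integrand (x : R) c :
  measurable_fun setT (fun t => (t `^ x * expR (- (c * t)))%R%:E : \bar R).
Proof.
apply/measurable_EFinP; apply: measurable_funM; first exact: measurable_powRE.
exact: measurable_expRN.
Qed.

Lemma measurable_gamma_integrand1 (x : R) :
  measurable_fun setT (fun t => (t `^ x * expR (- t))%R%:E : \bar R).
Proof.
rewrite (_ : (fun t => _) = (fun t => (t `^ x * expR (- (1 * t)))%R%:E)).
  exact: measurable_gamma_integrand.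
by apply/funext => t; rewrite mul1r.
Qed.

Lemma mint_gamma_scale (x : R) c : (0 < c)%R ->
  mint (fun t => (t `^ x * expR (- (c * t)))%R%:E) = (c `^ (- x))%R%:E * gammaE x.
Proof.
move=> c0.
have m1 := measurable_gamma_integrand1 x.
have g0 t : 0 <= (t `^ x * expR (- t))%R%:E by rewrite lee_fin mulr_ge0 ?powR_ge0 ?expR_ge0.
rewrite /gammaE -(mint_scale c0 m1 g0) -mintZl; last 3 first.
- apply: (measurableT_comp m1); apply: measurable_funM => //; exact: measurable_cst.
- by move=> r; exact: g0.
- by rewrite lee_fin powR_ge0.
apply: eq_mint => t t0; rewrite -EFinM; congr (_%:E).
rewrite powRM ?ltW// !mulrA powRN mulVf ?mul1r//.
by rewrite gt_eqF ?powR_gt0.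
Qed.

Lemma gammaE_gt0 (x : R) : (0 < x)%R -> 0 < gammaE x.
Proof.
move=> x0.
have m1 := measurable_gamma_integrand1 x.
have /andP[k0 _] : 0 < mint (K12 1%R 2%R : R -> \bar R) < +oo by apply: mint_indic; lra.
apply: (@lt_le_trans _ _ ((expR (- 2))%:E * mint (K12 1%R 2%R))).
  by rewrite mule_gt0// lte_fin.
rewrite -mintZl; last 3 first.
- exact: mK12.
- by move=> r; exact: K120.
- by rewrite lee_fin ltW.
apply: le_mint => //.
- by apply: emeasurable_funM => //; exact: measurable_cst.
- by move=> t; rewrite lee_fin mulr_ge0 ?powR_ge0 ?expR_ge0.
- move=> t t0; rewrite -EFinM lee_fin indicE mem_setE in_itv/=.
  have [/andP[t1 t2]|_] := boolP ((1 < t) && (t <= 2))%R; last first.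
    by rewrite mulr0 mulr_ge0 ?powR_ge0 ?expR_ge0.
  rewrite mulr1 -[leLHS]mul1r ler_pM ?expR_ge0//.
    by rewrite -(powRr0 t) ler_powR ?ltW.
  by rewrite ler_expR lerN2.
Qed.

(** Below 1 the integrand is at most [t ^ x]; from 1 on it is at most [C / t], because exp t >=
    t^(N+1) / (N+1)! and x <= N. *)
Lemma gammaE_lty (x : R) : (0 < x)%R -> gammaE x < +oo.
Proof.
move=> x0.
have m1 := measurable_gamma_integrand1 x.
pose T s := fun t => ((\1_(`[1%R, +oo[%classic) t : R) * t `^ (- s))%R%:E : \bar R.
have mT s : measurable_fun setT (T s).
  apply/measurable_EFinP; apply: measurable_funM; last exact: measurable_powRE.
  exact: measurable_indic.
have T0 s t : 0 <= T s t by rewrite lee_fin mulr_ge0 ?powR_ge0.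
have mTi s : measurable_fun setT (fun t : R => T s t^-1%R) by exact: measurable_comp_inv.
pose N := Num.bound x; pose C : R := (N.+1)`!%:R.
have C0 : (0 <= C)%R by rewrite ler0n.
have mCT : measurable_fun setT (fun t : R => C%:E * T 1%R t).
  by apply: emeasurable_funM => //; exact: measurable_cst.
apply: (@le_lt_trans _ _ (mint (fun t => T x t^-1%R + C%:E * T 1%R t))); last first.
  rewrite (_ : mint _ = mint (fun t => T x t^-1%R) + mint (fun t => C%:E * T 1%R t)).
    rewrite mint_inv// mintZl// /T !mint_tail// -EFinM -EFinD ltry//.
  rewrite /mint -ge0_integralD//.
  - by apply: eq_integral => r _; rewrite ge0_muleDr// mule_ge0.
  - by move=> r _; rewrite mule_ge0 ?T0// lee_fin hinv_ge0.
  - exact: measurable_mint_integrand.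
  - by move=> r _; rewrite !mule_ge0 ?T0// lee_fin hinv_ge0.
  - exact: measurable_mint_integrand.
apply: le_mint => //.
- exact: emeasurable_funD.
- by move=> t; rewrite lee_fin mulr_ge0 ?powR_ge0 ?expR_ge0.
- by move=> t; rewrite adde_ge0 ?mule_ge0.
move=> t t0; have [t1|t1] := lerP 1 t; last first.
  apply: (@le_trans _ _ (T x t^-1%R)); last by rewrite leeDl// mule_ge0.
  rewrite lee_fin indicE mem_set/=; last by rewrite in_itv/= andbT invf_ge1// ltW.
  have -> : (t^-1 `^ (- x) = t `^ x)%R.
    by rewrite -powR_inv1 ?ltW// -powRrM mulN1r opprK.
  by rewrite mul1r ler_piMr ?powR_ge0// -expR0 ler_expR oppr_le0 ltW.
apply: (@le_trans _ _ (C%:E * T 1%R t)); last by rewrite leeDr.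
rewrite -EFinM lee_fin indicE mem_set/=; last by rewrite in_itv/= t1.
rewrite mul1r powRN (powRr1 (ltW t0)) expRN.
rewrite ler_pdivrMr ?expR_gt0// mulrAC ler_pdivlMr//.
have xN : (x <= N%:R)%R by rewrite ltW// archi_boundP// ltW.
have tx : (t `^ x * t <= t ^+ N.+1)%R.
  by rewrite exprSr ler_wpM2r ?(ltW t0)// -powR_mulrn ?(ltW t0)// ler_powR.
apply: (le_trans tx); have := expR_ge1Dxn N (ltW t0).
have Cp : (0 < C)%R by rewrite ltr0n fact_gt0.
move=> h; rewrite mulrC -ler_pdivrMr// (le_trans _ h)// lerDr//.
Qed.

Lemma GammaE (x : R) : (0 < x)%R -> (Gamma x)%:E = gammaE x.
Proof.
move=> x0; rewrite /Gamma /Rintegral (_ : \int[leb]_(t in _) _ = gammaE x).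
  by rewrite fineK// ge0_fin_numE ?gammaE_lty// ltW// gammaE_gt0.
rewrite integral_mkcond; apply: eq_integral => t _; rewrite patchE /hinv.
case: (boolP (t \in _)) => [|]; rewrite mem_setE in_itv/= andbT.
  move=> t0; rewrite t0 -EFinM; congr (_%:E).
  by rewrite powR_sub1// -mulrA mulrCA.
by move=> /negbTE ->; rewrite mul0e.
Qed.

Lemma Gamma_gt0 (x : R) : (0 < x)%R -> (0 < Gamma x)%R.
Proof. by move=> x0; rewrite -lte_fin GammaE// gammaE_gt0. Qed.

End mellin_integrals.

(** * Polar integration and the function I *)

Section polar_coordinates.
Local Open Scope ereal_scope.
Context {R : realType}.
Local Notation leb := (@lebesgue_measure R).
Local Notation "'λ' d" := (@lebesgue_rV R d) (at level 10).
Implicit Types (F K Psi : R -> \bar R) (c r s a : R).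

Lemma measurable_comp_enorm d Psi : measurable_fun setT Psi ->
  measurable_fun setT (fun x : 'rV[R]_d => Psi (enorm x)).
Proof. by move=> mP; apply: (measurableT_comp mP); apply: measurable_enorm. Qed.

Lemma measurable_powMl b Psi : measurable_fun setT Psi ->
  measurable_fun setT (fun r => (r `^ b)%:E * Psi r).
Proof.
move=> mP; apply: emeasurable_funM => //; apply/measurable_EFinP; exact: measurable_powR.
Qed.

Lemma powMl_ge0 b Psi r : (forall r, 0 <= Psi r) -> 0 <= (r `^ b)%:E * Psi r.
Proof. by move=> P0; rewrite mule_ge0// lee_fin powR_ge0. Qed.

Lemma gt0_enorm d (x : 'rV[R]_d) : x != 0%R -> (0 < enorm x)%R.
Proof.
by move=> x0; rewrite lt0r enorm_ge0 andbT; apply: contra x0 => /eqP/enorm_eq0/eqP.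
Qed.

Lemma sphere_areaE d : (0 < d)%N ->
  @sphere_area R d.-1 = (2 * Num.sqrt pi ^+ d / Gamma (d%:R / 2))%R.
Proof.
move=> d0; rewrite /sphere_area prednK//; congr (_ * _ / _)%R.
by rewrite mulrC powRrM powR12_sqrt ?pi_ge0// powR_mulrn// sqrtr_ge0.
Qed.

Lemma sphere_area_gt0 d : (0 < @sphere_area R d)%R.
Proof.
rewrite /sphere_area mulr_gt0 ?invr_gt0 ?Gamma_gt0 ?divr_gt0//.
by rewrite mulr_gt0// powR_gt0 ?pi_gt0.
Qed.

(** The weight [enorm x ^- d] makes the integral over R^d invariant under dilation of the radius, so
    it is a multiple of [mint]. Testing on the Gaussian gives pi^(d/2) on one side and Gamma(d/2)/2
    on the other; their quotient is the area of the sphere. *)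
Lemma integral_polar d Psi : (0 < d)%N -> measurable_fun setT Psi -> (forall r, 0 <= Psi r) ->
  \int[λ d]_x Psi (enorm x) =
  (sphere_area d.-1)%:E * mint (fun r => (r `^ d%:R)%:E * Psi r).
Proof.
move=> d0 mP P0.
pose W (x : 'rV[R]_d) : R := (enorm x ^- d)%R.
have me : measurable_fun setT (@enorm R d) by apply: measurable_enorm.
have mW : measurable_fun setT W.
  by apply: measurable_fun_inv; exact: measurable_funX.
have W0 x : (0 <= W x)%R by rewrite invr_ge0 exprn_ge0// enorm_ge0.
have WN x : (W x != 0 -> 0 < enorm x)%R.
  move=> Wx; rewrite lt0r enorm_ge0 andbT; apply: contra Wx => /eqP ex.
  by rewrite /W ex expr0n gtn_eqF// invr0.
have inv F c : measurable_fun setT F -> (forall r, 0 <= F r) -> (0 < c)%R ->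
    \int[λ d]_x ((W x)%:E * F (c * enorm x)%R) = \int[λ d]_x ((W x)%:E * F (enorm x)).
  move=> mF F0 c0.
  have mFW : measurable_fun setT (fun x : 'rV[R]_d => (W x)%:E * F (enorm x)).
    by apply: emeasurable_funM; [exact/measurable_EFinP|exact: measurable_comp_enorm].
  have FW0 x : 0 <= (W x)%:E * F (enorm x) by rewrite mule_ge0// lee_fin.
  have cd : (0 < c ^+ d)%R by rewrite exprn_gt0.
  transitivity ((c ^+ d)%:E * ((c ^- d)%:E * \int[λ d]_x ((W x)%:E * F (enorm x)))); last first.
    by rewrite muleA -EFinM mulfV ?gt_eqF// mul1e.
  rewrite -(ge0_integral_rV_scale c0 mFW FW0) -ge0_integralTZl.
  - apply: eq_integral => x _; rewrite muleA -EFinM /W enormZ gtr0_norm//.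
    by rewrite exprMn invfM mulrA mulfV ?gt_eqF// mul1r.
  - apply: (measurableT_comp mFW); apply: measurable_scalemx => //; exact: measurable_cst.
  - by move=> x; exact: FW0.
  - by rewrite lee_fin ltW.
pose F r := (r `^ d%:R)%:E * Psi r.
pose K r := (r `^ d%:R * expR (- r ^+ 2))%R%:E : \bar R.
have mF : measurable_fun setT F by exact: measurable_powMl.
have mK : measurable_fun setT K.
  apply/measurable_EFinP; apply: measurable_funM; first exact: measurable_powR.
  by apply: measurableT_comp => //; apply: measurable_funN; exact: measurable_funX.
have F0 r : 0 <= F r by exact: powMl_ge0.
have K0 r : 0 <= K r by rewrite lee_fin mulr_ge0 ?powR_ge0 ?expR_ge0.
have WE x : x != 0%R -> (W x * enorm x `^ d%:R = 1)%R.
  move=> x0; have e0 := gt0_enorm x0.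
  by rewrite powR_mulrn ?enorm_ge0// mulVf// expf_neq0// gt_eqF.
have H := @scale_invariant_unique R _ _ (λ d) (@enorm R d) W me mW W0 WN inv F K mF mK F0 K0.
have EF : \int[λ d]_x ((W x)%:E * F (enorm x)) = \int[λ d]_x Psi (enorm x).
  apply: ge0_eq_integral_set0.
  - exact: lebesgue_rV_set0.
  - by apply: emeasurable_funM; [exact/measurable_EFinP|exact: measurable_comp_enorm].
  - exact: measurable_comp_enorm.
  - by move=> x; rewrite mule_ge0// lee_fin.
  - by move=> x; exact: P0.
  - by move=> x x0; rewrite /F muleA -EFinM WE// mul1e.
have EK : \int[λ d]_x ((W x)%:E * K (enorm x)) = (Num.sqrt pi ^+ d)%:E.
  rewrite -integral_gauss_rV; apply: ge0_eq_integral_set0.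
  - exact: lebesgue_rV_set0.
  - by apply: emeasurable_funM; [exact/measurable_EFinP|exact: measurable_comp_enorm].
  - by apply/measurable_EFinP; exact: measurable_gauss_rV.
  - by move=> x; rewrite mule_ge0// lee_fin.
  - by move=> x; rewrite lee_fin expR_ge0.
  - by move=> x x0; rewrite /K -EFinM mulrA WE// mul1r enorm_sqr.
have d2 : (0 < d%:R / 2 :> R)%R by rewrite divr_gt0// ltr0n.
have mKK : mint K = (2^-1 * Gamma (d%:R / 2))%:E.
  rewrite EFinM GammaE// /gammaE -mint_sqr.
  - apply: eq_mint => r r0; congr (_%:E); congr (_ * _)%R.
    rewrite -powR_mulrn ?ltW// -powRrM; congr (_ `^ _)%R.
    by rewrite mulrC divfK.
  - exact: measurable_gamma_integrand1.
  - by move=> r; rewrite lee_fin mulr_ge0 ?powR_ge0 ?expR_ge0.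
rewrite EF EK mKK in H.
have G0 := Gamma_gt0 d2.
apply: (@mule_cancelr _ (2^-1 * Gamma (d%:R / 2))%:E).
  by rewrite ltry lte_fin mulr_gt0.
rewrite H sphere_areaE// muleAC -EFinM; congr (_%:E * _).
by field; rewrite gt_eqF.
Qed.

(** Adding to a vector of length [r] an orthogonal one of length [r * enorm w] gives length
    [r * bracket w]. *)
Definition bracket d (w : 'rV[R]_d) : R := Num.sqrt (1 + dot w w).

Lemma bracket_gt0 d (w : 'rV[R]_d) : (0 < bracket w)%R.
Proof. by rewrite sqrtr_gt0 ltr_pwDl// dot_ge0. Qed.

Lemma measurable_bracket d : measurable_fun setT (@bracket d).
Proof.
apply: measurable_sqrtr; apply: measurable_funD; first exact: measurable_cst.
by apply: measurable_dot.
Qed.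

(** The function I of the overview, with values in the extended reals. *)
Definition bracket_integral d a : \bar R := \int[λ d]_w (bracket w `^ (- a))%:E.

Lemma integral_gauss_scale d t : (0 < t)%R ->
  \int[λ d]_w (expR (- (t * dot w w)))%:E = (t `^ (- (d%:R / 2)) * Num.sqrt pi ^+ d)%:E.
Proof.
move=> t0; have st : (0 < Num.sqrt t)%R by rewrite sqrtr_gt0.
have mg : measurable_fun setT (fun x : 'rV[R]_d => (expR (- dot x x))%:E : \bar R).
  by apply/measurable_EFinP; exact: measurable_gauss_rV.
rewrite EFinM -integral_gauss_rV.
have -> : (t `^ (- (d%:R / 2)) = Num.sqrt t ^- d)%R.
  by rewrite powRN mulrC powRrM powR12_sqrt ?ltW// powR_mulrn// ltW.
rewrite -(ge0_integral_rV_scale st mg); last by move=> x; rewrite lee_fin expR_ge0.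
by apply: eq_integral => w _; rewrite dotZ -expr2 sqr_sqrtr// ltW.
Qed.

(* [Gamma (a / 2) * bracket w `^ (- a)] is a Mellin transform of Gaussians in [w]. *)
Lemma bracket_integral_gamma d a :
  gammaE (a / 2) * bracket_integral d a =
  (Num.sqrt pi ^+ d)%:E * gammaE ((a - d%:R) / 2).
Proof.
have mb := @measurable_bracket d.
rewrite /bracket_integral muleC -ge0_integralTZr; last 3 first.
- apply/measurable_EFinP; apply: (measurableT_comp (@measurable_powR _ _)); exact: mb.
- by move=> w; rewrite lee_fin powR_ge0.
- by apply: mint_ge0 => r; rewrite lee_fin mulr_ge0 ?powR_ge0 ?expR_ge0.
have mf : measurable_fun setT (fun z : 'rV[R]_d * R =>
    ((hinv z.2)%:E * (z.2 `^ (a / 2) * expR (- ((bracket z.1) ^+ 2 * z.2)))%R%:E) : \bar R).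
  apply: emeasurable_funM; first exact: (measurableT_comp (@measurable_hinvE R) measurable_snd).
  apply/measurable_EFinP; apply: measurable_funM.
    exact: (measurableT_comp (@measurable_powR _ _) measurable_snd).
  apply: measurableT_comp => //; apply: measurable_funN; apply: measurable_funM => //.
  by apply: measurable_funX; exact: (measurableT_comp mb measurable_fst).
transitivity (\int[λ d]_w \int[leb]_t
    ((hinv t)%:E * (t `^ (a / 2) * expR (- ((bracket w) ^+ 2 * t)))%R%:E)).
  apply: eq_integral => w _; have b0 := bracket_gt0 w.
  rewrite -/(mint (fun t => (t `^ (a / 2) * expR (- ((bracket w) ^+ 2 * t)))%R%:E)).
  rewrite mint_gamma_scale ?exprn_gt0//; congr ((_)%:E * _).
  by rewrite -powR_mulrn ?ltW// -powRrM mulrN mulrC divfK.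
rewrite tonelli//; last first.
  by move=> w t; rewrite -EFinM lee_fin !mulr_ge0 ?hinv_ge0 ?powR_ge0 ?expR_ge0.
rewrite -mintZl; last 3 first.
- exact: measurable_gamma_integrand1.
- by move=> r; rewrite lee_fin mulr_ge0 ?powR_ge0 ?expR_ge0.
- by rewrite lee_fin exprn_ge0// sqrtr_ge0.
apply: eq_integral => t _; rewrite /hinv; case: ifPn => [t0|_]; last first.
  by rewrite mul0e; apply: integral0_eq => w _; rewrite mul0e.
transitivity (\int[λ d]_w ((t^-1 * (t `^ (a / 2) * expR (- t)))%R%:E * (expR (- (t * dot w w)))%:E)).
  apply: eq_integral => w _; rewrite -!EFinM; congr (_%:E).
  rewrite /bracket sqr_sqrtr ?addr_ge0 ?dot_ge0// mulrDl mul1r opprD expRD.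
  by rewrite !mulrA (mulrC t (dot _ _)).
rewrite ge0_integralTZl; last 3 first.
- apply/measurable_EFinP; apply: measurableT_comp => //; apply: measurable_funN.
  by apply: measurable_funM; [exact: measurable_cst|apply: measurable_dot].
- by move=> w; rewrite lee_fin expR_ge0.
- by rewrite lee_fin !mulr_ge0 ?invr_ge0 ?(ltW t0) ?powR_ge0 ?expR_ge0.
rewrite integral_gauss_scale// -!EFinM; congr (_%:E).
rewrite mulrBl powRD; last by rewrite (gt_eqF t0) implybT.
by ring.
Qed.

Lemma bracket_integralE d a : (d%:R < a)%R ->
  bracket_integral d a =
  (pi `^ (d%:R / 2) * (Gamma ((a - d%:R) / 2) / Gamma (a / 2)))%:E.
Proof.
move=> da; have a0 : (0 < a / 2)%R by rewrite divr_gt0// (le_lt_trans _ da).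
have ad0 : (0 < (a - d%:R) / 2)%R by rewrite divr_gt0// subr_gt0.
apply: (@mule_cancelr _ (gammaE (a / 2))); first by rewrite gammaE_gt0// gammaE_lty.
rewrite muleC bracket_integral_gamma -(GammaE ad0) -(GammaE a0) -!EFinM; congr (_%:E).
have -> : (pi `^ (d%:R / 2) = Num.sqrt pi ^+ d :> R)%R.
  by rewrite mulrC powRrM powR12_sqrt ?pi_ge0// powR_mulrn// sqrtr_ge0.
have G0 := lt0r_neq0 (Gamma_gt0 a0); by field.
Qed.

(** Identity (A) for radial integrands. After polar integration in [t], with [r] its radius, the
    substitution [z = r *: w] turns the argument of [Psi] into [r * bracket w]; dilation invariance
    of [dr / r] frees [Psi] from [bracket w] and leaves the power of [bracket w] that
    [bracket_integral] integrates. *)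
Lemma integral_double_radial m d (l : R) Psi : (0 < m)%N ->
  measurable_fun setT Psi -> (forall r, 0 <= Psi r) ->
  \int[λ m]_t \int[λ d]_z ((enorm t `^ l)%:E * Psi (Num.sqrt (dot z z + dot t t))) =
  (sphere_area m.-1)%:E * bracket_integral d (m%:R + d%:R + l) *
  mint (fun r => (r `^ (m%:R + d%:R + l))%:E * Psi r).
Proof.
move=> m0 mP P0.
pose X r := \int[λ d]_z ((r `^ l)%:E * Psi (Num.sqrt (dot z z + r ^+ 2))).
have mPz d' (T : measurableType d') (f : T -> 'rV[R]_d) (g : T -> R) :
    measurable_fun setT f -> measurable_fun setT g ->
    measurable_fun setT (fun x => Psi (Num.sqrt (dot (f x) (f x) + g x ^+ 2))).
  move=> mf mg; apply: (measurableT_comp mP); apply: measurable_sqrtr.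
  by apply: measurable_funD; [exact: measurable_dot|exact: measurable_funX].
have mX : measurable_fun setT X.
  apply: measurable_integral_ge0 => [|r z]; last by rewrite mule_ge0// lee_fin powR_ge0.
  apply: emeasurable_funM; last exact: mPz.
  by apply/measurable_EFinP; exact: (measurableT_comp (@measurable_powR _ _) measurable_fst).
have X0 r : 0 <= X r.
  by apply: integral_ge0 => z _; rewrite mule_ge0// lee_fin powR_ge0.
transitivity (\int[λ m]_t X (enorm t)).
  by apply: eq_integral => t _; apply: eq_integral => z _; rewrite enorm_sqr.
rewrite integral_polar// -muleA; congr (_ * _).
set N := (m%:R + d%:R + l)%R.
have mb := @measurable_bracket d.
have mPb r : measurable_fun setT (fun w : 'rV[R]_d => Psi (r * bracket w)%R).
  by apply: (measurableT_comp mP); apply: measurable_funM => //; exact: measurable_cst.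
transitivity (mint (fun r => \int[λ d]_w ((r `^ N)%:E * Psi (r * bracket w)%R))).
  apply: eq_mint => r r0.
  rewrite ge0_integralTZl; [|exact: mPb|by move=> w; exact: P0|by rewrite lee_fin powR_ge0].
  have mPr : measurable_fun setT (fun z : 'rV[R]_d => Psi (Num.sqrt (dot z z + r ^+ 2))).
    by apply: mPz => //; exact: measurable_cst.
  rewrite /X ge0_integralTZl; [|exact: mPr|by move=> w; exact: P0|by rewrite lee_fin powR_ge0].
  have rd : (0 < r ^+ d)%R by rewrite exprn_gt0.
  have -> : \int[λ d]_z Psi (Num.sqrt (dot z z + r ^+ 2)) =
      (r ^+ d)%:E * \int[λ d]_w Psi (r * bracket w)%R.
    rewrite -[LHS]mul1e -[1]/(1%R%:E) -(mulfV (lt0r_neq0 rd)) EFinM -muleA; congr (_ * _).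
    rewrite -(ge0_integral_rV_scale r0 mPr); last by move=> w; exact: P0.
    apply: eq_integral => w _; congr Psi; rewrite dotZ -expr2 /bracket.
    have -> : (r ^+ 2 * dot w w + r ^+ 2 = r ^+ 2 * (1 + dot w w))%R by ring.
    by rewrite sqrtrM ?sqr_ge0// sqrtr_sqr gtr0_norm.
  rewrite !muleA -!EFinM; congr (_%:E * _).
  rewrite /N powRD; last by rewrite (gt_eqF r0) implybT.
  rewrite powRD; last by rewrite (gt_eqF r0) implybT.
  by rewrite (powR_mulrn d (ltW r0)); ring.
have mf : measurable_fun setT (fun z : R * 'rV[R]_d =>
    ((hinv z.1)%:E * ((z.1 `^ N)%:E * Psi (z.1 * bracket z.2)%R))).
  apply: emeasurable_funM; first exact: (measurableT_comp (@measurable_hinvE R) measurable_fst).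
  apply: emeasurable_funM.
    by apply/measurable_EFinP; exact: (measurableT_comp (@measurable_powR _ _) measurable_fst).
  apply: (measurableT_comp mP); apply: measurable_funM => //.
  exact: (measurableT_comp mb measurable_snd).
transitivity (\int[leb]_r \int[λ d]_w ((hinv r)%:E * ((r `^ N)%:E * Psi (r * bracket w)%R))).
  apply: eq_integral => r _; rewrite [RHS]ge0_integralTZl; first by [].
  - by apply: emeasurable_funM; [exact: measurable_cst|exact: mPb].
  - by move=> w; rewrite mule_ge0// lee_fin powR_ge0.
  - by rewrite lee_fin hinv_ge0.
rewrite tonelli//; last first.
  by move=> r w; rewrite !mule_ge0// lee_fin ?hinv_ge0 ?powR_ge0.
rewrite /bracket_integral -ge0_integralTZr; last 3 first.
- apply/measurable_EFinP; apply: (measurableT_comp (@measurable_powR _ _)); exact: mb.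
- by move=> w; rewrite lee_fin powR_ge0.
- by apply: mint_ge0 => r; exact: powMl_ge0.
have mPN := measurable_powMl N mP.
have P0N r := powMl_ge0 N r P0.
apply: eq_integral => w _; have b0 := bracket_gt0 w.
rewrite -(mint_scale b0 mPN P0N) -mintZl; last 3 first.
- apply: (measurableT_comp mPN); apply: measurable_funM => //; exact: measurable_cst.
- by move=> r; exact: P0N.
- by rewrite lee_fin powR_ge0.
apply: eq_mint => r r0; rewrite muleA -EFinM powRM ?ltW// mulrA powRN mulVf ?mul1r.
  by rewrite mulrC.
by rewrite gt_eqF// powR_gt0.
Qed.

End polar_coordinates.

(** * The two basic identities for the plane transform *)

Section radon_identities.
Local Open Scope ereal_scope.
Context {R : realType} {n : nat}.
Implicit Types (V E : {vspace 'rV[R]_n}) (u v : 'rV[R]_n) (g h : 'M[R]_n).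
Local Notation "'λ' d" := (@lebesgue_rV R d) (at level 10).
Local Notation plane := ({vspace 'rV[R]_n} * 'rV[R]_n)%type.
Local Notation G := (to_orthgrp (fullv : {vspace 'rV[R]_n})).

Variables (j k : nat) (E1 E2 : {vspace 'rV[R]_n}) (Z : 'M[R]_(k - j, n)).
Hypotheses (E12 : (E1 <= E2)%VS) (dE1 : \dim E1 = j) (dE2 : \dim E2 = k).
Hypotheses (ZZ : (Z *m Z^T = 1%:M)%R) (ZP : (Z^T *m Z = orthproj (orthv E1 :&: E2)%VS)%R).
Hypotheses (hjk : (j < k)%N) (hkn : (k < n)%N).
Variable e : 'rV[R]_n.
Hypotheses (eE2 : e \in orthv E2) (e1 : dot e e = 1%R).

Let C2 := frame (n - k) (orthv E2).
Let C1 := frame (n - j) (orthv E1).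
Let dO2 : \dim (orthv E2) = (n - k)%N. Proof. by rewrite dim_orthv dE2. Qed.
Let dO1 : \dim (orthv E1) = (n - j)%N. Proof. by rewrite dim_orthv dE1. Qed.
Let CC2 := frame_orth dO2.
Let CC1 := frame_orth dO1.

Lemma mulmx_frame_mem d V (t : 'rV[R]_d) : \dim V = d -> (t *m frame d V \in V)%R.
Proof.
move=> dV; apply/orthprojP.
by rewrite -(frame_orthproj dV) -!mulmxA (mulmxA (frame d V)) (frame_orth dV) mul1mx.
Qed.

(** Sends frames of [E2] and of its complement to frames of [V] and of its complement, measurably in
    [V]. The test guards subspaces of other dimensions, so that the result is always orthogonal. *)
Definition to_plane_rotation V : 'M[R]_n :=
  let g := ((frame k E2)^T *m frame k V + C2^T *m frame (n - k) (orthv V))%R in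
  if (g *m g^T)%R == 1%:M%R then g else 1%:M%R.

Lemma to_plane_rotation_orth V :
  (to_plane_rotation V *m (to_plane_rotation V)^T = 1%:M)%R.
Proof. by rewrite /to_plane_rotation; case: eqP => // _; rewrite trmx1 mulmx1. Qed.

Lemma measurable_to_plane_rotation : measurable_fun setT to_plane_rotation.
Proof.
have mg : measurable_fun setT (fun V : {vspace 'rV[R]_n} =>
    (frame k E2)^T *m frame k V + C2^T *m frame (n - k) (orthv V))%R.
  apply: measurable_addmx; apply: measurable_mulmx; try exact: measurable_cst.
    exact: measurable_frame.
  exact: (measurableT_comp (@measurable_frame R n (n - k)) (@measurable_orthv R n)).
apply: measurable_fun_ifT => //.
  apply: measurable_fun_eqmx; last exact: measurable_cst.
  by apply: measurable_mulmx => //; exact: measurable_trmx.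
Qed.

Lemma rotate_to_plane_rotation V : \dim V = k -> rotate (to_plane_rotation V) E2 = V.
Proof.
move=> dV; rewrite /to_plane_rotation.
have dOV : \dim (orthv V) = (n - k)%N by rewrite dim_orthv dV.
set B := frame k E2; set B' := frame k V; set C' := frame (n - k) (orthv V).
have BB : (B *m B^T = 1%:M)%R by exact: frame_orth.
have BB' : (B' *m B'^T = 1%:M)%R by exact: frame_orth.
have CC' : (C' *m C'^T = 1%:M)%R by exact: frame_orth.
have BP : (B^T *m B = orthproj E2)%R by exact: frame_orthproj.
have BP' : (B'^T *m B' = orthproj V)%R by exact: frame_orthproj.
have CP : (C2^T *m C2 = orthproj (orthv E2))%R by exact: frame_orthproj.
have CP' : (C'^T *m C' = orthproj (orthv V))%R by exact: frame_orthproj.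
have crossP (d1 d2 : nat) U (A : 'M[R]_(d1, n)) (D : 'M[R]_(d2, n)) :
    (A *m A^T = 1%:M -> D *m D^T = 1%:M -> A^T *m A = orthproj U ->
     D^T *m D = orthproj (orthv U) -> A *m D^T = 0)%R.
  move=> AA DD AP DP.
  have AE : A = (A *m orthproj U)%R by rewrite -AP mulmxA AA mul1mx.
  have DE : D = (D *m orthproj (orthv U))%R by rewrite -DP mulmxA DD mul1mx.
  rewrite AE DE trmx_mul orthproj_trmx mulmxA -(mulmxA A) orthproj_orthv.
  by rewrite mulmxBr mulmx1 orthproj_idem subrr mulmx0 mul0mx.
have BC : (B *m C2^T = 0)%R by exact: (crossP _ _ _ _ _ BB CC2 BP CP).
have BC' : (B' *m C'^T = 0)%R by exact: (crossP _ _ _ _ _ BB' CC' BP' CP').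
have CB' : (C' *m B'^T = 0)%R by apply: trmx_inj; rewrite trmx_mul trmxK BC' trmx0.
set g := (_ + _)%R.
have gg : (g *m g^T = 1%:M)%R.
  rewrite /g linearD/= !trmx_mul !trmxK mulmxDl !mulmxDr -!mulmxA.
  rewrite !(mulmxA B') !(mulmxA C') BB' CC' BC' CB' !mul0mx !mulmx0 !mul1mx.
  by rewrite addr0 add0r BP CP orthproj_orthv addrC subrK.
rewrite gg eqxx; apply: orthproj_inj; rewrite orthproj_rotate// -BP mulmxA -trmx_mul -mulmxA.
have -> : (B *m g = B')%R by rewrite /g mulmxDr !mulmxA BB BC mul1mx mul0mx addr0.
by [].
Qed.

Lemma radon_integral_flag (f : plane -> R) tau : measurable_fun setT f -> planes k tau ->
  radon_integral j k f tau = radon_flag E1 E2 Z f (to_plane_rotation tau.1) tau.2.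
Proof.
move=> mf [dtau _]; rewrite -(radon_integralE E12 dE1 dE2 ZZ ZP)//; last first.
  exact: to_plane_rotation_orth.
by rewrite rotate_to_plane_rotation//; case: tau dtau.
Qed.

(** A version of the transform that is measurable on all pairs; for measurable [f] it agrees with
    [radon_integral] on [planes k]. *)
Definition radon_ext (f : plane -> R) (tau : plane) : \bar R :=
  radon_flag E1 E2 Z f (to_plane_rotation tau.1) tau.2.

Lemma measurable_radon_ext (f : plane -> R) : measurable_fun setT f -> measurable_fun setT (radon_ext f).
Proof.
move=> mf; apply: measurable_radon_flag => //.
- by move=> x; exact: to_plane_rotation_orth.
- exact: (measurableT_comp measurable_to_plane_rotation measurable_fst).
Qed.

Lemma radon_flag_ge0 (f : plane -> R) g u : (forall x, (0 <= f x)%R) -> 0 <= radon_flag E1 E2 Z f g u.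
Proof.
by move=> f0; apply: integral_ge0 => h _; apply: integral_ge0 => z _; rewrite lee_fin.
Qed.

(** The mean of [f] over the [j]-planes at distance [r] from the origin (for [r >= 0]). Both sides
    of (A) depend on [f] only through it. *)
Definition spherical_mean (f : plane -> R) (r : R) : \bar R :=
  \int[haar fullv]_g (f (rotate (G g) E1, (r *: e) *m G g)%R)%:E.

Lemma measurable_mean_integrand (f : plane -> R) d (T : measurableType d) (v : T -> 'rV[R]_n) (a : T -> 'M[R]_n) :
  measurable_fun setT f -> measurable_fun setT v -> measurable_fun setT a ->
  measurable_fun setT (fun x => (f (rotate (G (a x)) E1, v x *m G (a x))%R)%:E : \bar R).
Proof.
move=> mf mv ma; apply/measurable_EFinP; apply: measurableT_comp => //.
have mG : measurable_fun setT (fun x => G (a x)) by exact: measurable_to_orthgrp.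
apply: measurable_pair_rotate => //; first by move=> x; exact: to_orthgrp_orth.
exact: measurable_mulmx.
Qed.

Lemma measurable_spherical_mean (f : plane -> R) : measurable_fun setT f -> (forall x, (0 <= f x)%R) ->
  measurable_fun setT (spherical_mean f).
Proof.
move=> mf f0; apply: measurable_integral_ge0 => [|r g]; last by rewrite lee_fin.
apply: measurable_mean_integrand => //.
by apply: measurable_scalemx => //; exact: measurable_cst.
Qed.

Lemma spherical_mean_ge0 (f : plane -> R) r : (forall x, (0 <= f x)%R) -> 0 <= spherical_mean f r.
Proof. by move=> f0; apply: integral_ge0 => g _; rewrite lee_fin. Qed.

Lemma eE1 : e \in orthv E1.
Proof.
apply/memv_orthP => v vE; move/memv_orthP: eE2; apply; exact: (subvP E12).
Qed.

Lemma spherical_meanE (f : plane -> R) v : measurable_fun setT f -> (forall x, (0 <= f x)%R) ->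
  v \in orthv E1 ->
  \int[haar fullv]_g (f (rotate (G g) E1, v *m G g)%R)%:E = spherical_mean f (enorm v).
Proof.
move=> mf f0 vE; apply: (haar_radial (phi := fun x => (f x)%:E)) => //.
- exact/measurable_EFinP.
- exact: eE1.
Qed.

Lemma integral_plane_mean (f : plane -> R) (l : R) : measurable_fun setT f -> (forall x, (0 <= f x)%R) ->
  \int[plane_measure j]_x ((enorm x.2 `^ l)%:E * (f x)%:E) =
  (sphere_area (n - j).-1)%:E *
    mint (fun r => (r `^ ((n - j)%:R + l))%:E * spherical_mean f r).
Proof.
move=> mf f0.
have mphi : measurable_fun setT (fun x : plane => (enorm x.2 `^ l)%:E * (f x)%:E).
  apply: emeasurable_funM; last exact/measurable_EFinP.
  apply/measurable_EFinP; apply: (measurableT_comp (@measurable_powR _ _)).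
  by apply: measurable_enorm.
have phi0 (x : plane) : 0 <= (enorm x.2 `^ l)%:E * (f x)%:E.
  by rewrite mule_ge0// lee_fin ?powR_ge0.
have mS := measurable_spherical_mean mf f0.
have S0 r := spherical_mean_ge0 r f0.
rewrite (ge0_integral_plane dE1 CC1 (frame_orthproj dO1) mphi phi0).
transitivity (\int[haar fullv]_g \int[λ (n - j)]_t
    ((enorm t `^ l)%:E * (f (rotate (G g) E1, (t *m C1) *m G g)%R)%:E)).
  apply: eq_integral => g _; apply: eq_integral => t _ /=.
  by rewrite (enorm_mulmx _ (to_orthgrp_orth fullv g)) (enorm_mulmx _ CC1).
have mtC : measurable_fun setT (fun t : 'rV[R]_(n - j) => t *m C1)%R.
  by apply: measurable_mulmx => //; exact: measurable_cst.
have mpow : measurable_fun setT (fun t : 'rV[R]_(n - j) => (enorm t `^ l)%:E : \bar R).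
  apply/measurable_EFinP; apply: (measurableT_comp (@measurable_powR _ _)).
  by apply: measurable_enorm.
rewrite tonelli; last 2 first.
- apply: emeasurable_funM; first exact: (measurableT_comp mpow measurable_snd).
  apply: measurable_mean_integrand => //.
  exact: (measurableT_comp mtC measurable_snd).
- by move=> g t; rewrite mule_ge0// lee_fin ?powR_ge0.
transitivity (\int[λ (n - j)]_t ((enorm t `^ l)%:E * spherical_mean f (enorm t))).
  apply: eq_integral => t _; rewrite ge0_integralTZl.
  - apply: (congr1 (fun y => (enorm t `^ l)%:E * y)).
    rewrite (spherical_meanE mf f0 (mulmx_frame_mem t dO1)).
    by rewrite (enorm_mulmx t CC1).
  - by apply: measurable_mean_integrand => //; exact: measurable_cst.
  - by move=> g; rewrite lee_fin.
  - by rewrite lee_fin powR_ge0.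
have nj : (0 < n - j)%N by rewrite subn_gt0 (ltn_trans hjk).
rewrite (integral_polar (Psi := fun r => (r `^ l)%:E * spherical_mean f r) nj).
- congr (_ * _); apply: eq_mint => r r0; rewrite muleA -EFinM; congr (_%:E * _).
  by rewrite -powRD// (gt_eqF r0) implybT.
- exact: measurable_powMl.
- by move=> r; exact: powMl_ge0.
Qed.

(** The offset of a [j]-plane inside a [k]-plane is a rotation of [z *m Z + t *m C2], whose terms
    are orthogonal, so its length is sqrt(|z|^2 + |t|^2). Averaging over all rotations replaces [f]
    by its spherical mean at that radius, and (A) is reduced to radial integrands. *)
Lemma integral_plane_radon (f : plane -> R) (l : R) : measurable_fun setT f -> (forall x, (0 <= f x)%R) ->
  \int[plane_measure k]_x ((enorm x.2 `^ l)%:E * radon_ext f x) =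
  (sphere_area (n - k).-1)%:E * bracket_integral (k - j) ((n - j)%:R + l) *
    mint (fun r => (r `^ ((n - j)%:R + l))%:E * spherical_mean f r).
Proof.
move=> mf f0.
have mpow : measurable_fun setT (fun t : 'rV[R]_(n - k) => (enorm t `^ l)%:E : \bar R).
  apply/measurable_EFinP; apply: (measurableT_comp (@measurable_powR _ _)).
  by apply: measurable_enorm.
have mphi : measurable_fun setT (fun x : plane => (enorm x.2 `^ l)%:E * radon_ext f x).
  apply: emeasurable_funM; last exact: measurable_radon_ext.
  apply/measurable_EFinP; apply: (measurableT_comp (@measurable_powR _ _)).
  by apply: measurable_enorm.
have phi0 (x : plane) : 0 <= (enorm x.2 `^ l)%:E * radon_ext f x.
  by rewrite mule_ge0// ?lee_fin ?powR_ge0 ?radon_flag_ge0.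
have mS := measurable_spherical_mean mf f0.
have S0 r := spherical_mean_ge0 r f0.
have tCE t : (t *m C2 \in orthv E2)%R by exact: mulmx_frame_mem.
have mtC : measurable_fun setT (fun t : 'rV[R]_(n - k) => t *m C2)%R.
  by apply: measurable_mulmx => //; exact: measurable_cst.
have mtG : measurable_fun setT (fun x : 'M[R]_n * 'rV[R]_(n - k) => x.2 *m C2 *m G x.1)%R.
  by apply: measurable_mulmx; [exact: (measurableT_comp mtC)|exact: measurable_to_orthgrp].
rewrite (ge0_integral_plane dE2 CC2 (frame_orthproj dO2) mphi phi0).
transitivity (\int[haar fullv]_g \int[λ (n - k)]_t
    ((enorm t `^ l)%:E * radon_flag E1 E2 Z f (G g) (t *m C2 *m G g))).
  apply: eq_integral => g _; apply: eq_integral => t _ /=.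
  have Gg := to_orthgrp_orth fullv g.
  have -> : enorm (t *m C2 *m G g)%R = enorm t.
    exact: (etrans (enorm_mulmx _ Gg) (enorm_mulmx t CC2)).
  apply: (congr1 (fun y => (enorm t `^ l)%:E * y)).
  rewrite /radon_ext -radon_integral_flag//.
    exact: (radon_integralE E12 dE1 dE2 ZZ ZP).
  split => /=; first by rewrite dim_rotate.
  by rewrite orthv_rotate//; apply/mem_rotate; exists (t *m C2)%R.
rewrite tonelli; last 2 first.
- apply: emeasurable_funM; first exact: (measurableT_comp mpow measurable_snd).
  apply: measurable_radon_flag => //; first by move=> x; exact: to_orthgrp_orth.
  exact: measurable_to_orthgrp.
- by move=> g t; rewrite mule_ge0// ?lee_fin ?powR_ge0 ?radon_flag_ge0.
transitivity (\int[λ (n - k)]_t \int[λ (k - j)]_z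
    ((enorm t `^ l)%:E * spherical_mean f (Num.sqrt (dot z z + dot t t)))).
  apply: eq_integral => t _.
  have mSz : measurable_fun setT (fun z : 'rV[R]_(k - j) =>
      spherical_mean f (Num.sqrt (dot z z + dot t t))).
    apply: (measurableT_comp mS); apply: measurable_sqrtr; apply: measurable_funD.
      by apply: measurable_dot.
    exact: measurable_cst.
  rewrite ge0_integralTZl; last 3 first.
  - apply: measurable_radon_flag => //; first by move=> x; exact: to_orthgrp_orth.
      exact: measurable_to_orthgrp.
    by apply: measurable_mulmx; [exact: measurable_cst|exact: measurable_to_orthgrp].
  - by move=> g; exact: radon_flag_ge0.
  - by rewrite lee_fin powR_ge0.
  rewrite ge0_integralTZl; last 3 first.
  - exact: mSz.
  - by move=> z; exact: S0.
  - by rewrite lee_fin powR_ge0.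
  congr (_ * _).
  pose Q g h (z : 'rV[R]_(k - j)) := (f (rotate (to_orthgrp E2 h *m G g) E1,
     z *m Z *m (to_orthgrp E2 h *m G g) + t *m C2 *m G g)%R)%:E : \bar R.
  have mQ d (T : measurableType d) (a b : T -> 'M[R]_n) (z : T -> 'rV[R]_(k - j)) :
      measurable_fun setT a -> measurable_fun setT b -> measurable_fun setT z ->
      measurable_fun setT (fun x => Q (a x) (b x) (z x)).
    move=> ma mb mz; apply/measurable_EFinP.
    apply: (@measurable_radon_integrand R n j k E1 E2 Z f _ T (fun x => G (a x))
      (fun x => t *m C2 *m G (a x))%R b z) => //.
    - by move=> x; exact: to_orthgrp_orth.
    - exact: measurable_to_orthgrp.
    - by apply: measurable_mulmx; [exact: measurable_cst|exact: measurable_to_orthgrp].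
  have Q0 g h z : 0 <= Q g h z by rewrite lee_fin.
  transitivity (\int[haar fullv]_g \int[haar E2]_h \int[λ (k - j)]_z Q g h z).
    by [].
  rewrite tonelli; last 2 first.
  - apply: measurable_integral_ge0 => [|x z]; last exact: Q0.
    apply: mQ => //.
      exact: (measurableT_comp measurable_fst measurable_fst).
    exact: (measurableT_comp measurable_snd measurable_fst).
  - by move=> g h; apply: integral_ge0 => z _; exact: Q0.
  rewrite -[RHS](integral_probability_cst (haar E2)); apply: eq_integral => h _.
  rewrite tonelli; last 2 first.
  - by apply: mQ => //; exact: measurable_cst.
  - by move=> g z; exact: Q0.
  apply: eq_integral => z _.
  pose kap := to_orthgrp E2 h.
  have kE : orthgrp E2 kap by exact: to_orthgrpP.
  have kf : orthgrp fullv kap by exact: (orthgrpS (subvf _) kE).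
  pose v := (z *m Z + t *m C2)%R.
  have ZZE : (Z *m orthproj (orthv E1 :&: E2)%VS = Z)%R by rewrite -ZP mulmxA ZZ mul1mx.
  have zE : (z *m Z \in orthv E1 :&: E2)%VS.
    by apply/orthprojP; rewrite -mulmxA ZZE.
  move: zE; rewrite memv_cap => /andP[zE1 zE2].
  have vE : v \in orthv E1.
    rewrite memvD//; apply/memv_orthP => w wE; move/memv_orthP: (tCE t); apply.
    exact: (subvP E12).
  have -> : Num.sqrt (dot z z + dot t t) = enorm v.
    rewrite /enorm /v !(dotDl, dotDr) (dot_mulmx _ _ ZZ) (dot_mulmx _ _ CC2).
    have tz : dot (t *m C2)%R (z *m Z)%R = 0%R by move/memv_orthP: (tCE t); apply.
    by rewrite tz (dotC (z *m Z)%R) tz addr0 add0r.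
  rewrite -(spherical_meanE mf f0 vE).
  pose F g := (f (rotate (G g) E1, v *m G g)%R)%:E : \bar R.
  have mF : measurable_fun setT F.
    by apply: measurable_mean_integrand => //; exact: measurable_cst.
  have F0 g : 0 <= F g by rewrite lee_fin.
  (* The rotation [kap] of [E2] fixes [t *m C2], so it acts on the whole offset [v], and left
     invariance of [haar fullv] absorbs it. *)
  transitivity (\int[haar fullv]_g F (kap *m G g)%R).
    apply: eq_integral => g _; rewrite /Q /F (to_orthgrp_id (orthgrpM kf (to_orthgrpP _ g))).
    congr ((f (_, _))%:E); rewrite mulmxDl; congr (_ + _)%R.
    by rewrite !mulmxA (orthgrp_fix kE (tCE t)).
  rewrite (haar_mulmxl mF F0 kf); apply: eq_integral => g _.
  by rewrite /F (to_orthgrp_id (to_orthgrpP _ g)).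
have nk : (0 < n - k)%N by rewrite subn_gt0.
rewrite (integral_double_radial _ _ nk mS S0).
have -> : ((n - k)%:R + (k - j)%:R + l = (n - j)%:R + l :> R)%R.
  rewrite -natrD; congr (_%:R + _)%R; rewrite addnBA ?(ltnW hjk)// subnK//.
  exact: ltnW.
by [].
Qed.

End radon_identities.

(** * Negligible planes, linearity, identities (A) and (B) *)

Section radon_operator.
Local Open Scope ereal_scope.
Context {R : realType} {n : nat}.
Local Notation "'λ' d" := (@lebesgue_rV R d) (at level 10).
Local Notation plane := ({vspace 'rV[R]_n} * 'rV[R]_n)%type.
Local Notation G := (to_orthgrp (fullv : {vspace 'rV[R]_n})).

(** Planes through the origin are discarded because [enorm x.2] is raised to powers of arbitrary
    sign, whose values at 0 are mere conventions. *)
Lemma ae_planes m : (m < n)%N ->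
  {ae @plane_measure R n m, forall x, planes m x /\ x.2 != 0%R}.
Proof.
move=> mn.
have [|E _ dE] := @exists_subspace R n fullv m.
  by rewrite dimvf /dim/= mul1n ltnW.
have dO : \dim (orthv E) = (n - m)%N by rewrite dim_orthv dE.
have CC := frame_orth dO.
pose N := [set x : plane | x.2 = 0%R].
have mN : measurable N by apply: measurable_eqmx => //; exact: measurable_cst.
have N0 : @plane_measure R n m N = 0.
  rewrite -(integralT_indic (plane_measure m))// (ge0_integral_plane dE CC (frame_orthproj dO)).
  - rewrite integral0_eq// => g _.
    rewrite -(lebesgue_rV_set0 (d := (n - m)%N) (R := R)) ?subn_gt0//.
    rewrite -[RHS]integralT_indic; last exact: measurable_mx_set1.
    apply: eq_integral => t _; congr (_%:E); rewrite !indicE; congr ((nat_of_bool _)%:R).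
    apply/idP/idP; rewrite !inE /N/=; last by move=> ->; rewrite !mul0mx.
    move=> /(congr1 (fun x => x *m (G g)^T *m (frame (n - m) (orthv E))^T)%R).
    by rewrite -!mulmxA (mulmxA (G g)) to_orthgrp_orth mul1mx CC mulmx1 !mul0mx.
  - by apply/measurable_EFinP; exact: measurable_indic.
  - by move=> x; rewrite lee_fin.
have ae1 : {ae @plane_measure R n m, forall x, planes m x}.
  exists (~` planes m); split => //; first by apply: measurableC; exact: measurable_planes.
  exact: plane_measure_setC (ltnW mn).
have ae2 : {ae @plane_measure R n m, forall x, x.2 != 0%R}.
  by exists N; split => // x /= /negP/negPn/eqP.
by apply: filterS2 ae1 ae2 => x.
Qed.

Lemma integral_plane_radial m (Psi : R -> \bar R) : (m < n)%N ->
  measurable_fun setT Psi -> (forall r, 0 <= Psi r) ->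
  \int[@plane_measure R n m]_x Psi (enorm x.2) =
  (sphere_area (n - m).-1)%:E * mint (fun r => (r `^ (n - m)%:R)%:E * Psi r).
Proof.
move=> mn mP P0.
have [|E _ dE] := @exists_subspace R n fullv m.
  by rewrite dimvf /dim/= mul1n ltnW.
have dO : \dim (orthv E) = (n - m)%N by rewrite dim_orthv dE.
have CC := frame_orth dO.
rewrite (ge0_integral_plane (phi := fun x => Psi (enorm x.2)) dE CC (frame_orthproj dO)); last 2 first.
- by apply: (measurableT_comp mP); apply: measurable_enorm.
- by move=> x; exact: P0.
rewrite -(integral_polar _ mP P0) ?subn_gt0//.
rewrite -[RHS](integral_probability_cst (haar (fullv : {vspace 'rV[R]_n}))).
apply: eq_integral => g _; apply: eq_integral => t _ /=.
by rewrite (enorm_mulmx _ (to_orthgrp_orth fullv g)) (enorm_mulmx _ CC).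
Qed.

Variables (j k : nat) (E1 E2 : {vspace 'rV[R]_n}) (Z : 'M[R]_(k - j, n)).
Hypotheses (E12 : (E1 <= E2)%VS) (dE1 : \dim E1 = j) (dE2 : \dim E2 = k).
Hypotheses (ZZ : (Z *m Z^T = 1%:M)%R) (ZP : (Z^T *m Z = orthproj (orthv E1 :&: E2)%VS)%R).
Hypotheses (hjk : (j < k)%N) (hkn : (k < n)%N).
Variable e : 'rV[R]_n.
Hypotheses (eE2 : e \in orthv E2) (e1 : dot e e = 1%R).

Local Notation rext := (radon_ext E1 E2 Z).
Local Notation d := (k - j)%N.
Let P : {measure set ('M[R]_n * 'rV[R]_d) -> \bar R} := (haar E2 \x λ d).

(* The [j]-planes contained in the [k]-plane [tau], parametrized by [haar E2 \x λ d]. *)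
Definition flag_point (tau : plane) (w : 'M[R]_n * 'rV[R]_d) : plane :=
  (rotate (to_orthgrp E2 w.1 *m to_plane_rotation k E2 tau.1) E1,
   w.2 *m Z *m (to_orthgrp E2 w.1 *m to_plane_rotation k E2 tau.1) + tau.2)%R.

Lemma measurable_flag_comp (f : plane -> R) tau : measurable_fun setT f ->
  measurable_fun setT (fun w => f (flag_point tau w)).
Proof.
move=> mf; apply: (@measurable_radon_integrand R n j k E1 E2 Z f _ _
  (fun=> to_plane_rotation k E2 tau.1) (fun=> tau.2) fst snd) => //.
by move=> x; exact: to_plane_rotation_orth.
Qed.

Lemma ge0_radon_extE (f : plane -> R) tau : measurable_fun setT f ->
  (forall x, (0 <= f x)%R) -> rext f tau = \int[P]_w (f (flag_point tau w))%:E.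
Proof.
move=> mf f0; rewrite fubini_tonelli1//.
  by apply/measurable_EFinP; exact: measurable_flag_comp.
by move=> x; rewrite lee_fin.
Qed.

Lemma radon_integrable (f : plane -> R) tau : measurable_fun setT f ->
  rext (fun x => `|f x|%R) tau < +oo ->
  P.-integrable setT (fun w => (f (flag_point tau w))%:E).
Proof.
move=> mf; rewrite ge0_radon_extE//; last first.
  by apply: measurableT_comp => //; exact: normr_measurable.
move=> fin; apply/integrableP; split => //.
by apply/measurable_EFinP; exact: measurable_flag_comp.
Qed.

Lemma radon_extE (f : plane -> R) tau : measurable_fun setT f ->
  rext (fun x => `|f x|%R) tau < +oo ->
  rext f tau = \int[P]_w (f (flag_point tau w))%:E.
Proof.
by move=> mf fin; rewrite -integral12_prod_meas1//; exact: radon_integrable.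
Qed.

Lemma radon_ext_fin_num (f : plane -> R) tau : measurable_fun setT f ->
  rext (fun x => `|f x|%R) tau < +oo -> rext f tau \is a fin_num.
Proof.
move=> mf fin; rewrite radon_extE//.
by apply: integrable_fin_num => //; exact: radon_integrable.
Qed.

(** Where the right-hand side is infinite, [fine] may return its default value, and the bound is
    trivial. *)
Lemma abs_radon_ext_le (f : plane -> R) tau : measurable_fun setT f ->
  (`|fine (rext f tau)|%R)%:E <= rext (fun x => `|f x|%R) tau.
Proof.
move=> mf; have mfa : measurable_fun setT (fun x => `|f x|%R) by exact: measurableT_comp.
have [fin|] := ltP (rext (fun x => `|f x|%R) tau) +oo; last first.
  by rewrite leye_eq => /eqP ->; rewrite leey.
rewrite -[X in X <= _]/(`|(fine (rext f tau))%:E|) fineK ?radon_ext_fin_num//.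
rewrite radon_extE// ge0_radon_extE//.
apply: le_abse_integral => //; apply/measurable_EFinP; exact: measurable_flag_comp.
Qed.

Lemma radon_ext_linear (f h : plane -> R) (a : R) tau :
  measurable_fun setT f -> measurable_fun setT h ->
  rext (fun x => `|f x|%R) tau < +oo -> rext (fun x => `|h x|%R) tau < +oo ->
  fine (rext (fun x => a * f x + h x)%R tau) = (a * fine (rext f tau) + fine (rext h tau))%R.
Proof.
move=> mf mh ffin hfin.
have if_ := radon_integrable mf ffin; have ih := radon_integrable mh hfin.
have iaf : P.-integrable setT (fun w => a%:E * (f (flag_point tau w))%:E) by exact: integrableZl.
pose fs x := (a * f x + h x)%R.
have mfs : measurable_fun setT fs.
  by apply: measurable_funD => //; apply: measurable_funM => //; exact: measurable_cst.
have isum : P.-integrable setT (fun w => (fs (flag_point tau w))%:E).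
  by apply: eq_integrable (integrableD measurableT iaf ih) => // w _; rewrite -EFinM -EFinD.
have sfin : rext (fun x => `|fs x|%R) tau < +oo.
  rewrite ge0_radon_extE; last 2 first.
  - exact: measurableT_comp.
  - by [].
  by move/integrableP : isum => [_].
have ff := integrable_fin_num measurableT if_.
have hf := integrable_fin_num measurableT ih.
rewrite (radon_extE mfs sfin) (radon_extE mf ffin) (radon_extE mh hfin).
have -> : \int[P]_w (fs (flag_point tau w))%:E =
    a%:E * \int[P]_w (f (flag_point tau w))%:E + \int[P]_w (h (flag_point tau w))%:E.
  rewrite -(integralZl measurableT if_) -(integralD measurableT iaf ih).
  by apply: eq_integral => w _; rewrite -EFinM -EFinD.
move: ff hf; case: (\int[P]_w (f (flag_point tau w))%:E) => [x| |]//.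
by case: (\int[P]_w (h (flag_point tau w))%:E) => [y| |].
Qed.

Lemma flag_point_sqr tau w : planes k tau ->
  enorm (flag_point tau w).2 = Num.sqrt (dot w.2 w.2 + enorm tau.2 ^+ 2)%R.
Proof.
move=> [dt ut]; rewrite {1}/enorm; congr Num.sqrt; rewrite enorm_sqr /=.
set x := (to_orthgrp E2 w.1 *m to_plane_rotation k E2 tau.1)%R.
have xx : (x *m x^T = 1%:M)%R.
  by rewrite trmx_mul mulmxA -(mulmxA (to_orthgrp _ _)) to_plane_rotation_orth
    mulmx1 to_orthgrp_orth.
have xE : rotate x E2 = tau.1.
  by rewrite -rotateM (orthgrp_rotate (to_orthgrpP E2 w.1)) rotate_to_plane_rotation.
have zE : (w.2 *m Z \in E2)%R.
  have : (w.2 *m Z \in orthv E1 :&: E2)%VS.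
    by apply/orthprojP; rewrite -ZP -!mulmxA (mulmxA Z) ZZ mul1mx.
  by rewrite memv_cap => /andP[].
have zt : (w.2 *m Z *m x \in tau.1)%R by rewrite -xE; apply/mem_rotate; exists (w.2 *m Z)%R.
have uz : dot tau.2 (w.2 *m Z *m x)%R = 0%R by move/memv_orthP: ut; apply.
by rewrite !(dotDl, dotDr) (dot_mulmx _ _ xx) (dot_mulmx _ _ ZZ) uz (dotC _ tau.2) uz addr0 add0r.
Qed.

Lemma radon_ext_radial (phi : R -> R) tau : measurable_fun setT phi ->
  (forall r, 0 <= phi r)%R -> planes k tau -> tau.2 != 0%R ->
  rext (fun x => phi (enorm x.2)) tau =
  (enorm tau.2 `^ d%:R)%:E * \int[λ d]_w (phi (enorm tau.2 * bracket w)%R)%:E.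
Proof.
move=> mphi phi0 pt u0; have r0 := gt0_enorm u0; set r := enorm tau.2 in r0 *.
have mF : measurable_fun setT (fun z : 'rV[R]_d => (phi (Num.sqrt (dot z z + r ^+ 2)))%:E : \bar R).
  apply/measurable_EFinP; apply: (measurableT_comp mphi); apply: measurable_sqrtr.
  apply: measurable_funD; last exact: measurable_cst.
  by apply: (measurable_dot (f := id) (g := id)); exact: measurable_id.
transitivity (\int[λ d]_z (phi (Num.sqrt (dot z z + r ^+ 2)))%:E).
  rewrite -[RHS](integral_probability_cst (haar E2)).
  apply: eq_integral => h _; apply: eq_integral => z _.
  by rewrite -(flag_point_sqr (h, z) pt).
have rd : (0 < r ^+ d)%R by rewrite exprn_gt0.
rewrite (powR_mulrn _ (ltW r0)).
transitivity ((r ^+ d)%:E * ((r ^- d)%:E * \int[λ d]_z (phi (Num.sqrt (dot z z + r ^+ 2)))%:E)).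
  by rewrite muleA -EFinM mulfV ?gt_eqF// mul1e.
congr (_ * _); rewrite -(ge0_integral_rV_scale r0 mF); last by move=> z; rewrite lee_fin.
apply: eq_integral => w _; rewrite dotZ -expr2 /bracket.
have -> : (r ^+ 2 * dot w w + r ^+ 2 = r ^+ 2 * (1 + dot w w))%R by ring.
by rewrite sqrtrM ?sqr_ge0// sqrtr_sqr gtr0_norm.
Qed.

(** Identity (B), for every exponent, with [bracket_integral d a] possibly infinite. *)
Lemma radon_ext_power (a : R) tau : planes k tau -> tau.2 != 0%R ->
  rext (fun x => enorm x.2 `^ (- a))%R tau =
  (enorm tau.2 `^ (d%:R - a))%:E * bracket_integral d a.
Proof.
move=> pt u0; have r0 := gt0_enorm u0.
have mpow : measurable_fun setT (fun r : R => r `^ (- a))%R by exact: measurable_powR.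
have pow0 (r : R) : (0 <= r `^ (- a))%R by exact: powR_ge0.
rewrite (radon_ext_radial mpow pow0 pt u0).
rewrite powRD; last by rewrite (gt_eqF r0) implybT.
rewrite EFinM -muleA; congr (_ * _); rewrite -ge0_integralTZl.
- apply: eq_integral => w _; rewrite -EFinM; congr (_%:E).
  by rewrite powRM// ltW// bracket_gt0.
- apply/measurable_EFinP; apply: (measurableT_comp (@measurable_powR _ _)).
  exact: measurable_bracket.
- by move=> w; rewrite lee_fin powR_ge0.
- by rewrite lee_fin powR_ge0.
Qed.

(** Identity (A): the integral of the spherical means is eliminated between [integral_plane_radon]
    and [integral_plane_mean]. *)
Lemma integral_radon_ext (f : plane -> R) (l : R) : measurable_fun setT f ->
  (forall x, (0 <= f x)%R) ->
  \int[plane_measure k]_x ((enorm x.2 `^ l)%:E * rext f x) =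
  (sphere_area (n - k).-1 / sphere_area (n - j).-1)%:E * bracket_integral d ((n - j)%:R + l) *
  \int[plane_measure j]_x ((enorm x.2 `^ l)%:E * (f x)%:E).
Proof.
move=> mf f0.
rewrite (integral_plane_radon E12 dE1 dE2 ZZ ZP hjk hkn eE2 e1)//.
rewrite (integral_plane_mean E12 dE1 hjk hkn eE2 e1)//.
have s0 : (sphere_area (n - j).-1 != 0 :> R)%R by rewrite gt_eqF// sphere_area_gt0.
rewrite [RHS]muleA; congr (_ * _); rewrite muleAC -EFinM; congr (_%:E * _).
by rewrite divfK.
Qed.

(** Makes the transform well defined on classes modulo null sets. *)
Lemma radon_ext_ae0 (f : plane -> R) : measurable_fun setT f -> (forall x, (0 <= f x)%R) ->
  {ae plane_measure j, forall x, f x = 0%R} ->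
  {ae plane_measure k, forall x, rext f x = 0}.
Proof.
move=> mf f0 fae.
have mS : measurable_fun setT (rext f) by exact: measurable_radon_ext.
have S0 x : 0 <= rext f x by exact: radon_flag_ge0.
have I0 : \int[plane_measure k]_x `|rext f x| = 0.
  transitivity (\int[plane_measure k]_x ((enorm x.2 `^ 0)%:E * rext f x)).
    by apply: eq_integral => x _; rewrite powRr0 mul1e gee0_abs.
  rewrite integral_radon_ext// (_ : \int[plane_measure j]_x _ = 0) ?mule0//.
  transitivity (\int[@plane_measure R n j]_x `|(f x)%:E|).
    by apply: eq_integral => x _; rewrite powRr0 mul1e gee0_abs// lee_fin.
  apply/ae_eq_integral_abs => //; first exact/measurable_EFinP.
  by apply: filterS fae => x fx _; rewrite fx.
have [A] := (ae_eq_integral_abs (plane_measure k) measurableT mS).1 I0.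
move=> [mA A0 H]; exists A; split => // x /= Hx; apply: H => /= H'.
by apply: Hx; exact: H'.
Qed.

End radon_operator.

(** * Upper bounds *)

Section lebesgue_norms.
Local Open Scope ereal_scope.
Context {R : realType} {n : nat}.
Local Notation plane := ({vspace 'rV[R]_n} * 'rV[R]_n)%type.

Lemma weighted_normE m (p nu : R) (phi : plane -> R) : (1 <= p)%R ->
  weighted_norm m p%:E nu phi =
  (\int[plane_measure m]_(x in planes m) ((enorm x.2 `^ nu * `|phi x|) `^ p)%:E) `^ p^-1.
Proof.
move=> p1; have p0 : (p != 0)%R by rewrite gt_eqF// (lt_le_trans ltr01).
rewrite /weighted_norm unlock; congr (_ `^ _); rewrite [RHS]integral_mkcond.
apply: eq_integral => x _; rewrite !patchE; case: ifPn => _; last first.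
  by rewrite abse0 poweR0r.
by rewrite /= normrM ger0_norm ?powR_ge0.
Qed.

Lemma integral_planes m (F : plane -> \bar R) : (m < n)%N ->
  measurable_fun setT F -> (forall x, 0 <= F x) ->
  \int[plane_measure m]_(x in planes m) F x = \int[plane_measure m]_x F x.
Proof.
move=> mn mF F0.
rewrite [RHS](ge0_negligible_integral _ _ _ _ (plane_measure_setC (ltnW mn)))//.
  by rewrite setTD setCK.
by apply: measurableC; exact: measurable_planes.
Qed.

Lemma measurable_enorm_pow (nu : R) : measurable_fun setT (fun x : plane => enorm x.2 `^ nu)%R.
Proof. by apply: (measurableT_comp (@measurable_powR _ _)); apply: measurable_enorm. Qed.

Lemma measurable_weighted (p nu : R) (phi : plane -> R) : measurable_fun setT phi ->
  measurable_fun setT (fun x : plane => ((enorm x.2 `^ nu * `|phi x|) `^ p)%R).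
Proof.
move=> mphi; apply: (measurableT_comp (@measurable_powR _ _)).
apply: measurable_funM; first exact: measurable_enorm_pow.
exact: measurableT_comp.
Qed.

End lebesgue_norms.

(** * Hoelder's inequality and the bound for finite exponents *)

Section radon_bounds.
Local Open Scope ereal_scope.
Context {R : realType} {n : nat}.
Local Notation "'λ' d" := (@lebesgue_rV R d) (at level 10).
Local Notation plane := ({vspace 'rV[R]_n} * 'rV[R]_n)%type.

Variables (j k : nat) (E1 E2 : {vspace 'rV[R]_n}) (Z : 'M[R]_(k - j, n)).
Hypotheses (E12 : (E1 <= E2)%VS) (dE1 : \dim E1 = j) (dE2 : \dim E2 = k).
Hypotheses (ZZ : (Z *m Z^T = 1%:M)%R) (ZP : (Z^T *m Z = orthproj (orthv E1 :&: E2)%VS)%R).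
Hypotheses (hjk : (j < k)%N) (hkn : (k < n)%N).
Variable e : 'rV[R]_n.
Hypotheses (eE2 : e \in orthv E2) (e1 : dot e e = 1%R).

Local Notation rext := (radon_ext E1 E2 Z).
Local Notation d := (k - j)%N.
Let P : {measure set ('M[R]_n * 'rV[R]_d) -> \bar R} := (haar E2 \x λ d).

(** The splitting exponent [a * (p - 1) / p] is [a / q] for the conjugate exponent [q]: the [q]-th
    power of the second factor is then |zeta|^(-a), whose transform (B) evaluates. *)
Lemma radon_hoelder (f : plane -> R) (p a : R) tau :
  measurable_fun setT f -> (1 < p)%R -> planes k tau -> tau.2 != 0%R ->
  (rext (fun x => `|f x|%R) tau) `^ p <=
  rext (fun x => `|f x| `^ p * enorm x.2 `^ (a * (p - 1)))%R tau *
  ((enorm tau.2 `^ (d%:R - a))%:E * bracket_integral d a) `^ (p - 1).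
Proof.
move=> mf p1 pt u0.
have p0 : (0 < p)%R by exact: lt_trans p1.
have q0 : (0 < p - 1)%R by rewrite subr_gt0.
pose q := (p / (p - 1))%R.
have q0' : (0 < q)%R by rewrite divr_gt0.
pose N w := enorm (flag_point E1 E2 Z tau w).2.
have N0 w : (0 < N w)%R.
  rewrite /N (flag_point_sqr dE2 ZZ ZP)// sqrtr_gt0 ltr_wpDl ?dot_ge0//.
  by rewrite exprn_gt0// gt0_enorm.
have mpt (h : plane -> R) : measurable_fun setT h ->
    measurable_fun setT (fun w => h (flag_point E1 E2 Z tau w)).
  by move=> mh; apply: measurable_flag_comp.
have mpow b : measurable_fun setT (fun w => N w `^ b)%R.
  exact: (mpt _ (measurable_enorm_pow b)).
pose F w := (`|f (flag_point E1 E2 Z tau w)| * N w `^ (a * (p - 1) / p))%R.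
pose H w := (N w `^ (- (a * (p - 1) / p)))%R.
have mF : measurable_fun setT F.
  by apply: measurable_funM => //; apply: measurableT_comp => //; exact: mpt.
have mH : measurable_fun setT H by exact: mpow.
have F0 w : (0 <= F w)%R by rewrite mulr_ge0 ?powR_ge0.
have H0 w : (0 <= H w)%R by rewrite powR_ge0.
have pq : (p^-1 + q^-1 = 1)%R by rewrite /q; field; rewrite !gt_eqF.
have := hoelder P mF mH p0 q0' pq.
have -> : 'N[P]_1[EFin \o (F \* H)%R] = rext (fun x => `|f x|%R) tau.
  rewrite Lnorm1 (ge0_radon_extE _ _ _ (k := k)) //; last exact: measurableT_comp.
  apply: eq_integral => w _; rewrite /= ger0_norm ?mulr_ge0 ?powR_ge0//; congr EFin.
  by rewrite /F /H powRN mulfK// gt_eqF// powR_gt0.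
move=> hol.
have ap : (0 <= p)%R by exact: ltW.
have in0y (x : \bar R) : 0 <= x -> x \in `[0, +oo] by move=> x0; rewrite in_itv/= x0 leey.
apply: (le_trans (gt0_ler_poweR ap _ _ hol)).
- by apply: in0y; apply: radon_flag_ge0.
- by apply: in0y; rewrite mule_ge0 ?Lnorm_ge0.
rewrite poweRM ?Lnorm_ge0// poweR_Lnorm ?gt_eqF//.
have -> : \int[P]_w `|(EFin \o F) w| `^ p =
    rext (fun x => `|f x| `^ p * enorm x.2 `^ (a * (p - 1)))%R tau.
  rewrite (ge0_radon_extE _ _ _ (k := k)) //; last 2 first.
  - apply: measurable_funM; last exact: measurable_enorm_pow.
    by apply: (measurableT_comp (@measurable_powR _ _)); exact: measurableT_comp.
  - by move=> x; rewrite mulr_ge0 ?powR_ge0.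
  apply: eq_integral => w _; rewrite /= ger0_norm ?F0 ?H0 ?mulr_ge0 ?powR_ge0//; congr (_%:E).
  by rewrite powRM ?powR_ge0// -powRrM divfK// gt_eqF.
rewrite lee_wpmul2l//.
  apply: radon_flag_ge0 => x; rewrite mulr_ge0 ?powR_ge0//.
rewrite unlock -poweRrM.
have -> : (q^-1 * p = p - 1)%R by rewrite /q; field; rewrite !gt_eqF.
have -> : \int[P]_w `|(EFin \o H) w| `^ q = rext (fun x => enorm x.2 `^ (- a))%R tau.
  rewrite (ge0_radon_extE _ _ _ (k := k)); last 2 first.
  - exact: measurable_enorm_pow.
  - by move=> x; exact: powR_ge0.
  apply: eq_integral => w _; rewrite /= ger0_norm ?F0 ?H0 ?mulr_ge0 ?powR_ge0//; congr (_%:E).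
  rewrite -powRrM; congr (_ `^ _)%R; rewrite /q; field; rewrite !gt_eqF//.
by rewrite (radon_ext_power dE2 ZZ ZP).
Qed.

Lemma bracket_integral_gt0 (a : R) : (d%:R < a)%R -> (0 < fine (bracket_integral d a))%R.
Proof.
move=> da; rewrite bracket_integralE//= mulr_gt0 ?powR_gt0 ?pi_gt0// divr_gt0// Gamma_gt0//.
  by rewrite divr_gt0// subr_gt0.
by rewrite divr_gt0// (le_lt_trans _ da).
Qed.

Lemma bracket_integral_fin (a : R) : (d%:R < a)%R ->
  bracket_integral d a = (fine (bracket_integral d a))%:E.
Proof. by move=> da; rewrite bracket_integralE. Qed.

Lemma radon_Lp_bound (f : plane -> R) (p mu nu a : R) : measurable_fun setT f ->
  (1 <= p)%R -> (a * p = mu * p + (n - j)%:R)%R -> (nu * p = mu * p - d%:R * (p - 1))%R ->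
  (d%:R < a)%R ->
  \int[plane_measure k]_x ((enorm x.2 `^ nu)%:E * rext (fun x => `|f x|%R) x) `^ p <=
  (sphere_area (n - k).-1 / sphere_area (n - j).-1 *
    fine (bracket_integral d a) `^ p)%:E *
  \int[plane_measure j]_x ((enorm x.2 `^ mu * `|f x|) `^ p)%:E.
Proof.
move=> mf p1 ap nup da.
set I := fine (bracket_integral d a); have I0 : (0 < I)%R by exact: bracket_integral_gt0.
have IE : bracket_integral d a = I%:E by exact: bracket_integral_fin.
(* [l] equals [nu * p + (d - a) * (p - 1)], the power of |tau| left by Hoelder and (B); and
   [l + a * (p - 1) = mu * p] restores the weight of the norm of [f]. *)
pose l := (mu * p - a * (p - 1))%R.
pose h (x : plane) : R := (`|f x| `^ p * enorm x.2 `^ (a * (p - 1)))%R.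
have mfa : measurable_fun setT (fun x => `|f x|%R) by exact: measurableT_comp.
have mh : measurable_fun setT h.
  apply: measurable_funM; last exact: measurable_enorm_pow.
  exact: (measurableT_comp (@measurable_powR _ _)).
have h0 x : (0 <= h x)%R by rewrite mulr_ge0 ?powR_ge0.
have mS : measurable_fun setT (rext (fun x => `|f x|%R)) by exact: measurable_radon_ext.
have S0 x : 0 <= rext (fun x => `|f x|%R) x by exact: radon_flag_ge0.
have mX : measurable_fun setT (rext h) by exact: measurable_radon_ext.
have X0 x : 0 <= rext h x by exact: radon_flag_ge0.
have mlX : measurable_fun setT (fun x : plane => (enorm x.2 `^ l)%:E * rext h x).
  by apply: emeasurable_funM => //; apply/measurable_EFinP; exact: measurable_enorm_pow.
have lX0 (x : plane) : 0 <= (enorm x.2 `^ l)%:E * rext h x.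
  by rewrite mule_ge0// lee_fin powR_ge0.
apply: (@le_trans _ _ (\int[plane_measure k]_x
    ((I `^ (p - 1))%:E * ((enorm x.2 `^ l)%:E * rext h x)))).
  apply: ae_ge0_le_integral => //.
  - by move=> x _; exact: poweR_ge0.
  - apply: (measurableT_comp (measurable_poweR _)); apply: emeasurable_funM => //.
    by apply/measurable_EFinP; exact: measurable_enorm_pow.
  - by move=> x _; rewrite mule_ge0// lee_fin powR_ge0.
  - by apply: emeasurable_funM => //; exact: measurable_cst.
  apply: filterS (ae_planes hkn) => x [px x0] _.
  have r0 := gt0_enorm x0; set r := enorm x.2 in r0 *.
  rewrite poweRM//; last by rewrite lee_fin powR_ge0.
  rewrite poweR_EFin -powRrM.
  (* At [p = 1] the conjugate exponent is infinite, but [h] is then [|f|] and [nu = l], so both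
     sides coincide. *)
  have [p1'|p1'] := eqVneq p 1%R.
    rewrite p1' poweRe1// subrr powRr0 mul1e mulr1.
    have -> : nu = l by move: nup; rewrite /l p1' subrr !mulr0 !subr0 !mulr1.
    have -> : h = fun x => `|f x|%R.
      by apply/funext => y; rewrite /h p1' subrr mulr0 powRr0 powRr1// mulr1.
    by [].
  have p1'' : (1 < p)%R by rewrite lt_neqAle eq_sym p1' p1.
  apply: (@le_trans _ _ ((r `^ (nu * p))%:E * (rext h x *
      ((r `^ (d%:R - a))%:E * bracket_integral d a) `^ (p - 1)))).
    by rewrite lee_wpmul2l ?lee_fin ?powR_ge0//; exact: radon_hoelder.
  rewrite IE -EFinM poweR_EFin powRM ?powR_ge0 ?(ltW I0)// -powRrM EFinM.
  have -> : (r `^ l = r `^ (nu * p) * r `^ ((d%:R - a) * (p - 1)))%R.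
    rewrite -powRD ?(gt_eqF r0) ?implybT//; congr (_ `^ _)%R; rewrite /l nup; ring.
  rewrite EFinM [rext h x * _]muleC !muleA.
  by rewrite [_ * (I `^ (p - 1))%:E]muleC !muleA.
rewrite ge0_integralTZl//; last by rewrite lee_fin powR_ge0.
rewrite (integral_radon_ext E12 dE1 dE2 ZZ ZP hjk hkn eE2 e1)//.
have -> : ((n - j)%:R + l = a)%R by rewrite /l mulrBr mulr1 ap; ring.
rewrite IE !muleA -!EFinM.
have -> : (I `^ (p - 1) * (sphere_area (n - k).-1 / sphere_area (n - j).-1) * I =
    sphere_area (n - k).-1 / sphere_area (n - j).-1 * I `^ p)%R.
  rewrite mulrAC mulrC; congr (_ * _)%R.
  by rewrite -{2}(powRr1 (ltW I0)) -powRD ?subrK// (gt_eqF I0) implybT.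
rewrite lee_wpmul2l//.
  by rewrite lee_fin mulr_ge0 ?powR_ge0// divr_ge0// ltW// sphere_area_gt0.
apply: ae_ge0_le_integral => //.
- by move=> x _; rewrite mule_ge0// lee_fin ?powR_ge0.
- apply: emeasurable_funM; last exact/measurable_EFinP.
  by apply/measurable_EFinP; exact: measurable_enorm_pow.
- by move=> x _; rewrite lee_fin powR_ge0.
- by apply/measurable_EFinP; exact: measurable_weighted.
apply: filterS (ae_planes (ltn_trans hjk hkn)) => x [_ x0] _.
have r0 := gt0_enorm x0; rewrite -EFinM lee_fin /h.
rewrite powRM ?powR_ge0// -powRrM mulrCA -powRD ?(gt_eqF r0) ?implybT//.
by rewrite /l subrK [leLHS]mulrC.
Qed.

End radon_bounds.

Section plane_restriction.
Local Open Scope ereal_scope.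
Context {R : realType} {n : nat}.
Local Notation plane := ({vspace 'rV[R]_n} * 'rV[R]_n)%type.

(** Members of [weighted_Lp] are measurable on [planes j] only. As the transform on [planes k]
    evaluates them nowhere else, they may be replaced by extensions measurable everywhere. *)
Lemma eq_radon_integral j k (f h : plane -> R) tau : planes k tau ->
  (forall x, planes j x -> f x = h x) ->
  radon_integral j k f tau = radon_integral j k h tau.
Proof.
move=> [_ ut] fh; apply: eq_integral => eta; rewrite inE/= => -[etas deta].
apply: eq_integral => y; rewrite inE/= memv_cap => /andP[yeta _].
rewrite fh//; split => //=; rewrite memvD//.
by apply/memv_orthP => v veta; move/memv_orthP: ut; apply; exact: (subvP etas).
Qed.

Lemma eq_weighted_norm m (p : \bar R) (nu : R) (phi psi : plane -> R) :
  (forall x, planes m x -> phi x = psi x) ->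
  weighted_norm m p nu phi = weighted_norm m p nu psi.
Proof.
move=> e; rewrite /weighted_norm; congr (Lnorm _ _ _); apply/funext => x.
by rewrite !patchE; case: ifPn => //; rewrite inE => /e ->.
Qed.

Lemma weighted_norm_ge0 m (p : \bar R) (nu : R) (phi : plane -> R) :
  0 <= weighted_norm m p nu phi.
Proof. exact: Lnorm_ge0. Qed.

End plane_restriction.

(** * Boundedness and linearity deduced from an a priori bound *)

Section radon_clauses.
Local Open Scope ereal_scope.
Context {R : realType} {n : nat}.
Local Notation plane := ({vspace 'rV[R]_n} * 'rV[R]_n)%type.

Variables (j k : nat) (E1 E2 : {vspace 'rV[R]_n}) (Z : 'M[R]_(k - j, n)).
Hypotheses (E12 : (E1 <= E2)%VS) (dE1 : \dim E1 = j) (dE2 : \dim E2 = k).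
Hypotheses (ZZ : (Z *m Z^T = 1%:M)%R) (ZP : (Z^T *m Z = orthproj (orthv E1 :&: E2)%VS)%R).
Hypotheses (hjk : (j < k)%N) (hkn : (k < n)%N).
Variable e : 'rV[R]_n.
Hypotheses (eE2 : e \in orthv E2) (e1 : dot e e = 1%R).

Local Notation rext := (radon_ext E1 E2 Z).

Lemma radon_integral_ext (f h : plane -> R) tau : planes k tau -> measurable_fun setT h ->
  (forall x, planes j x -> f x = h x) -> radon_integral j k f tau = rext h tau.
Proof.
move=> pt mh fh; rewrite (eq_radon_integral pt fh).
exact: (radon_integral_flag E12 dE1 dE2 ZZ ZP).
Qed.

Lemma radonE (f h : plane -> R) tau : planes k tau -> measurable_fun setT h ->
  (forall x, planes j x -> f x = h x) -> radon j k f tau = fine (rext h tau).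
Proof. by move=> pt mh fh; rewrite /radon (radon_integral_ext pt mh fh). Qed.

Lemma measurable_extension (f : plane -> R) : measurable_fun (planes j) f ->
  exists2 h : plane -> R, measurable_fun setT h & forall x, planes j x -> f x = h x.
Proof.
move=> mf; exists (f \_ (planes j)).
  by apply: (measurable_restrictT _ _).1 => //; exact: measurable_planes.
by move=> x px; rewrite patchE mem_set.
Qed.

Variables (p : \bar R) (mu nu C : R).
Hypothesis C0 : (0 <= C)%R.
Hypothesis bound : forall f : plane -> R, measurable_fun setT f ->
  weighted_norm j p mu f < +oo ->
  {ae plane_measure k, forall x, rext (fun x => `|f x|%R) x < +oo} /\
  weighted_norm k p nu (fun x => fine (rext f x)) <= C%:E * weighted_norm j p mu f.

Lemma radon_norm_le (f : plane -> R) : weighted_Lp j p mu f ->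
  weighted_norm k p nu (radon j k f) <= C%:E * weighted_norm j p mu f.
Proof.
move=> [mf ff]; have [h mh fh] := measurable_extension mf.
rewrite (eq_weighted_norm p mu fh) in ff *; have [_] := bound mh ff.
by apply: le_trans; rewrite (eq_weighted_norm p nu (psi := fun x => fine (rext h x)))// => x px;
  exact: radonE.
Qed.

Lemma radon_converges_ae (f : plane -> R) : weighted_Lp j p mu f ->
  {ae plane_measure k, forall tau, planes k tau -> radon_converges j k f tau}.
Proof.
move=> [mf ff]; have [h mh fh] := measurable_extension mf.
rewrite (eq_weighted_norm p mu fh) in ff; have [fin _] := bound mh ff.
apply: filterS fin => tau fint pt; rewrite /radon_converges.
rewrite (radon_integral_ext (h := fun x => `|h x|%R) pt)//; first exact: measurableT_comp.
by move=> x /fh ->.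
Qed.

Lemma radon_bounded : bounded_linear_operator j k p mu nu (@radon R n j k).
Proof.
split.
- move=> f fL; split.
    have [h mh fh] := measurable_extension fL.1.
    apply: (eq_measurable_fun (fun x => fine (rext h x))).
      by move=> x; rewrite inE => px; rewrite (radonE px mh fh).
    apply: measurable_funTS; apply: (measurableT_comp (fine_measurable _)) => //.
    exact: measurable_radon_ext.
  apply: (le_lt_trans (radon_norm_le fL)); apply: lte_mul_pinfty => //.
  by case: fL.
- move=> f g [mf ff] [mg fg] fgae.
  have [f' mf' ff'] := measurable_extension mf.
  have [g' mg' gg'] := measurable_extension mg.
  rewrite (eq_weighted_norm p mu gg') in fg; have [ging _] := bound mg' fg.
  pose h x := (f' x - g' x)%R.
  have mh : measurable_fun setT h by exact: measurable_funB.
  have mha : measurable_fun setT (fun x => `|h x|%R) by exact: measurableT_comp.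
  have h0 : {ae plane_measure j, forall x, `|h x|%R = 0%R}.
    apply: filterS2 fgae (ae_planes (ltn_trans hjk hkn)) => x fgx [px _].
    by rewrite /h -ff'// -gg'// fgx// subrr normr0.
  have r0 := radon_ext_ae0 E12 dE1 dE2 ZZ ZP hjk hkn eE2 e1 mha (fun=> normr_ge0 _) h0.
  have good : {ae plane_measure k, forall x,
      rext (fun x => `|g' x|%R) x < +oo /\ (planes k x /\ x.2 != 0%R)}.
    by apply: filterS2 ging (ae_planes hkn) => x.
  apply: filterS2 r0 good => x hx [gx [px _]] _.
  rewrite (radonE px mf' ff') (radonE px mg' gg').
  (* [f' = 1 * h + g'], where the transform of [|h|] vanishes at [x]; linearity then identifies the
     two values. *)
  have := radon_ext_linear 1 mh mg' (tau := x) (E1 := E1) (E2 := E2) (Z := Z).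
  rewrite hx => /(_ (ltry _) gx).
  have -> : (fun y => 1 * h y + g' y)%R = f'.
    by apply/funext => y; rewrite mul1r subrK.
  move=> ->; have := abs_radon_ext_le E1 E2 Z x mh.
  by rewrite hx lee_fin normr_le0 => /eqP ->; rewrite mulr0 add0r.
- move=> a f g [mf ff] [mg fg].
  have [f' mf' ff'] := measurable_extension mf.
  have [g' mg' gg'] := measurable_extension mg.
  rewrite (eq_weighted_norm p mu gg') in fg; have [ging _] := bound mg' fg.
  rewrite (eq_weighted_norm p mu ff') in ff; have [finf _] := bound mf' ff.
  have good : {ae plane_measure k, forall x,
      rext (fun x => `|g' x|%R) x < +oo /\ (planes k x /\ x.2 != 0%R)}.
    by apply: filterS2 ging (ae_planes hkn) => x.
  apply: filterS2 finf good => x fx [gx [px _]] _.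
  rewrite (radonE px mf' ff') (radonE px mg' gg') -radon_ext_linear//.
  apply: radonE => //; last by move=> y py; rewrite ff'// gg'.
  by apply: measurable_funD => //; apply: measurable_funM => //; exact: measurable_cst.
- by exists C => f; exact: radon_norm_le.
Qed.

Lemma operator_norm_radon_le : operator_norm j k p mu nu (@radon R n j k) <= C%:E.
Proof.
apply: ge_ereal_sup => _ [f [fL f1] <-].
apply: (le_trans (radon_norm_le fL)).
by rewrite -[leRHS]mule1 lee_wpmul2l// lee_fin.
Qed.

End radon_clauses.

(** * The a priori bound for finite and for infinite exponents *)

Section radon_upper.
Local Open Scope ereal_scope.
Context {R : realType} {n : nat}.
Local Notation plane := ({vspace 'rV[R]_n} * 'rV[R]_n)%type.

(** The norm with exponent [+oo] is the essential supremum only for a nonzero measure, and bounding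
    an essential supremum from below rests on this as well. *)
Lemma plane_measure_gt0 m : (m < n)%N -> 0 < @plane_measure R n m setT.
Proof.
move=> mn; rewrite lt0e measure_ge0 andbT; apply/negP => /eqP m0.
(* The power cancels the polar density and leaves the indicator. *)
pose Psi r := (r `^ (- (n - m)%:R) * \1_(`]1%R, 2%R]%classic) r)%:E : \bar R.
have mP : measurable_fun setT Psi.
  apply/measurable_EFinP; apply: measurable_funM; first exact: measurable_powR.
  exact: measurable_indic.
have P0 r : 0 <= Psi r by rewrite lee_fin mulr_ge0 ?powR_ge0.
have := integral_plane_radial mn mP P0.
rewrite (_ : \int[plane_measure m]_x _ = 0); last first.
  apply: null_set_integral => //.
  by apply: (measurableT_comp mP); apply: measurable_enorm.
move/esym/eqP; rewrite mule_eq0 => /orP[|].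
  by rewrite eqe gt_eqF// sphere_area_gt0.
have /andP[k0 _] : 0 < mint (fun r => (\1_(`]1%R, 2%R]%classic) r)%:E : \bar R) < +oo.
  by apply: mint_indic; lra.
rewrite (_ : mint _ = mint (fun r => (\1_(`]1%R, 2%R]%classic) r)%:E : \bar R)) ?gt_eqF//.
apply: eq_mint => r r0; rewrite -EFinM mulrA -powRD ?(gt_eqF r0) ?implybT//.
by rewrite subrr powRr0 mul1r.
Qed.

Lemma weighted_norm_leyP m (nu : R) (phi : plane -> R) (y : \bar R) : (m < n)%N ->
  weighted_norm m +oo nu phi <= y <->
  {ae plane_measure m, forall x, (enorm x.2 `^ nu * `|phi x|)%:E <= y}.
Proof.
move=> mn; rewrite /weighted_norm unlock plane_measure_gt0//.
have aep := @ae_planes R n m mn.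
have absE x : planes m x -> (abse \o (fun tau : plane => (enorm tau.2 `^ nu * phi tau)%:E)
    \_ (planes m)) x = (enorm x.2 `^ nu * `|phi x|)%:E.
  by move=> px; rewrite /= patchE mem_set//= normrM ger0_norm ?powR_ge0.
split=> [/ess_supP|] h; last apply/ess_supP.
  by apply: filterS2 h aep => x hx [px _]; rewrite -absE.
by apply: filterS2 h aep => x hx [px _]; rewrite absE.
Qed.

Variables (j k : nat) (E1 E2 : {vspace 'rV[R]_n}) (Z : 'M[R]_(k - j, n)).
Hypotheses (E12 : (E1 <= E2)%VS) (dE1 : \dim E1 = j) (dE2 : \dim E2 = k).
Hypotheses (ZZ : (Z *m Z^T = 1%:M)%R) (ZP : (Z^T *m Z = orthproj (orthv E1 :&: E2)%VS)%R).
Hypotheses (hjk : (j < k)%N) (hkn : (k < n)%N).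
Variable e : 'rV[R]_n.
Hypotheses (eE2 : e \in orthv E2) (e1 : dot e e = 1%R).

Local Notation rext := (radon_ext E1 E2 Z).
Local Notation d := (k - j)%N.
Local Notation hjn := (ltn_trans hjk hkn).

Lemma measurable_fine_radon_ext (f : plane -> R) : measurable_fun setT f ->
  measurable_fun setT (fun x => fine (rext f x)).
Proof.
move=> mf; apply: (measurableT_comp (fine_measurable _)) => //.
exact: measurable_radon_ext.
Qed.

Lemma radon_bound_fin (p mu nu a : R) (f : plane -> R) :
  (1 <= p)%R -> (a * p = mu * p + (n - j)%:R)%R -> (nu * p = mu * p - d%:R * (p - 1))%R ->
  (d%:R < a)%R -> measurable_fun setT f -> weighted_norm j p%:E mu f < +oo ->
  {ae plane_measure k, forall x, rext (fun x => `|f x|%R) x < +oo} /\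
  weighted_norm k p%:E nu (fun x => fine (rext f x)) <=
  ((sphere_area (n - k).-1 / sphere_area (n - j).-1) `^ p^-1 *
    fine (bracket_integral d a))%:E * weighted_norm j p%:E mu f.
Proof.
move=> p1 ap nup da mf; have p0 : (0 < p)%R by exact: lt_le_trans p1.
have wf0 (l : R) (phi : plane -> R) x :
    0 <= ((enorm x.2 `^ l * `|phi x|) `^ p)%:E by rewrite lee_fin powR_ge0.
have mwf (l : R) (phi : plane -> R) : measurable_fun setT phi ->
    measurable_fun setT (fun x : plane => ((enorm x.2 `^ l * `|phi x|) `^ p)%:E).
  by move=> mphi; apply/measurable_EFinP; exact: measurable_weighted.
have mg := measurable_fine_radon_ext mf.
rewrite !weighted_normE// (integral_planes hjn); [|exact: mwf|exact: wf0].
rewrite (integral_planes hkn); [|exact: mwf|exact: wf0].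
set N := \int[plane_measure j]_x _ => Nfin.
have N0 : 0 <= N by apply: integral_ge0 => x _; exact: wf0.
have {}Nfin : N < +oo by apply: lty_poweRy Nfin; rewrite invr_eq0 gt_eqF.
have := radon_Lp_bound E12 dE1 dE2 ZZ ZP hjk hkn eE2 e1 mf p1 ap nup da.
rewrite -/N; set K := (_ / _ * _)%R => hK.
have s0 : (0 < sphere_area (n - k).-1 / sphere_area (n - j).-1 :> R)%R.
  by rewrite divr_gt0// sphere_area_gt0.
have I0 : (0 < fine (bracket_integral d a))%R by exact: bracket_integral_gt0.
have mS : measurable_fun setT (rext (fun x => `|f x|%R)).
  by apply: measurable_radon_ext; exact: measurableT_comp.
have S0 x : 0 <= rext (fun x => `|f x|%R) x by exact: radon_flag_ge0.
pose B x := ((enorm x.2 `^ nu)%:E * rext (fun x => `|f x|%R) x) `^ p.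
have mB : measurable_fun setT B.
  apply: (measurableT_comp (measurable_poweR _)); apply: emeasurable_funM => //.
  by apply/measurable_EFinP; exact: measurable_enorm_pow.
have B0 x : 0 <= B x by exact: poweR_ge0.
have K0 : (0 <= K)%R by rewrite mulr_ge0 ?powR_ge0// ltW.
have KN : K%:E * N < +oo by apply: lte_mul_pinfty => //; rewrite lee_fin mulr_ge0 ?powR_ge0// ltW.
split.
  (* Almost everywhere convergence: [B] is integrable, hence finite almost everywhere, and away from
     the planes through the origin an infinite transform would make [B] infinite. *)
  have iB : (plane_measure k).-integrable setT B.
    apply/integrableP; split => //; refine (le_lt_trans _ KN).
    rewrite (_ : \int[plane_measure k]_x `|B x| = \int[plane_measure k]_x B x) //.
    by apply: eq_integral => x _; rewrite gee0_abs.
  apply: filterS2 (integrable_ae measurableT iB) (ae_planes hkn) => x /(_ I) Bx [_ x0].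
  rewrite ltNge leye_eq; apply/negP => /eqP SE; move: Bx.
  rewrite /B SE gt0_muley ?lte_fin ?powR_gt0 ?gt0_enorm// poweRyr ?gt_eqF//.
apply: (@le_trans _ _ ((K%:E * N) `^ p^-1)).
  apply: gt0_ler_poweR.
  - by rewrite invr_ge0 ltW.
  - by rewrite in_itv/= leey andbT; apply: integral_ge0 => x _; rewrite lee_fin powR_ge0.
  - by rewrite in_itv/= leey andbT mule_ge0// lee_fin mulr_ge0 ?powR_ge0// ltW.
  apply: le_trans hK; apply: ge0_le_integral => //.
  - by move=> x _; rewrite lee_fin powR_ge0.
  - exact: (mwf nu _ mg).
  move=> x _; rewrite -poweR_EFin; apply: gt0_ler_poweR.
  - exact: ltW.
  - by rewrite in_itv/= leey andbT lee_fin mulr_ge0 ?powR_ge0.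
  - by rewrite in_itv/= leey andbT mule_ge0// lee_fin powR_ge0.
  by rewrite EFinM lee_wpmul2l ?lee_fin ?powR_ge0//; exact: abs_radon_ext_le.
rewrite poweRM// ?lee_fin// poweR_EFin /K.
rewrite (powRM _ (ltW s0) (powR_ge0 _ _)) -powRrM.
have -> : (p / p = 1)%R by rewrite mulfV ?gt_eqF.
by rewrite (powRr1 (ltW I0)) lexx.
Qed.

Lemma radon_ext_le_add (f g h : plane -> R) (m : R) tau : measurable_fun setT f ->
  measurable_fun setT g -> measurable_fun setT h -> (0 <= m)%R ->
  (forall x, 0 <= f x)%R -> (forall x, 0 <= g x)%R -> (forall x, 0 <= h x)%R ->
  (forall x : plane, x.2 != 0 -> f x <= m * g x + h x)%R ->
  planes k tau -> tau.2 != 0%R ->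
  rext f tau <= m%:E * rext g tau + rext h tau.
Proof.
move=> mf mg mh m0 f0 g0 h0 fgh pt t0.
rewrite !ge0_radon_extE//.
have mfl (phi : plane -> R) : measurable_fun setT phi ->
    measurable_fun setT (fun w => (phi (flag_point E1 E2 Z tau w))%:E).
  by move=> mphi; apply/measurable_EFinP; exact: measurable_flag_comp.
rewrite -ge0_integralTZl//; [|exact: mfl|by move=> w; rewrite lee_fin].
have mmg : measurable_fun setT (fun w => m%:E * (g (flag_point E1 E2 Z tau w))%:E).
  by apply: emeasurable_funM; [exact: measurable_cst|exact: mfl].
rewrite -ge0_integralD//; last 3 first.
- by move=> w _; rewrite mule_ge0// lee_fin.
- by move=> w _; rewrite lee_fin.
- exact: mfl.
apply: ge0_le_integral => //.
- by move=> w _; rewrite lee_fin.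
- exact: mfl.
- by apply: emeasurable_funD => //; exact: mfl.
move=> w _; rewrite -EFinM -EFinD lee_fin; apply: fgh.
apply/eqP => w0; have := flag_point_sqr dE2 ZZ ZP w pt.
rewrite w0 {1}/enorm /dot mul0mx mxE sqrtr0 => /esym/eqP.
by rewrite gt_eqF// sqrtr_gt0 ltr_wpDl ?dot_ge0// exprn_gt0// gt0_enorm.
Qed.

Lemma radon_bound_infty (mu nu : R) (f : plane -> R) :
  (nu = mu - d%:R)%R -> (d%:R < mu)%R ->
  measurable_fun setT f -> weighted_norm j +oo mu f < +oo ->
  {ae plane_measure k, forall x, rext (fun x => `|f x|%R) x < +oo} /\
  weighted_norm k +oo nu (fun x => fine (rext f x)) <=
  (fine (bracket_integral d mu))%:E * weighted_norm j +oo mu f.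
Proof.
move=> nuE dmu mf; have := weighted_norm_ge0 j +oo mu f.
have := weighted_norm_leyP mu f (weighted_norm j +oo mu f) hjn.
case: (weighted_norm j +oo mu f) => [m| |]// [/(_ (lexx _)) fm _] m0 _.
rewrite lee_fin in m0.
have mfa : measurable_fun setT (fun x => `|f x|%R) by exact: measurableT_comp.
pose g (x : plane) := (enorm x.2 `^ (- mu))%R.
have mg : measurable_fun setT g by exact: measurable_enorm_pow.
have g0 x : (0 <= g x)%R by exact: powR_ge0.
(* The bound [|f| <= m * g] holds only almost everywhere. [h] is the excess; it vanishes almost
   everywhere, and so does its transform. *)
pose h x := Num.max (`|f x| - m * g x)%R 0%R.
have mh : measurable_fun setT h.
  apply: measurable_maxr; last exact: measurable_cst.
  by apply: measurable_funB => //; apply: measurable_funM => //; exact: measurable_cst.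
have h0 x : (0 <= h x)%R by rewrite /h le_max lexx orbT.
have hae : {ae plane_measure j, forall x, h x = 0%R}.
  apply: filterS2 fm (ae_planes hjn) => x fx [_ x0]; rewrite lee_fin in fx.
  have r0 := gt0_enorm x0; apply/max_r; rewrite subr_le0 /g powRN.
  by rewrite ler_pdivlMr ?powR_gt0// mulrC.
have Sae : {ae plane_measure k, forall x : plane,
    [/\ x.2 != 0%R & rext (fun x => `|f x|%R) x <=
      (m * (enorm x.2 `^ (d%:R - mu) * fine (bracket_integral d mu)))%:E]}.
  have := radon_ext_ae0 E12 dE1 dE2 ZZ ZP hjk hkn eE2 e1 mh h0 hae.
  move=> rh; apply: filterS2 rh (ae_planes hkn) => x hx [px x0]; split => //.
  rewrite -[leRHS]adde0 -hx 2!EFinM -bracket_integral_fin//.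
  rewrite -(radon_ext_power dE2 ZZ ZP mu px x0).
  apply: radon_ext_le_add => // y _.
  by rewrite -lerBlDl /h le_max lexx.
split.
  by apply: filterS Sae => x [_ Sx]; apply: le_lt_trans Sx _; exact: ltry.
apply/(weighted_norm_leyP _ _ _ hkn); apply: filterS Sae => x [x0 Sx].
have r0 := gt0_enorm x0.
rewrite EFinM; apply: (@le_trans _ _ ((enorm x.2 `^ nu)%:E *
    (m * (enorm x.2 `^ (d%:R - mu) * fine (bracket_integral d mu)))%:E)).
  apply: lee_wpmul2l; first by rewrite lee_fin powR_ge0.
  exact: (le_trans (abs_radon_ext_le _ _ _ _ mf) Sx).
rewrite -EFinM lee_fin mulrCA (mulrA (_ `^ _)%R) -powRD ?(gt_eqF r0) ?implybT//.
by rewrite nuE addrA subrK subrr powRr0 mul1r mulrC.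
Qed.

End radon_upper.

(** * Sharpness *)

Section bracket_limit.
Local Open Scope ereal_scope.
Context {R : realType}.

(** As [bracket w >= 1], the integrands increase when the exponent decreases to [a]; monotone
    convergence takes the place of continuity of the closed form. *)
Lemma bracket_integral_le d (a : R) (M : \bar R) :
  (forall i, bracket_integral d (a + i.+1%:R^-1)%R <= M) -> bracket_integral d a <= M.
Proof.
move=> h.
pose g i (w : 'rV[R]_d) : \bar R := (bracket w `^ (- (a + i.+1%:R^-1)))%:E.
have mg i : measurable_fun setT (g i).
  apply/measurable_EFinP; apply: (measurableT_comp (@measurable_powR _ _)).
  exact: measurable_bracket.
have g0 i w : 0 <= g i w by rewrite lee_fin powR_ge0.
have b1 (w : 'rV[R]_d) : (1 <= bracket w)%R.
  by rewrite -[leLHS]sqrtr1 /bracket ler_sqrt ?lerDl ?dot_ge0// addr_ge0 ?dot_ge0.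
have nd (w : 'rV[R]_d) : {homo g^~ w : i l / (i <= l)%N >-> i <= l}.
  move=> i l il; rewrite lee_fin ler_powR// lerN2 lerD2l.
  by rewrite lef_pV2 ?posrE// ler_nat.
have := cvg_monotone_convergence measurableT mg (fun i w _ => g0 i w) (fun w _ => nd w).
move=> /(_ (lebesgue_rV d)) /cvge_to_le.
have -> : \int[lebesgue_rV d]_w limn (g^~ w) = bracket_integral d a.
  apply: eq_integral => w _; apply/cvg_lim => //; apply/cvg_EFin; first by near=> i.
  have bn0 : bracket w != 0%R by rewrite gt_eqF// bracket_gt0.
  rewrite /g /= /powR (negbTE bn0).
  apply: continuous_cvg; first exact: continuous_expR.
  apply: cvgMl; apply: cvgN; rewrite -[X in _ --> X]addr0.
  apply: cvgD; [exact: cvg_cst|exact: cvg_harmonic].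
by apply; near=> i; exact: h.
Unshelve. all: by end_near. Qed.

End bracket_limit.

(** * Extremal and nearly extremal functions *)

Section radon_lower.
Local Open Scope ereal_scope.
Context {R : realType} {n : nat}.
Local Notation plane := ({vspace 'rV[R]_n} * 'rV[R]_n)%type.

Local Notation tail t := (\1_(`[1%R, +oo[%classic) (t : R) : R).

Lemma mint_tail_scale (K s : R) : (0 <= K)%R -> (0 < s)%R ->
  mint (fun t => (K * (tail t * t `^ (- s)))%R%:E) = (K / s)%:E.
Proof.
move=> K0 s0; rewrite EFinM -mint_tail// -mintZl//.
- apply/measurable_EFinP; apply: measurable_funM; last exact: measurable_powR.
  exact: measurable_indic.
- by move=> t; rewrite lee_fin mulr_ge0 ?powR_ge0.
Qed.

Lemma tailE (t : R) : tail t = (1 <= t)%R%:R.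
Proof. by rewrite indicE mem_setE in_itv/= andbT. Qed.

Variables (j k : nat) (E1 E2 : {vspace 'rV[R]_n}) (Z : 'M[R]_(k - j, n)).
Hypotheses (E12 : (E1 <= E2)%VS) (dE1 : \dim E1 = j) (dE2 : \dim E2 = k).
Hypotheses (ZZ : (Z *m Z^T = 1%:M)%R) (ZP : (Z^T *m Z = orthproj (orthv E1 :&: E2)%VS)%R).
Hypotheses (hjk : (j < k)%N) (hkn : (k < n)%N).
Variable e : 'rV[R]_n.
Hypotheses (eE2 : e \in orthv E2) (e1 : dot e e = 1%R).

Local Notation rext := (radon_ext E1 E2 Z).
Local Notation d := (k - j)%N.
Local Notation hjn := (ltn_trans hjk hkn).

Lemma radon_lower_infty (mu nu : R) : (nu = mu - d%:R)%R -> (d%:R < mu)%R ->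
  exists f : plane -> R, [/\ measurable_fun setT f, weighted_norm j +oo mu f <= 1 &
    (fine (bracket_integral d mu))%:E <= weighted_norm k +oo nu (radon j k f)].
Proof.
move=> nuE dmu; pose f (x : plane) := (enorm x.2 `^ (- mu))%R.
have mf : measurable_fun setT f by exact: measurable_enorm_pow.
exists f; split => //.
  apply/(weighted_norm_leyP _ _ _ hjn); apply: filterS (ae_planes hjn) => x [_ x0].
  have r0 := gt0_enorm x0; rewrite ger0_norm ?powR_ge0// lee_fin /f.
  by rewrite -powRD ?(gt_eqF r0) ?implybT// subrr powRr0.
have := weighted_norm_leyP nu (radon j k f) (weighted_norm k +oo nu (radon j k f)) hkn.
move=> [/(_ (lexx _)) H _]; rewrite leNgt; apply/negP => ltI.
(* A smaller norm would make a contradictory bound hold almost everywhere, although the set of all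
   planes has positive measure. *)
have : {ae @plane_measure R n k, forall x, False}.
  apply: filterS2 H (ae_planes hkn) => x Hx [px x0]; move: Hx; apply/negP; rewrite -ltNge.
  apply: (lt_le_trans ltI); have r0 := gt0_enorm x0.
  rewrite (radonE E12 dE1 dE2 ZZ ZP px mf)// (radon_ext_power dE2 ZZ ZP)//.
  rewrite bracket_integral_fin// -EFinM [fine _%:E]/= lee_fin ger0_norm; last first.
    by rewrite mulr_ge0 ?powR_ge0// ltW// bracket_integral_gt0.
  rewrite mulrA -powRD ?(gt_eqF r0) ?implybT// nuE addrA subrK subrr powRr0 mul1r.
  exact: lexx.
move=> [A [mA A0 hA]]; have := plane_measure_gt0 (R := R) hkn.
rewrite (_ : setT = A) ?A0 ?ltxx//.
by apply/seteqP; split => // x _; apply: hA => /= -[].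
Qed.

(** Truncation to |zeta| >= 1 makes the norm finite. On [k]-planes with |tau| >= 1 it is invisible,
    since the planes inside are no closer to the origin, so the transform there is the one given by
    (B) with exponent [a + eps]. The same tail integral 1/(eps p) occurs in both norms and
    cancels. *)
Lemma radon_lower_fin (p mu nu a eps : R) : (1 <= p)%R ->
  (a * p = mu * p + (n - j)%:R)%R -> (nu * p = mu * p - d%:R * (p - 1))%R ->
  (d%:R < a)%R -> (0 < eps)%R ->
  exists f : plane -> R, [/\ measurable_fun setT f, weighted_norm j p%:E mu f <= 1 &
    ((sphere_area (n - k).-1 / sphere_area (n - j).-1) `^ p^-1 *
      fine (bracket_integral d (a + eps)))%:E <= weighted_norm k p%:E nu (radon j k f)].
Proof.
move=> p1 ap nup da eps0; have p0 : (0 < p)%R by exact: lt_le_trans p1.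
have ep0 : (0 < eps * p)%R by exact: mulr_gt0.
have cancel (x y z t : R) : (0 < y -> 0 < t -> x * (t / y * z / t) = x / y * z)%R.
  by move=> y0 t0; field; rewrite !gt_eqF.
set sj : R := sphere_area (n - j).-1; set sk : R := sphere_area (n - k).-1.
have sj0 : (0 < sj)%R by exact: sphere_area_gt0.
have sk0 : (0 < sk)%R by exact: sphere_area_gt0.
(* Makes the norm of [f] equal to 1: its [p]-th power is [c ^ p * sj / (eps * p)]. *)
pose c := ((eps * p / sj) `^ p^-1)%R.
have c0 : (0 <= c)%R by exact: powR_ge0.
have esj : (0 <= eps * p / sj)%R by exact: divr_ge0 (ltW ep0) (ltW sj0).
have cp : (c `^ p = eps * p / sj)%R.
  by rewrite -powRrM mulVf ?(gt_eqF p0)// (powRr1 esj).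
pose b := (a + eps)%R.
have db : (d%:R < b)%R by rewrite (lt_trans da)// ltrDl.
pose I0 := fine (bracket_integral d b).
have I0_gt0 : (0 < I0)%R by exact: bracket_integral_gt0.
pose phi r := (c * (tail r * r `^ (- b)))%R.
have mphi : measurable_fun setT phi.
  apply: measurable_funM; first exact: measurable_cst.
  by apply: measurable_funM; [exact: measurable_indic|exact: measurable_powR].
have phi0 r : (0 <= phi r)%R by rewrite !mulr_ge0 ?powR_ge0.
pose f (x : plane) := phi (enorm x.2).
have mf : measurable_fun setT f.
  by apply: (measurableT_comp mphi); apply: measurable_enorm.
have mtail K s : measurable_fun setT (fun t : R => (K * (tail t * t `^ (- s)))%R%:E : \bar R).
  apply/measurable_EFinP; apply: measurable_funM; first exact: measurable_cst.
  by apply: measurable_funM; [exact: measurable_indic|exact: measurable_powR].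
exists f; split => //.
  have mPsi : measurable_fun setT (fun r => ((r `^ mu * `|phi r|) `^ p)%:E : \bar R).
    apply/measurable_EFinP; apply: (measurableT_comp (@measurable_powR _ _)).
    apply: measurable_funM; first exact: measurable_powR.
    exact: measurableT_comp.
  rewrite weighted_normE// (integral_planes hjn); last 2 first.
  - by apply/measurable_EFinP; exact: measurable_weighted.
  - by move=> x; rewrite lee_fin powR_ge0.
  rewrite (integral_plane_radial (Psi := fun r => ((r `^ mu * `|phi r|) `^ p)%:E) hjn mPsi); last first.
    by move=> r; rewrite lee_fin powR_ge0.
  rewrite (_ : mint _ = mint (fun r => (c `^ p * (tail r * r `^ (- (eps * p))))%R%:E)); last first.
    apply: eq_mint => r r0; rewrite -EFinM /phi ger0_norm; last by rewrite !mulr_ge0 ?powR_ge0.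
    congr (_%:E); rewrite tailE; case: (1 <= r)%R; last first.
      by rewrite !mul0r !mulr0 powR0 ?gt_eqF// mulr0.
    rewrite !mul1r mulrCA powRM ?powR_ge0 ?mulr_ge0 ?powR_ge0//.
    rewrite mulrCA -powRD ?(gt_eqF r0) ?implybT// -powRrM -powRD ?(gt_eqF r0) ?implybT//.
    congr (_ * _ `^ _)%R; rewrite mulrBl mulrDl ap; ring.
  rewrite mint_tail_scale ?powR_ge0// cp -EFinM.
  rewrite -(mulr1 (eps * p / sj)%R) cancel// mulr1 mulfV ?(gt_eqF sj0)//.
  by rewrite poweR_EFin powR1.
rewrite (eq_weighted_norm p%:E nu (psi := fun x => fine (rext f x))); last first.
  by move=> x px; exact: (radonE E12 dE1 dE2 ZZ ZP px mf).
have mrf := measurable_fine_radon_ext E1 E2 Z mf.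
rewrite weighted_normE// (integral_planes hkn); last 2 first.
- by apply/measurable_EFinP; exact: measurable_weighted.
- by move=> x; rewrite lee_fin powR_ge0.
(* [- s] is [(nu + d - b) * p], the exponent of the [p]-th power of the weighted transform; the
   polar density [r ^ (n - k)] turns it into the tail [r ^ (- (eps * p))], as for [f]. *)
pose s := ((n - k)%:R + eps * p)%R.
pose Psi r := ((c * I0) `^ p * (tail r * r `^ (- s)))%R%:E : \bar R.
have Psi0 r : 0 <= Psi r by rewrite lee_fin !mulr_ge0 ?powR_ge0.
have -> : ((sk / sj) `^ p^-1 * I0)%:E = (\int[@plane_measure R n k]_x Psi (enorm x.2)) `^ p^-1.
  rewrite (integral_plane_radial hkn (mtail _ _) Psi0).
  rewrite (_ : mint _ = mint (fun r => ((c * I0) `^ p * (tail r * r `^ (- (eps * p))))%R%:E)); last first.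
    apply: eq_mint => r r0; rewrite -EFinM; congr (_%:E).
    rewrite 2!(mulrCA (r `^ _)%R) -powRD ?(gt_eqF r0) ?implybT//.
    by rewrite /s opprD addrA subrr add0r.
  rewrite mint_tail_scale ?powR_ge0// (powRM _ c0 (ltW I0_gt0)) cp -EFinM -/sk.
  have -> : (sk * (eps * p / sj * I0 `^ p / (eps * p)) = sk / sj * I0 `^ p)%R.
    exact: cancel.
  rewrite poweR_EFin (powRM _ (divr_ge0 (ltW sk0) (ltW sj0)) (powR_ge0 _ _)) -powRrM.
  have -> : (p / p = 1)%R by rewrite mulfV ?gt_eqF.
  by rewrite (powRr1 (ltW I0_gt0)).
apply: gt0_ler_poweR.
- by rewrite invr_ge0 ltW.
- by rewrite in_itv/= leey andbT; apply: integral_ge0 => x _; exact: Psi0.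
- by rewrite in_itv/= leey andbT; apply: integral_ge0 => x _; rewrite lee_fin powR_ge0.
apply: ae_ge0_le_integral => //.
- by apply: (measurableT_comp (mtail _ _)); apply: measurable_enorm.
- by move=> x _; rewrite lee_fin powR_ge0.
- by apply/measurable_EFinP; exact: measurable_weighted.
apply: filterS (ae_planes hkn) => x [px x0] _.
have r0 := gt0_enorm x0; rewrite lee_fin tailE.
have [r1|_] := boolP (1 <= enorm x.2)%R; last by rewrite mul0r mulr0 powR_ge0.
rewrite mul1r (radon_ext_radial dE2 ZZ ZP mphi phi0 px x0).
have -> : \int[lebesgue_rV d]_w (phi (enorm x.2 * bracket w)%R)%:E =
    ((c * enorm x.2 `^ (- b))%:E * I0%:E).
  rewrite -bracket_integral_fin// -ge0_integralTZl.
  - apply: eq_integral => w _; rewrite -EFinM; congr (_%:E).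
    have b1 : (1 <= bracket w)%R.
      by rewrite -[leLHS]sqrtr1 /bracket ler_sqrt ?lerDl ?dot_ge0// addr_ge0 ?dot_ge0.
    rewrite /phi tailE mulr_ege1// mul1r powRM ?mulrA//; first exact: ltW.
    exact: le_trans b1.
  - apply/measurable_EFinP; apply: (measurableT_comp (@measurable_powR _ _)).
    exact: measurable_bracket.
  - by move=> w; rewrite lee_fin powR_ge0.
  - by rewrite lee_fin mulr_ge0 ?powR_ge0.
rewrite -!EFinM [fine _%:E]/= ger0_norm; last first.
  by rewrite !mulr_ge0 ?powR_ge0 ?(ltW I0_gt0).
have -> : (enorm x.2 `^ nu * (enorm x.2 `^ d%:R * (c * enorm x.2 `^ (- b) * I0)) =
    (c * I0) * enorm x.2 `^ (nu + d%:R - b))%R.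
  have pD u v : (enorm x.2 `^ (u + v) = enorm x.2 `^ u * enorm x.2 `^ v)%R.
    by rewrite powRD// (gt_eqF r0) implybT.
  rewrite !pD; ring.
rewrite (powRM _ (mulr_ge0 c0 (ltW I0_gt0)) (powR_ge0 _ _)) -powRrM.
rewrite (_ : (nu + d%:R - b) * p = - s)%R ?lexx//.
rewrite /s /b mulrBl mulrDl nup (mulrDl a) ap !natrB ?(ltnW hjk) ?(ltnW hkn) ?(ltnW hjn)//; ring.
Qed.

End radon_lower.

(** * The constant and the conclusion *)

Section radon_norm.
Context {R : realType}.

Lemma recip_conj (p p' : \bar R) : (1 <= p)%E -> (p^-1 + p'^-1 = 1)%E ->
  recip p' = 1 - recip p.
Proof.
move=> p1; rewrite /recip.
have -> : (p^-1)%E = (fine p^-1)%:E.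
  case: p p1 => [r r1|_|//]; last by rewrite invey.
  by rewrite inver gt_eqF// (lt_le_trans ltr01).
case: (p'^-1)%E => [y| |]//; rewrite -EFinD => -[<-] /=.
by rewrite addrAC subrr add0r.
Qed.

(** With [q] for 1/p, the arguments of Gamma are those of [bracket_integralE] at [mu + (n - j) * q],
    rewritten with 1/p' = 1 - q. *)
Lemma radon_norm_constant (n j k : nat) (mu q : R) : (j < k)%N -> (k < n)%N ->
  (k - j)%:R < mu + (n - j)%:R * q ->
  (sphere_area (n - k).-1 / sphere_area (n - j).-1) `^ q *
    fine (bracket_integral (k - j) (mu + (n - j)%:R * q)) =
  pi `^ ((k%:R - j%:R) / 2) * (sphere_area (n - k - 1) / sphere_area (n - j - 1)) `^ q *
  (Gamma ((mu + n%:R * q - k%:R + j%:R * (1 - q)) / 2)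
   / Gamma ((mu + n%:R * q - j%:R * q) / 2)).
Proof.
move=> hjk hkn da; rewrite bracket_integralE//= !subn1.
have -> : mu + n%:R * q - k%:R + j%:R * (1 - q) = mu + (n - j)%:R * q - (k - j)%:R.
  by rewrite !natrB ?(ltnW hjk) ?(ltnW (ltn_trans hjk hkn))//; ring.
have -> : mu + n%:R * q - j%:R * q = mu + (n - j)%:R * q.
  by rewrite natrB ?(ltnW (ltn_trans hjk hkn))//; ring.
by rewrite natrB ?(ltnW hjk)// mulrA [X in X * _ = _]mulrC.
Qed.

End radon_norm.

Theorem theorem1p2 (R : realType) (n j k : nat) (p p' : \bar R) (mu nu : R)
    (hjk : (j < k)%N) (hkn : (k < n)%N)
    (hp : (1 <= p)%E) (hpp' : (p^-1 + p'^-1 = 1)%E)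
    (hmu : mu > k%:R - n%:R * recip p - j%:R * recip p')
    (hnu : nu = mu - (k%:R - j%:R) * recip p') :
  [/\ forall f : {vspace 'rV[R]_n} * 'rV[R]_n -> R, weighted_Lp j p mu f ->
        {ae plane_measure k, forall tau, planes k tau -> radon_converges j k f tau},
      bounded_linear_operator j k p mu nu (@radon R n j k) &
      operator_norm j k p mu nu (@radon R n j k) =
        (pi `^ ((k%:R - j%:R) / 2)
         * (sphere_area (n - k - 1) / sphere_area (n - j - 1)) `^ recip p
         * (Gamma ((mu + n%:R * recip p - k%:R + j%:R * recip p') / 2)
            / Gamma ((mu + n%:R * recip p - j%:R * recip p) / 2)))%:E].
Proof.
pose q := recip p; have qE : recip p' = 1 - q by exact: recip_conj.
rewrite qE in hmu hnu *.
have hjn := ltn_trans hjk hkn.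
(* A reference flag: [E1] inside [E2], a frame [Z] of the complement of [E1] in [E2], and a unit
   vector [e] orthogonal to [E2], which exists as [k < n]. *)
have [|E2 _ dE2] := @exists_subspace R n fullv k; first by rewrite dimvf /dim/= mul1n ltnW.
have [|E1 E12 dE1] := @exists_subspace R n E2 j; first by rewrite dE2 ltnW.
have dE12 : \dim (orthv E1 :&: E2) = (k - j)%N by rewrite dim_orthv_cap// dE1 dE2.
have ZZ := frame_orth dE12; have ZP := frame_orthproj dE12.
set Z := frame _ _ in ZZ ZP.
have dO2 : \dim (orthv E2) = (n - k)%N by rewrite dim_orthv dE2.
have [e eE2 e1] : exists2 e, e \in orthv E2 & dot e e = 1.
  have nk : (0 < n - k)%N by rewrite subn_gt0.
  pose t : 'rV[R]_(n - k) := delta_mx 0 (Ordinal nk).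
  exists (t *m frame (n - k) (orthv E2)); first exact: mulmx_frame_mem.
  by rewrite (dot_mulmx _ _ (frame_orth dO2)) /dot trmx_delta mul_delta_mx mxE !eqxx.
pose a := mu + (n - j)%:R * q.
have djk : (k - j)%:R = k%:R - j%:R :> R by rewrite natrB// ltnW.
(* [a - (k - j)] is the difference of the two sides of the hypothesis on [mu]. *)
have da : (k - j)%:R < a.
  rewrite -subr_gt0 /a !natrB ?(ltnW hjk) ?(ltnW hjn)//.
  by move: hmu; rewrite -subr_gt0 -/q; congr (0 < _); ring.
rewrite -radon_norm_constant// -/q -/a.
set S := _ `^ q; have S0 : 0 < S by rewrite powR_gt0// divr_gt0// sphere_area_gt0.
have C0 : 0 <= S * fine (bracket_integral (k - j) a).
  by rewrite mulr_ge0 ?(ltW S0)// ltW// bracket_integral_gt0.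
have mem_sup (f : {vspace 'rV[R]_n} * 'rV[R]_n -> R) : measurable_fun setT f -> (weighted_norm j p mu f <= 1)%E ->
    (weighted_norm k p nu (radon j k f) <= operator_norm j k p mu nu (@radon R n j k))%E.
  move=> mf f1; apply: ereal_sup_ubound; exists f => //; split => //; split.
    exact: measurable_funTS.
  by rewrite (le_lt_trans f1)// ltry.
suff [bound lower] : (forall f : {vspace 'rV[R]_n} * 'rV[R]_n -> R, measurable_fun setT f -> (weighted_norm j p mu f < +oo)%E ->
    {ae plane_measure k, forall x, (radon_ext E1 E2 Z (fun x => `|f x|%R) x < +oo)%E} /\
    (weighted_norm k p nu (fun x => fine (radon_ext E1 E2 Z f x)) <=
     (S * fine (bracket_integral (k - j) a))%:E * weighted_norm j p mu f)%E) /\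
    ((S * fine (bracket_integral (k - j) a))%:E <=
     operator_norm j k p mu nu (@radon R n j k))%E.
  split.
  - by move=> f; exact: (radon_converges_ae E12 dE1 dE2 ZZ ZP bound).
  - exact: (radon_bounded E12 dE1 dE2 ZZ ZP hjk hkn eE2 e1 C0 bound).
  - apply/eqP; rewrite eq_le lower andbT.
    exact: (operator_norm_radon_le E12 dE1 dE2 ZZ ZP C0 bound).
move: hp @q qE hmu hnu @a da @S S0 C0 mem_sup.
case: p {hpp'} => [r| |]// r1 q _ _ hnu a da S S0 C0 mem_sup.
  rewrite lee_fin in r1; have r0 : 0 < r by exact: lt_le_trans r1.
  have qr : q = r^-1 by rewrite /q /recip inver gt_eqF.
  have ar : a * r = mu * r + (n - j)%:R by rewrite /a qr mulrDl divfK// gt_eqF.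
  have nur : nu * r = mu * r - (k - j)%:R * (r - 1).
    by rewrite hnu -djk qr mulrBl -mulrA [(1 - _) * r]mulrBl mul1r mulVf// gt_eqF.
  split.
    by move=> f mf ff; rewrite /S qr; exact: (radon_bound_fin E12 dE1 dE2 ZZ ZP hjk hkn eE2 e1).
  (* Divide by [S], take the functions for [eps = 1 / (i + 1)], and pass to the limit by
     [bracket_integral_le]. *)
  rewrite EFinM -bracket_integral_fin// -lee_pdivlMl//.
  apply: bracket_integral_le => i; rewrite lee_pdivlMl//.
  have e0 : 0 < i.+1%:R^-1 :> R by rewrite invr_gt0.
  have [f [mf f1]] := radon_lower_fin E12 dE1 dE2 ZZ ZP hjk hkn r1 ar nur da e0.
  rewrite bracket_integral_fin ?(lt_trans da) ?ltrDl// -EFinM /S qr => /le_trans; apply.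
  exact: mem_sup.
have q0 : q = 0 by rewrite /q /recip invey.
have aE : a = mu by rewrite /a q0 mulr0 addr0.
have S1 : S = 1 by rewrite /S q0 powRr0.
have nuE : nu = mu - (k - j)%:R by rewrite hnu -djk q0 subr0 mulr1.
rewrite S1 mul1r aE in da *; split.
  by move=> f mf ff; exact: (radon_bound_infty E12 dE1 dE2 ZZ ZP hjk hkn eE2 e1).
have [f [mf f1]] := radon_lower_infty E12 dE1 dE2 ZZ ZP hjk hkn nuE da.
by move=> /le_trans; apply; exact: mem_sup.
Qed.
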